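(* Let $r\ge1$ be an integer, let $\mathbb K$ be a field of characteristic $0$, and let $\chi\colon\operatorname{End}_{\mathcal C^{\mathcal T}_{\mathrm{univ}}}(\mathbf 1)\to\mathbb K$ be a character. Then the symmetric monoidal category $\mathcal C_\chi$ is tensor generated by a rigid object $W$ that comes with the structure of a closed $\Lambda_r$-Frobenius algebra, and $\operatorname{End}_{\mathcal C_\chi}(\mathbf 1)\cong\mathbb K$. Moreover, if $\Sigma$ is a closed surface with an $r$-spin structure, then the invariant in $\operatorname{End}_{\mathcal C_\chi}(\mathbf 1)\cong\mathbb K$ that $W$ (i.e. the $r$-spin TQFT corresponding to $W$) assigns to $\Sigma$ is exactly $\chi(\Sigma)$.
   Context: **$r$-spin TQFTs.** $\operatorname{Spin}_2^r$ is the $r$-fold cover $\operatorname{SO}_2\to\operatorname{SO}_2$, $x\mapsto x^r$; an $r$-spin structure on an oriented surface $\Sigma$ is a $\operatorname{Spin}_2^r$-principal bundle $P$ with a bundle map $q\colon P\to F_\Sigma$ to the oriented orthonormal frame bundle with $q(x.p)=x^r.q(p)$. $\operatorname{Bord}_2^r$ is the symmetric monoidal category of closed 1-manifolds $S$ with an $r$-spin structure on $S\times\mathbb R$ and diffeomorphism classes of compact $r$-spin bordisms; its connected objects are the circles $S^1_a$, $a\in\mathbb Z/r$. An $r$-spin TQFT in $\mathcal C$ is a symmetric monoidal functor $\operatorname{Bord}_2^r\to\mathcal C$. Known theorem (Stern–Szegedy): these are equivalent to closed $\Lambda_r$-Frobenius algebras in $\mathcal C$ (with $C_a$ the value on $S^1_a$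 and structure maps the values on pairs of pants and discs). **Closed $\Lambda_r$-Frobenius algebras.** Let $\mathcal C$ be symmetric monoidal with braiding $\sigma$. A closed $\Lambda_r$-Frobenius algebra in $\mathcal C$ consists of objects $C_a$ ($a\in\mathbb Z/r$) and morphisms $\mu_{a,b}\colon C_a\otimes C_b\to C_{a+b-1}$, $\eta_1\colon\mathbf 1\to C_1$, $\Delta_{a,b}\colon C_{a+b+1}\to C_a\otimes C_b$, $\varepsilon_{-1}\colon C_{-1}\to\mathbf 1$. Put $\delta_a=\Delta_{a,-a}\circ\eta_1$ and $N_a=(\varepsilon_{-1}\circ\mu_{-a,a}\otimes 1_{C_a})\circ(1_{C_{-a}}\otimes\sigma_{C_a,C_a})\circ(\delta_{-a}\otimes 1_{C_a})\colon C_a\to C_a$. The axioms (for all $a,b,c,d\in\mathbb Z/r$) are: associativity $\mu_{a+b-1,c}(\mu_{a,b}\otimes1)=\mu_{a,b+c-1}(1\otimes\mu_{b,c})$; coassociativity $(\Delta_{a,b}\otimes1)\Delta_{a+b+1,c}=(1\otimes\Delta_{b,c})\Delta_{a,b+c+1}$; unitality $\mu_{1,a}(\eta_1\otimes1)=1=\mu_{a,1}(1\otimes\eta_1)$; counitality $(\varepsilon_{-1}\otimes1)\Delta_{-1,a}=1=(1\otimes\varepsilon_{-1})\Delta_{a,-1}$; Frobenius relation, for $a+b=c+d+2$: $(1\otimes\mu_{d-b+1,b})(\Delta_{c,a-c-1}\otimes1)=(\mu_{a,c-a+1}\otimes1)(1\otimes\Delta_{b-d-1,d})$; commutativity $\mu_{b,a}(N_b^{1-a}\otimes1)=\mu_{a,b}\circ\sigma_{C_b,C_a}=\mu_{b,a}(1\otimes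 N_a^{b-1})$; twist relations $N_a^a=1$ and $\mu_{a,-a}(N_a^b\otimes1)\delta_a=\mu_{a+b-1,-a-b+1}(N_{a+b-1}^b\otimes1)\delta_{a+b-1}$; and $N_a^r=1$. In an idempotent complete additive $\mathcal C$ such an algebra is encoded by one object $W=\bigoplus_aC_a$ with structure tensors $P_0,\dots,P_{r-1}\colon W\to W$ (orthogonal idempotents summing to $1_W$, with $C_a=\operatorname{Im}P_a$), $\mu\colon W^{\otimes2}\to W$, $\Delta\colon W\to W^{\otimes2}$, $\varepsilon\colon W\to\mathbf 1$, $\eta\colon\mathbf 1\to W$ (the sums of the components). Let $\mathcal T$ be the theory consisting of all these axioms (including the idempotent relations and the compatibility of $\mu,\Delta,\varepsilon,\eta$ with the grading), written as equations between linear combinations of string diagrams in these tensors. **The category $\mathcal C_{\mathrm{univ}}^{\mathcal T}$.** Let $\operatorname{Con}^{p,q}$ be the $\mathbb K$-vector space freely spanned by equivalence classes of string diagrams with $q$ inputs and $p$ outputs built from boxes labelled by the structure tensors or $1_W$, where strings may be permuted and output strings may be connected to input strings (forming also loops); two diagrams are equivalent if they define the same morphism $W^{\otimes q}\to W^{\otimes p}$ for every dualisable object with structure tensors of the given type. $\mathcal C_{\mathrm{univ}}$ has as objects formal finite direct sums of $W^{a,b}=W^{\otimes a}\otimes(W^* )^{\otimes b}$, and $\operatorname{Hom}(W^{a,b},W^{c,d})=\operatorname{Con}^{b+c,a+d}$ with composition by connecting strings. $\mathcal C_{\mathrm{univ}}^{\mathcal T}$ is the quotient of $\mathcal C_{\mathrm{univ}}$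 by the tensor ideal generated by the axioms $\mathcal T$; symmetric monoidal $\mathbb K$-linear functors from it to an (idempotent complete) $\mathcal D$ correspond to closed $\Lambda_r$-Frobenius algebras in $\mathcal D$. Every closed $r$-spin surface $\Sigma$ defines an element, again written $\Sigma$, of $\operatorname{End}_{\mathcal C_{\mathrm{univ}}^{\mathcal T}}(\mathbf 1)$, and this commutative $\mathbb K$-algebra is the polynomial algebra on the set of diffeomorphism classes of closed connected $r$-spin surfaces. **Characters and $\mathcal C_\chi$.** A character is a $\mathbb K$-algebra homomorphism $\chi\colon\operatorname{End}_{\mathcal C_{\mathrm{univ}}^{\mathcal T}}(\mathbf 1)\to\mathbb K$ (equivalently, an arbitrary assignment of scalars to diffeomorphism classes of closed connected $r$-spin surfaces). A morphism $f\colon X\to Y$ in $\mathcal C_{\mathrm{univ}}^{\mathcal T}$ is $\chi$-negligible if $\chi(\operatorname{tr}(f\circ g))=0$ for all $g\colon Y\to X$. The $\chi$-negligible morphisms form a tensor ideal $\mathcal N_\chi$, and $\mathcal C_\chi$ is the Karoubian (idempotent) envelope of $\mathcal C_{\mathrm{univ}}^{\mathcal T}/\mathcal N_\chi$. ''Tensor generated by $W$'' means every object is a direct summand of a finite direct sum of objects $W^{\otimes a}\otimes(W^* )^{\otimes b}$. *)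

(* Defs.v *)
From HB Require Import structures.
From mathcomp Require Import all_boot all_order all_algebra.

Set Implicit Arguments.
Unset Strict Implicit.
Unset Printing Implicit Defensive.

Import GRing.Theory.
Local Open Scope ring_scope.

(******************************************************************************)
(* Hom-sets are types with an equivalence relation [heq] (written f === g),   *)
(* so that passing to a quotient category only changes [heq].  The operations *)
(* [symmon] are kept apart from the axioms [symmon_laws].                     *)
(******************************************************************************)

Declare Scope cat_scope.
Delimit Scope cat_scope with cat.
Local Open Scope cat_scope.

Record symmon := SymMon {
  ob :> Type;
  Mor : ob -> ob -> Type;
  heq : forall X Y, Mor X Y -> Mor X Y -> Prop;
  idm : forall X, Mor X X;
  compm : forall X Y Z, Mor Y Z -> Mor X Y -> Mor X Z;
  unit_ob : ob;
  tens : ob -> ob -> ob;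
  tensm : forall X Y X' Y',
    Mor X Y -> Mor X' Y' -> Mor (tens X X') (tens Y Y');
  assoc : forall X Y Z, Mor (tens (tens X Y) Z) (tens X (tens Y Z));
  associ : forall X Y Z, Mor (tens X (tens Y Z)) (tens (tens X Y) Z);
  lun : forall X, Mor (tens unit_ob X) X;
  luni : forall X, Mor X (tens unit_ob X);
  run : forall X, Mor (tens X unit_ob) X;
  runi : forall X, Mor X (tens X unit_ob);
  braid : forall X Y, Mor (tens X Y) (tens Y X)
}.

Arguments Mor {s} X Y : rename.
Arguments heq {s X Y} f g : rename.
Arguments idm {s} X : rename.
Arguments compm {s X Y Z} g f : rename.
Arguments unit_ob {s} : rename.
Arguments tens {s} X Y : rename.
Arguments tensm {s X Y X' Y'} f g : rename.
Arguments assoc {s} X Y Z : rename.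
Arguments associ {s} X Y Z : rename.
Arguments lun {s} X : rename.
Arguments luni {s} X : rename.
Arguments run {s} X : rename.
Arguments runi {s} X : rename.
Arguments braid {s} X Y : rename.

Notation "f === g" := (heq f g) (at level 70, no associativity) : cat_scope.
Notation "g ∘ f" := (compm g f) (at level 40, left associativity) : cat_scope.
Notation "X ⊗ Y" := (tens X Y) (at level 35, right associativity) : cat_scope.
Notation "f ⊠ g" := (tensm f g) (at level 35, right associativity) : cat_scope.

Record symmon_laws (D : symmon) : Prop := SymMonLaws {
  heq_refl : forall (X Y : D) (f : Mor X Y), f === f;
  heq_sym : forall (X Y : D) (f g : Mor X Y), f === g -> g === f;
  heq_trans : forall (X Y : D) (f g h : Mor X Y), f === g -> g === h -> f === h;
  comp_congr : forall (X Y Z : D) (g g' : Mor Y Z) (f f' : Mor X Y),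
    g === g' -> f === f' -> g ∘ f === g' ∘ f';
  comp_idl : forall (X Y : D) (f : Mor X Y), idm Y ∘ f === f;
  comp_idr : forall (X Y : D) (f : Mor X Y), f ∘ idm X === f;
  comp_assoc : forall (X Y Z T : D) (h : Mor Z T) (g : Mor Y Z) (f : Mor X Y),
    h ∘ (g ∘ f) === (h ∘ g) ∘ f;
  tens_congr : forall (X Y X' Y' : D) (f g : Mor X Y) (f' g' : Mor X' Y'),
    f === g -> f' === g' -> f ⊠ f' === g ⊠ g';
  tens_id : forall X Y : D, idm X ⊠ idm Y === idm (X ⊗ Y);
  tens_comp : forall (X Y Z X' Y' Z' : D) (g : Mor Y Z) (f : Mor X Y)
      (g' : Mor Y' Z') (f' : Mor X' Y'),
    (g ∘ f) ⊠ (g' ∘ f') === (g ⊠ g') ∘ (f ⊠ f');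
  assocK : forall X Y Z : D, associ X Y Z ∘ assoc X Y Z === idm _;
  associK : forall X Y Z : D, assoc X Y Z ∘ associ X Y Z === idm _;
  assoc_nat : forall (X Y Z X' Y' Z' : D)
      (f : Mor X X') (g : Mor Y Y') (h : Mor Z Z'),
    assoc X' Y' Z' ∘ ((f ⊠ g) ⊠ h) === (f ⊠ (g ⊠ h)) ∘ assoc X Y Z;
  lunK : forall X : D, luni X ∘ lun X === idm _;
  luniK : forall X : D, lun X ∘ luni X === idm _;
  lun_nat : forall (X Y : D) (f : Mor X Y),
    lun Y ∘ (idm unit_ob ⊠ f) === f ∘ lun X;
  runK : forall X : D, runi X ∘ run X === idm _;
  runiK : forall X : D, run X ∘ runi X === idm _;
  run_nat : forall (X Y : D) (f : Mor X Y),
    run Y ∘ (f ⊠ idm unit_ob) === f ∘ run X;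
  pentagon : forall X Y Z T : D,
    assoc X Y (Z ⊗ T) ∘ assoc (X ⊗ Y) Z T
    === (idm X ⊠ assoc Y Z T) ∘ assoc X (Y ⊗ Z) T ∘ (assoc X Y Z ⊠ idm T);
  triangle : forall X Y : D,
    (idm X ⊠ lun Y) ∘ assoc X unit_ob Y === run X ⊠ idm Y;
  braid_nat : forall (X Y X' Y' : D) (f : Mor X X') (g : Mor Y Y'),
    braid X' Y' ∘ (f ⊠ g) === (g ⊠ f) ∘ braid X Y;
  braidK : forall X Y : D, braid Y X ∘ braid X Y === idm _;
  hexagon : forall X Y Z : D,
    assoc Y Z X ∘ braid X (Y ⊗ Z) ∘ assoc X Y Z
    === (idm Y ⊠ braid X Z) ∘ assoc Y X Z ∘ (braid X Y ⊠ idm Z)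
}.

Record linsymmon (K : fieldType) := LinSymMon {
  lbase :> symmon;
  hzero : forall X Y : lbase, Mor X Y;
  hadd : forall X Y : lbase, Mor X Y -> Mor X Y -> Mor X Y;
  hscale : forall X Y : lbase, K -> Mor X Y -> Mor X Y
}.

Arguments hzero {K l X Y} : rename.
Arguments hadd {K l X Y} f g : rename.
Arguments hscale {K l X Y} c f : rename.

Notation "f ⊞ g" := (hadd f g) (at level 50, left associativity) : cat_scope.
Notation "c ·: f" := (hscale c f) (at level 36, right associativity) : cat_scope.
Notation "f ⊟ g" := (hadd f (hscale (- 1) g))
  (at level 50, left associativity) : cat_scope.

Record linsymmon_laws (K : fieldType) (D : linsymmon K) : Prop :=
  LinSymMonLaws {
  base_laws : symmon_laws D;
  add_congr : forall (X Y : D) (f f' g g' : Mor X Y),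
    f === f' -> g === g' -> f ⊞ g === f' ⊞ g';
  scale_congr : forall (X Y : D) c (f f' : Mor X Y),
    f === f' -> c ·: f === c ·: f';
  add_assoc : forall (X Y : D) (f g h : Mor X Y), f ⊞ (g ⊞ h) === f ⊞ g ⊞ h;
  add_comm : forall (X Y : D) (f g : Mor X Y), f ⊞ g === g ⊞ f;
  add_zero : forall (X Y : D) (f : Mor X Y), hzero ⊞ f === f;
  add_opp : forall (X Y : D) (f : Mor X Y), f ⊟ f === hzero;
  scale_one : forall (X Y : D) (f : Mor X Y), 1 ·: f === f;
  scale_scale : forall (X Y : D) c c' (f : Mor X Y),
    c ·: (c' ·: f) === (c * c') ·: f;
  scale_addr : forall (X Y : D) c (f g : Mor X Y),
    c ·: (f ⊞ g) === (c ·: f) ⊞ (c ·: g);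
  scale_addl : forall (X Y : D) c c' (f : Mor X Y),
    (c + c') ·: f === (c ·: f) ⊞ (c' ·: f);
  comp_addl : forall (X Y Z : D) (g g' : Mor Y Z) (f : Mor X Y),
    (g ⊞ g') ∘ f === (g ∘ f) ⊞ (g' ∘ f);
  comp_addr : forall (X Y Z : D) (g : Mor Y Z) (f f' : Mor X Y),
    g ∘ (f ⊞ f') === (g ∘ f) ⊞ (g ∘ f');
  comp_scalel : forall (X Y Z : D) c (g : Mor Y Z) (f : Mor X Y),
    (c ·: g) ∘ f === c ·: (g ∘ f);
  comp_scaler : forall (X Y Z : D) c (g : Mor Y Z) (f : Mor X Y),
    g ∘ (c ·: f) === c ·: (g ∘ f);
  tens_addl : forall (X Y X' Y' : D) (f f' : Mor X Y) (g : Mor X' Y'),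
    (f ⊞ f') ⊠ g === (f ⊠ g) ⊞ (f' ⊠ g);
  tens_addr : forall (X Y X' Y' : D) (f : Mor X Y) (g g' : Mor X' Y'),
    f ⊠ (g ⊞ g') === (f ⊠ g) ⊞ (f ⊠ g');
  tens_scalel : forall (X Y X' Y' : D) c (f : Mor X Y) (g : Mor X' Y'),
    (c ·: f) ⊠ g === c ·: (f ⊠ g);
  tens_scaler : forall (X Y X' Y' : D) c (f : Mor X Y) (g : Mor X' Y'),
    f ⊠ (c ·: g) === c ·: (f ⊠ g)
}.

Record duality (D : symmon) (X : D) := Dual {
  dob : D;
  ev : Mor (dob ⊗ X) unit_ob;
  coev : Mor unit_ob (X ⊗ dob);
  zig : run X ∘ (idm X ⊠ ev) ∘ assoc X dob X ∘ (coev ⊠ idm X) ∘ luni X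
        === idm X;
  zag : lun dob ∘ (ev ⊠ idm dob) ∘ associ dob X dob ∘ (idm dob ⊠ coev)
        ∘ runi dob === idm dob
}.

Definition cat_trace (D : symmon) (X : D) (d : duality X) (f : Mor X X) :
    Mor (unit_ob : D) unit_ob :=
  ev d ∘ braid X (dob d) ∘ (f ⊠ idm (dob d)) ∘ coev d.

Section Powers.
Variable D : symmon.

Definition pow (X : D) (n : nat) : D := iter n (tens X) unit_ob.

Fixpoint pow_split (X : D) (m n : nat) : Mor (pow X (m + n)) (pow X m ⊗ pow X n) :=
  match m with
  | 0 => luni (pow X n)
  | m'.+1 => associ X (pow X m') (pow X n) ∘ (idm X ⊠ pow_split X m' n)
  end.

Fixpoint pow_join (X : D) (m n : nat) : Mor (pow X m ⊗ pow X n) (pow X (m + n)) :=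
  match m with
  | 0 => lun (pow X n)
  | m'.+1 => (idm X ⊠ pow_join X m' n) ∘ assoc X (pow X m') (pow X n)
  end.

Definition mid4 (X Y Z T : D) : Mor ((X ⊗ Y) ⊗ (Z ⊗ T)) ((X ⊗ Z) ⊗ (Y ⊗ T)) :=
  associ X Z (Y ⊗ T)
  ∘ (idm X ⊠ (assoc Z Y T ∘ (braid Y Z ⊠ idm T) ∘ associ Y Z T))
  ∘ assoc X Y (Z ⊗ T).

(* The i-th factor of X^n is connected with the i-th factor of Xs^n. *)
Fixpoint ev_pow (X Xs : D) (e : Mor (Xs ⊗ X) unit_ob) (n : nat) :
    Mor (pow Xs n ⊗ pow X n) unit_ob :=
  match n with
  | 0 => lun unit_ob
  | n'.+1 => lun unit_ob ∘ (e ⊠ ev_pow e n') ∘ mid4 Xs (pow Xs n') X (pow X n')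
  end.

Fixpoint coev_pow (X Xs : D) (c : Mor unit_ob (X ⊗ Xs)) (n : nat) :
    Mor unit_ob (pow X n ⊗ pow Xs n) :=
  match n with
  | 0 => luni unit_ob
  | n'.+1 => mid4 X Xs (pow X n') (pow Xs n') ∘ (c ⊠ coev_pow c n') ∘ luni unit_ob
  end.

Fixpoint hpow (X : D) (f : Mor X X) (n : nat) : Mor X X :=
  if n is n'.+1 then f ∘ hpow f n' else idm X.

End Powers.

(******************************************************************************)
(* Z/r is 'I_(r.-1.+1), which is Z/r also for r = 1 (r = 0 is never used).    *)
(* Degrees that are equal only propositionally are handled by giving the      *)
(* structure maps the target (resp. source) degree as an extra argument,      *)
(* together with the equation it has to satisfy.                              *)
(******************************************************************************)

Notation "''Zmod_' r" := 'I_(r.-1.+1)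
  (at level 8, r at level 2, format "''Zmod_' r") : type_scope.

Section FrobeniusAlgebra.
Variable r : nat.

Definition z1 : 'Zmod_r := inZp 1.

Record frobdata (D : symmon) := FrobData {
  fC : 'Zmod_r -> D;
  fmu : forall a b c, c = a + b - z1 -> Mor (fC a ⊗ fC b) (fC c);
  feta : Mor unit_ob (fC z1);
  fDelta : forall a b c, c = a + b + z1 -> Mor (fC c) (fC a ⊗ fC b);
  feps : Mor (fC (- z1)) unit_ob
}.

Arguments fC {D} f a : rename.
Arguments fmu {D} f {a b c} e : rename.
Arguments feta {D} f : rename.
Arguments fDelta {D} f {a b c} e : rename.
Arguments feps {D} f : rename.

Fact deg_delta (a : 'Zmod_r) : z1 = a + - a + z1.
Proof. by rewrite addrN add0r. Qed.

Fact deg_deltaN (a : 'Zmod_r) : z1 = - a + a + z1.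
Proof. by rewrite addNr add0r. Qed.

Fact deg_pair (a : 'Zmod_r) : - z1 = a + - a - z1.
Proof. by rewrite addrN sub0r. Qed.

Fact deg_pairN (a : 'Zmod_r) : - z1 = - a + a - z1.
Proof. by rewrite addNr sub0r. Qed.

Section Relations.
Variables (D : symmon) (A : frobdata D).
Local Notation C := (fC A).

Definition fdelta (a b : 'Zmod_r) (e : z1 = a + b + z1) :
    Mor unit_ob (C a ⊗ C b) :=
  fDelta A e ∘ feta A.

Definition fN (a : 'Zmod_r) : Mor (C a) (C a) :=
  lun (C a)
  ∘ ((feps A ∘ fmu A (deg_pairN a)) ⊠ idm (C a))
  ∘ associ (C (- a)) (C a) (C a)
  ∘ (idm (C (- a)) ⊠ braid (C a) (C a))
  ∘ assoc (C (- a)) (C a) (C a)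
  ∘ (fdelta (deg_deltaN a) ⊠ idm (C a))
  ∘ luni (C a).

(* N_a ^ b; the axiom N_a ^ r = 1 makes the choice of the representative of b
   in {0, ..., r - 1} immaterial. *)
Definition fNpow (a b : 'Zmod_r) : Mor (C a) (C a) := hpow (fN a) b.

Definition ftwist (a b : 'Zmod_r) : Mor unit_ob (C (- z1)) :=
  fmu A (deg_pair a) ∘ (fNpow a b ⊠ idm (C (- a))) ∘ fdelta (deg_delta a).

(* The axioms, as the set of pairs (left hand side, right hand side) *)
Inductive frob_axiom : forall X Y : D, Mor X Y -> Mor X Y -> Prop :=
| ax_assoc a b c ab bc abc
    (e1 : ab = a + b - z1) (e2 : abc = ab + c - z1)
    (e3 : bc = b + c - z1) (e4 : abc = a + bc - z1) :
    frob_axiom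
      (fmu A e2 ∘ (fmu A e1 ⊠ idm (C c)))
      (fmu A e4 ∘ (idm (C a) ⊠ fmu A e3) ∘ assoc (C a) (C b) (C c))
| ax_coassoc a b c ab bc abc
    (e1 : ab = a + b + z1) (e2 : abc = ab + c + z1)
    (e3 : bc = b + c + z1) (e4 : abc = a + bc + z1) :
    frob_axiom
      (assoc (C a) (C b) (C c) ∘ (fDelta A e1 ⊠ idm (C c)) ∘ fDelta A e2)
      ((idm (C a) ⊠ fDelta A e3) ∘ fDelta A e4)
| ax_unitl a (e : a = z1 + a - z1) :
    frob_axiom (fmu A e ∘ (feta A ⊠ idm (C a)) ∘ luni (C a)) (idm (C a))
| ax_unitr a (e : a = a + z1 - z1) :
    frob_axiom (fmu A e ∘ (idm (C a) ⊠ feta A) ∘ runi (C a)) (idm (C a))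
| ax_counitl a (e : a = - z1 + a + z1) :
    frob_axiom (lun (C a) ∘ (feps A ⊠ idm (C a)) ∘ fDelta A e) (idm (C a))
| ax_counitr a (e : a = a + - z1 + z1) :
    frob_axiom (run (C a) ∘ (idm (C a) ⊠ feps A) ∘ fDelta A e) (idm (C a))
  (* x = a - c - 1 = d - b + 1 and y = b - d - 1 = c - a + 1, which is
     possible exactly when a + b = c + d + 2 *)
| ax_frobenius a b c d x y
    (e1 : a = c + x + z1) (e2 : d = x + b - z1)
    (e3 : b = y + d + z1) (e4 : c = a + y - z1) :
    frob_axiom
      ((idm (C c) ⊠ fmu A e2) ∘ assoc (C c) (C x) (C b)
       ∘ (fDelta A e1 ⊠ idm (C b)))
      ((fmu A e4 ⊠ idm (C d)) ∘ associ (C a) (C y) (C d)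
       ∘ (idm (C a) ⊠ fDelta A e3))
| ax_comml a b c (e : c = b + a - z1) (e' : c = a + b - z1) :
    frob_axiom (fmu A e ∘ (fNpow b (z1 - a) ⊠ idm (C a)))
               (fmu A e' ∘ braid (C b) (C a))
| ax_commr a b c (e : c = b + a - z1) (e' : c = a + b - z1) :
    frob_axiom (fmu A e' ∘ braid (C b) (C a))
               (fmu A e ∘ (idm (C b) ⊠ fNpow a (b - z1)))
| ax_twist a : frob_axiom (fNpow a a) (idm (C a))
| ax_twist_pair a b : frob_axiom (ftwist a b) (ftwist (a + b - z1) b)
| ax_order a : frob_axiom (hpow (fN a) r) (idm (C a)).

Definition frob_laws : Prop :=
  forall (X Y : D) (f g : Mor X Y), frob_axiom f g -> f === g.

End Relations.

Record frob_mor (D : symmon) (A B : frobdata D) := FrobMor {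
  fmor : forall a, Mor (fC A a) (fC B a);
  fmor_mu : forall a b c (e : c = a + b - z1),
    fmor c ∘ fmu A e === fmu B e ∘ (fmor a ⊠ fmor b);
  fmor_eta : fmor z1 ∘ feta A === feta B;
  fmor_Delta : forall a b c (e : c = a + b + z1),
    fDelta B e ∘ fmor c === (fmor a ⊠ fmor b) ∘ fDelta A e;
  fmor_eps : feps B ∘ fmor (- z1) === feps A
}.

Definition frob_isomorphic (D : symmon) (A B : frobdata D) : Prop :=
  exists (phi : frob_mor A B) (psi : frob_mor B A),
    forall a, fmor psi a ∘ fmor phi a === idm _ /\
              fmor phi a ∘ fmor psi a === idm _.

End FrobeniusAlgebra.

Arguments frobdata r D : clear implicits.
Arguments fC {r D} f a : rename.
Arguments fmu {r D} f {a b c} e : rename.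
Arguments feta {r D} f : rename.
Arguments fDelta {r D} f {a b c} e : rename.
Arguments feps {r D} f : rename.

Record symmonfun (B D : symmon) := SymMonFun {
  Fob :> B -> D;
  Fhom : forall X Y : B, Mor X Y -> Mor (Fob X) (Fob Y);
  Fone : Mor unit_ob (Fob unit_ob);
  Fonei : Mor (Fob unit_ob) unit_ob;
  Ften : forall X Y : B, Mor (Fob X ⊗ Fob Y) (Fob (X ⊗ Y));
  Fteni : forall X Y : B, Mor (Fob (X ⊗ Y)) (Fob X ⊗ Fob Y);
  F_congr : forall (X Y : B) (f g : Mor X Y), f === g -> Fhom f === Fhom g;
  F_id : forall X : B, Fhom (idm X) === idm (Fob X);
  F_comp : forall (X Y Z : B) (g : Mor Y Z) (f : Mor X Y),
    Fhom (g ∘ f) === Fhom g ∘ Fhom f;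
  FoneK : Fonei ∘ Fone === idm _;
  FoneiK : Fone ∘ Fonei === idm _;
  FtenK : forall X Y : B, Fteni X Y ∘ Ften X Y === idm _;
  FteniK : forall X Y : B, Ften X Y ∘ Fteni X Y === idm _;
  Ften_nat : forall (X Y X' Y' : B) (f : Mor X Y) (g : Mor X' Y'),
    Fhom (f ⊠ g) ∘ Ften X X' === Ften Y Y' ∘ (Fhom f ⊠ Fhom g);
  F_assoc : forall X Y Z : B,
    Fhom (assoc X Y Z) ∘ Ften (X ⊗ Y) Z ∘ (Ften X Y ⊠ idm (Fob Z))
    === Ften X (Y ⊗ Z) ∘ (idm (Fob X) ⊠ Ften Y Z)
        ∘ assoc (Fob X) (Fob Y) (Fob Z);
  F_lun : forall X : B,
    Fhom (lun X) ∘ Ften unit_ob X ∘ (Fone ⊠ idm (Fob X)) === lun (Fob X);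
  F_run : forall X : B,
    Fhom (run X) ∘ Ften X unit_ob ∘ (idm (Fob X) ⊠ Fone) === run (Fob X);
  F_braid : forall X Y : B,
    Fhom (braid X Y) ∘ Ften X Y === Ften Y X ∘ braid (Fob X) (Fob Y)
}.

Arguments Fhom {B D} F {X Y} f : rename.
Arguments Fone {B D} F : rename.
Arguments Fonei {B D} F : rename.
Arguments Ften {B D} F X Y : rename.
Arguments Fteni {B D} F X Y : rename.

Record symmon_nat (B D : symmon) (F G : symmonfun B D) := SymMonNat {
  ntr :> forall X : B, Mor (F X) (G X);
  ntr_nat : forall (X Y : B) (f : Mor X Y),
    ntr Y ∘ Fhom F f === Fhom G f ∘ ntr X;
  ntr_one : ntr unit_ob ∘ Fone F === Fone G;
  ntr_ten : forall X Y : B,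
    ntr (X ⊗ Y) ∘ Ften F X Y === Ften G X Y ∘ (ntr X ⊠ ntr Y)
}.

Definition frob_image (r : nat) (B D : symmon) (F : symmonfun B D)
    (S : frobdata r B) : frobdata r D :=
  @FrobData r D (fun a => F (fC S a))
    (fun a b c e => Fhom F (fmu S e) ∘ Ften F (fC S a) (fC S b))
    (Fhom F (feta S) ∘ Fone F)
    (fun a b c e => Fteni F (fC S a) (fC S b) ∘ Fhom F (fDelta S e))
    (Fonei F ∘ Fhom F (feps S)).

(* The r-spin bordism category, through the theorem of Stern and Szegedy:     *)
(* the circles S^1_a with the pairs of pants and discs form a closed          *)
(* Lambda_r-Frobenius algebra, and evaluation on it is, for every symmetric   *)
(* monoidal category D, an equivalence from symmetric monoidal functors to D  *)
(* (and monoidal transformations) to closed Lambda_r-Frobenius algebras in D. *)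
(* This determines the category up to symmetric monoidal equivalence.  In the *)
(* geometric model [heq] is "diffeomorphic relative to the boundary" and the  *)
(* endomorphisms of the unit object (the empty 1-manifold) are the closed     *)
(* r-spin surfaces.                                                           *)
Record spin_bordism (r : nat) := SpinBordism {
  bord :> symmon;
  bord_laws : symmon_laws bord;
  circles : frobdata r bord;
  circles_laws : frob_laws circles;
  tqft_exists : forall D : symmon, symmon_laws D ->
    forall A : frobdata r D, frob_laws A ->
    exists Z : symmonfun bord D, frob_isomorphic (frob_image Z circles) A;
  tqft_ff : forall D : symmon, symmon_laws D ->
    forall (Z Z' : symmonfun bord D)
           (phi : frob_mor (frob_image Z circles) (frob_image Z' circles)),
    exists t : symmon_nat Z Z',
      (forall a, t (fC circles a) === fmor phi a) /\
      (forall t' : symmon_nat Z Z',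
        (forall a, t' (fC circles a) === fmor phi a) ->
        forall X, t' X === t X)
}.

Definition closed_surface (r : nat) (Bord : spin_bordism r) : Type :=
  Mor (unit_ob : Bord) unit_ob.

Definition tqft_of (r : nat) (Bord : spin_bordism r) (D : symmon)
    (A : frobdata r D) (Z : symmonfun Bord D) : Prop :=
  frob_isomorphic (frob_image Z (circles Bord)) A.

Definition surface_invariant (r : nat) (Bord : spin_bordism r) (D : symmon)
    (Z : symmonfun Bord D) (Sigma : closed_surface Bord) :
    Mor (unit_ob : D) unit_ob :=
  Fonei Z ∘ Fhom Z Sigma ∘ Fone Z.

Section StringDiagrams.
Variable r : nat.

Inductive box := BoxP of 'Zmod_r | BoxMu | BoxDelta | BoxEps | BoxEta.

Definition box_in (b : box) : nat :=
  match b with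
  | BoxP _ => 1 | BoxMu => 2 | BoxDelta => 1 | BoxEps => 1 | BoxEta => 0
  end.

Definition box_out (b : box) : nat :=
  match b with
  | BoxP _ => 1 | BoxMu => 1 | BoxDelta => 2 | BoxEps => 0 | BoxEta => 1
  end.

(* A level of a diagram: a bracketed list of strings running forwards (SW) or
   backwards (SWd).  Backward strings occur inside a diagram where an output
   is led back to an input by means of the turns [sev] and [scoev]. *)
Inductive strings := SW | SWd | SNone | SPair of strings & strings.

Definition wpow (n : nat) : strings := iter n (SPair SW) SNone.

Inductive diagram : strings -> strings -> Type :=
| sbox (b : box) : diagram (wpow (box_in b)) (wpow (box_out b))
| sid A : diagram A A
| scomp A B C : diagram B C -> diagram A B -> diagram A C
| sten A B A' B' :
    diagram A B -> diagram A' B' -> diagram (SPair A A') (SPair B B')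
| sassoc A B C : diagram (SPair (SPair A B) C) (SPair A (SPair B C))
| sassoci A B C : diagram (SPair A (SPair B C)) (SPair (SPair A B) C)
| slun A : diagram (SPair SNone A) A
| sluni A : diagram A (SPair SNone A)
| srun A : diagram (SPair A SNone) A
| sruni A : diagram A (SPair A SNone)
| sbraid A B : diagram (SPair A B) (SPair B A)
| sev : diagram (SPair SWd SW) SNone
| scoev : diagram SNone (SPair SW SWd).

Section Evaluation.
Variables (D : symmon) (X : D) (d : duality X).

Fixpoint eval_strings (A : strings) : D :=
  match A with
  | SW => X
  | SWd => dob d
  | SNone => unit_ob
  | SPair A B => eval_strings A ⊗ eval_strings B
  end.

Definition structure_tensors : Type :=
  forall b : box, Mor (eval_strings (wpow (box_in b)))
                      (eval_strings (wpow (box_out b))).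

Fixpoint eval_diagram (t : structure_tensors) A B (f : diagram A B) :
    Mor (eval_strings A) (eval_strings B) :=
  match f in diagram A B return Mor (eval_strings A) (eval_strings B) with
  | sbox b => t b
  | sid A => idm _
  | scomp _ _ _ g f => eval_diagram t g ∘ eval_diagram t f
  | sten _ _ _ _ f g => eval_diagram t f ⊠ eval_diagram t g
  | sassoc _ _ _ => assoc _ _ _
  | sassoci _ _ _ => associ _ _ _
  | slun _ => lun _
  | sluni _ => luni _
  | srun _ => run _
  | sruni _ => runi _
  | sbraid _ _ => braid _ _
  | sev => ev d
  | scoev => coev d
  end.

End Evaluation.

(* Two diagrams are equivalent if they define the same morphism for every
   dualisable object with structure tensors of the given type. *)
Definition diagram_eq A B (f g : diagram A B) : Prop :=
  forall D : symmon, symmon_laws D ->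
  forall (X : D) (d : duality X) (t : structure_tensors d),
    eval_diagram t f === eval_diagram t g.

Definition diagrams : symmon :=
  @SymMon strings diagram diagram_eq sid scomp SNone SPair sten
    sassoc sassoci slun sluni srun sruni sbraid.

End StringDiagrams.

(* The free K-linear category on D: Hom-spaces are freely spanned by the
   classes of morphisms of D.  Two formal linear combinations agree if every
   K-valued function on the set of classes, extended linearly, takes the same
   value on them. *)
Section Linearisation.
Variables (K : fieldType) (D : symmon).

Definition lincomb (X Y : D) : Type := seq (K * Mor X Y).

Definition lc_eq (X Y : D) (s t : lincomb X Y) : Prop :=
  forall phi : Mor X Y -> K, (forall f g, f === g -> phi f = phi g) ->
    \sum_(p <- s) p.1 * phi p.2 = \sum_(p <- t) p.1 * phi p.2.

Definition lc1 (X Y : D) (f : Mor X Y) : lincomb X Y := [:: (1, f)].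

Definition linearisation : linsymmon K :=
  @LinSymMon K
    (@SymMon D lincomb lc_eq
      (fun X => lc1 (idm X))
      (fun X Y Z g f => [seq (p.1 * q.1, p.2 ∘ q.2) | p <- g, q <- f])
      unit_ob tens
      (fun X Y X' Y' f g => [seq (p.1 * q.1, p.2 ⊠ q.2) | p <- f, q <- g])
      (fun X Y Z => lc1 (assoc X Y Z)) (fun X Y Z => lc1 (associ X Y Z))
      (fun X => lc1 (lun X)) (fun X => lc1 (luni X))
      (fun X => lc1 (run X)) (fun X => lc1 (runi X))
      (fun X Y => lc1 (braid X Y)))
    (fun X Y => [::])
    (fun X Y s t => s ++ t)
    (fun X Y c s => [seq (c * p.1, p.2) | p <- s]).

End Linearisation.

Section Universal.
Variables (r : nat) (K : fieldType).

Definition lin_diagrams : linsymmon K := linearisation K (diagrams r).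

Local Notation L := lin_diagrams.
Local Notation W := (SW : L).
Local Notation Wd := (SWd : L).

(* q inputs and p outputs; in C_univ, Mor W^(a,b) W^(c,d) = Con (b + c) (a + d) *)
Definition Con (p q : nat) : Type := @Mor L (pow W q) (pow W p).

(* A diagram with a + d inputs and b + c outputs is the same
   thing as one from W^a (W^ * )^b to W^c (W^ * )^d: the last d inputs become
   dual outputs and the first b outputs become dual inputs. *)

Definition Wab (x : nat * nat) : L := pow W x.1 ⊗ pow Wd x.2.
Definition Wev n : @Mor L (pow Wd n ⊗ pow W n) unit_ob :=
  @ev_pow L W Wd (lc1 K (sev r : @Mor (diagrams r) _ _)) n.
Definition Wcoev n : @Mor L unit_ob (pow W n ⊗ pow Wd n) :=
  @coev_pow L W Wd (lc1 K (scoev r : @Mor (diagrams r) _ _)) n.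

Definition bend (x y : nat * nat) (f : @Mor L (Wab x) (Wab y)) :
    Con (x.2 + y.1) (x.1 + y.2) :=
  let a := pow W x.1 in let b := x.2 in let c := pow W y.1 in let d := y.2 in
  pow_join W b y.1
  ∘ (idm (pow W b) ⊠
      (run c ∘ (idm c ⊠ Wev d) ∘ assoc c (pow Wd d) (pow W d)
       ∘ (f ⊠ idm (pow W d))))
  ∘ (idm (pow W b) ⊠
      ((braid (pow Wd b) a ⊠ idm (pow W d)) ∘ associ (pow Wd b) a (pow W d)))
  ∘ assoc (pow W b) (pow Wd b) (a ⊗ pow W d)
  ∘ (Wcoev b ⊠ idm (a ⊗ pow W d))
  ∘ luni (a ⊗ pow W d)
  ∘ pow_split W x.1 d.

Definition unbend (x y : nat * nat) (f : Con (x.2 + y.1) (x.1 + y.2)) :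
    @Mor L (Wab x) (Wab y) :=
  let a := pow W x.1 in let b := x.2 in let c := pow W y.1 in let d := y.2 in
  lun (Wab y)
  ∘ (Wev b ⊠ idm (Wab y))
  ∘ associ (pow Wd b) (pow W b) (Wab y)
  ∘ (idm (pow Wd b) ⊠ assoc (pow W b) c (pow Wd d))
  ∘ (idm (pow Wd b) ⊠
      ((pow_split W b y.1 ∘ f ∘ pow_join W x.1 d) ⊠ idm (pow Wd d)))
  ∘ (idm (pow Wd b) ⊠ associ a (pow W d) (pow Wd d))
  ∘ assoc (pow Wd b) a (pow W d ⊗ pow Wd d)
  ∘ (braid a (pow Wd b) ⊠ Wcoev d)
  ∘ runi (Wab x).

(* The full subcategory of C_univ on the objects W^(a,b) *)

Definition opair (x y : nat * nat) : nat * nat := ((x.1 + y.1)%N, (x.2 + y.2)%N).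
Definition uhom (x y : nat * nat) : Type := Con (x.2 + y.1) (x.1 + y.2).

Definition sh (x y : nat * nat) : @Mor L (Wab (opair x y)) (Wab x ⊗ Wab y) :=
  mid4 (pow W x.1) (pow W y.1) (pow Wd x.2) (pow Wd y.2)
  ∘ (pow_split W x.1 y.1 ⊠ pow_split Wd x.2 y.2).

Definition shi (x y : nat * nat) : @Mor L (Wab x ⊗ Wab y) (Wab (opair x y)) :=
  (pow_join W x.1 y.1 ⊠ pow_join Wd x.2 y.2)
  ∘ mid4 (pow W x.1) (pow Wd x.2) (pow W y.1) (pow Wd y.2).

Definition u0 : @Mor L (Wab (0, 0)%N) unit_ob := lun unit_ob.
Definition u0i : @Mor L unit_ob (Wab (0, 0)%N) := luni unit_ob.

Definition univ_W : linsymmon K :=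
  @LinSymMon K
    (@SymMon (nat * nat)%type uhom
      (fun x y f g => heq (f : @Mor L _ _) g)
      (fun x => bend (idm (Wab x)))
      (fun x y z g f => bend (unbend g ∘ unbend f))
      (0, 0)%N opair
      (fun x y x' y' f g => bend (shi y y' ∘ (unbend f ⊠ unbend g) ∘ sh x x'))
      (fun x y z => @bend (opair (opair x y) z) (opair x (opair y z))
        (shi x (opair y z) ∘ (idm (Wab x) ⊠ shi y z)
         ∘ assoc (Wab x) (Wab y) (Wab z)
         ∘ (sh x y ⊠ idm (Wab z)) ∘ sh (opair x y) z))
      (fun x y z => @bend (opair x (opair y z)) (opair (opair x y) z)
        (shi (opair x y) z ∘ (shi x y ⊠ idm (Wab z))
         ∘ associ (Wab x) (Wab y) (Wab z)
         ∘ (idm (Wab x) ⊠ sh y z) ∘ sh x (opair y z)))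
      (fun x => @bend (opair (0, 0)%N x) x
        (lun (Wab x) ∘ (u0 ⊠ idm (Wab x)) ∘ sh (0, 0)%N x))
      (fun x => @bend x (opair (0, 0)%N x)
        (shi (0, 0)%N x ∘ (u0i ⊠ idm (Wab x)) ∘ luni (Wab x)))
      (fun x => @bend (opair x (0, 0)%N) x
        (run (Wab x) ∘ (idm (Wab x) ⊠ u0) ∘ sh x (0, 0)%N))
      (fun x => @bend x (opair x (0, 0)%N)
        (shi x (0, 0)%N ∘ (idm (Wab x) ⊠ u0i) ∘ runi (Wab x)))
      (fun x y => @bend (opair x y) (opair y x)
        (shi y x ∘ braid (Wab x) (Wab y) ∘ sh x y)))
    (fun x y => (hzero : @Mor L _ _))
    (fun x y f g => (hadd (f : @Mor L _ _) g))
    (fun x y c f => (hscale c (f : @Mor L _ _))).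

End Universal.

(* Formal finite direct sums; morphisms are matrices, f i j being the
   component from the i-th to the j-th summand. *)
Section DirectSums.
Variables (K : fieldType) (D : linsymmon K).

Record dsum := DSum { dsidx :> finType; dsfam : dsidx -> D }.

Arguments dsfam X i : clear implicits, rename.

Definition dhom (X Y : dsum) : Type := forall (i : X) (j : Y), Mor (dsfam X i) (dsfam Y j).
Definition dtens (X Y : dsum) : dsum := @DSum (X * Y)%type (fun p => dsfam X p.1 ⊗ dsfam Y p.2).
Definition dunit : dsum := @DSum unit (fun=> unit_ob).

Definition dmat (X Y : dsum) (s : X -> Y) (m : forall i, Mor (dsfam X i) (dsfam Y (s i))) :
    dhom X Y :=
  fun i j =>
  match s i =P j with
  | ReflectT e => eq_rect (s i) (fun j => Mor (dsfam X i) (dsfam Y j)) (m i) j e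
  | ReflectF _ => hzero
  end.

Definition direct_sums : linsymmon K :=
  @LinSymMon K
    (@SymMon dsum dhom
      (fun X Y f g => forall i j, f i j === g i j)
      (fun X => @dmat X X id (fun i => idm (dsfam X i)))
      (fun X Y Z g f => fun i k => \big[hadd/hzero]_(j : Y) (g j k ∘ f i j))
      dunit dtens
      (fun X Y X' Y' f g => fun i j => f i.1 j.1 ⊠ g i.2 j.2)
      (fun X Y Z => @dmat (dtens (dtens X Y) Z) (dtens X (dtens Y Z))
        (fun i => (i.1.1, (i.1.2, i.2)))
        (fun i => assoc (dsfam X i.1.1) (dsfam Y i.1.2) (dsfam Z i.2)))
      (fun X Y Z => @dmat (dtens X (dtens Y Z)) (dtens (dtens X Y) Z)
        (fun i => ((i.1, i.2.1), i.2.2))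
        (fun i => associ (dsfam X i.1) (dsfam Y i.2.1) (dsfam Z i.2.2)))
      (fun X => @dmat (dtens dunit X) X (fun i => i.2) (fun i => lun (dsfam X i.2)))
      (fun X => @dmat X (dtens dunit X) (fun i => (tt, i)) (fun i => luni (dsfam X i)))
      (fun X => @dmat (dtens X dunit) X (fun i => i.1) (fun i => run (dsfam X i.1)))
      (fun X => @dmat X (dtens X dunit) (fun i => (i, tt)) (fun i => runi (dsfam X i)))
      (fun X Y => @dmat (dtens X Y) (dtens Y X) (fun i => (i.2, i.1))
        (fun i => braid (dsfam X i.1) (dsfam Y i.2))))
    (fun X Y => fun i j => hzero)
    (fun X Y f g => fun i j => f i j ⊞ g i j)
    (fun X Y c f => fun i j => c ·: f i j).

Definition ds1 (X : D) : direct_sums := @DSum unit (fun=> X).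

End DirectSums.

Definition C_univ (r : nat) (K : fieldType) : linsymmon K :=
  direct_sums (univ_W r K).

Definition Wpq (r : nat) (K : fieldType) (a b : nat) : C_univ r K :=
  ds1 ((a, b) : univ_W r K).

Record tensor_ideal (K : fieldType) (D : linsymmon K)
    (J : forall X Y : D, Mor X Y -> Prop) : Prop := TensorIdeal {
  ideal_heq : forall (X Y : D) (f g : Mor X Y), f === g -> J X Y f -> J X Y g;
  ideal_zero : forall X Y : D, J X Y hzero;
  ideal_add : forall (X Y : D) (f g : Mor X Y),
    J X Y f -> J X Y g -> J X Y (f ⊞ g);
  ideal_scale : forall (X Y : D) c (f : Mor X Y), J X Y f -> J X Y (c ·: f);
  ideal_compl : forall (X Y Z : D) (g : Mor Y Z) (f : Mor X Y),
    J X Y f -> J X Z (g ∘ f);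
  ideal_compr : forall (X Y Z : D) (g : Mor Y Z) (f : Mor X Y),
    J Y Z g -> J X Z (g ∘ f);
  ideal_tensl : forall (X Y X' Y' : D) (g : Mor X' Y') (f : Mor X Y),
    J X Y f -> J _ _ (g ⊠ f);
  ideal_tensr : forall (X Y X' Y' : D) (g : Mor X' Y') (f : Mor X Y),
    J X Y f -> J _ _ (f ⊠ g)
}.

Definition generated_ideal (K : fieldType) (D : linsymmon K)
    (T : forall X Y : D, Mor X Y -> Mor X Y -> Prop) (X Y : D) (f : Mor X Y) :
    Prop :=
  forall J : (forall X Y : D, Mor X Y -> Prop), tensor_ideal J ->
    (forall (X Y : D) (g h : Mor X Y), T X Y g h -> J X Y (g ⊟ h)) -> J X Y f.

Definition quot_cat (K : fieldType) (D : linsymmon K)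
    (J : forall X Y : D, Mor X Y -> Prop) : linsymmon K :=
  @LinSymMon K
    (@SymMon D (@Mor D) (fun X Y f g => J X Y (f ⊟ g))
      idm (@compm D) unit_ob tens (@tensm D)
      assoc associ lun luni run runi braid)
    (@hzero K D) (@hadd K D) (@hscale K D).

Section Karoubi.
Variables (K : fieldType) (D : linsymmon K) (HD : linsymmon_laws D).

Record karob := KarOb {
  kob : D;
  kidem : Mor kob kob;
  kidemP : kidem ∘ kidem === kidem
}.

Record karhom (X Y : karob) := KarHom {
  kfun : Mor (kob X) (kob Y);
  kfunP : kidem Y ∘ (kfun ∘ kidem X) === kfun
}.

Let SD := base_laws HD.

Fact karm_subproof (X Y : karob) (f : Mor (kob X) (kob Y)) :
  kidem Y ∘ ((kidem Y ∘ (f ∘ kidem X)) ∘ kidem X) === kidem Y ∘ (f ∘ kidem X).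
Proof.
have A := comp_assoc SD; have R := heq_refl SD.
have fE : (f ∘ kidem X) ∘ kidem X === f ∘ kidem X.
  apply: (heq_trans SD (heq_sym SD (A _ _ _ _ _ _ _))).
  exact: (comp_congr SD (R _ _ f) (kidemP X)).
apply: (heq_trans SD (comp_congr SD (R _ _ _) (heq_sym SD (A _ _ _ _ _ _ _)))).
apply: (heq_trans SD (A _ _ _ _ _ _ _)).
exact: (comp_congr SD (kidemP Y) fE).
Qed.

Definition karm (X Y : karob) (f : Mor (kob X) (kob Y)) : karhom X Y :=
  KarHom (karm_subproof f).

Fact kartens_subproof (X Y : karob) :
  (kidem X ⊠ kidem Y) ∘ (kidem X ⊠ kidem Y) === kidem X ⊠ kidem Y.
Proof.
apply: (heq_trans SD (heq_sym SD (tens_comp SD _ _ _ _))).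
exact: (tens_congr SD (kidemP X) (kidemP Y)).
Qed.

Definition kartens (X Y : karob) : karob := KarOb (kartens_subproof X Y).

Definition karone : karob := KarOb (comp_idl SD (idm unit_ob)).

Definition karoubi : linsymmon K :=
  @LinSymMon K
    (@SymMon karob karhom (fun X Y f g => kfun f === kfun g)
      (fun X => karm (idm (kob X)))
      (fun X Y Z g f => karm (kfun g ∘ kfun f))
      karone kartens
      (fun X Y X' Y' f g =>
        @karm (kartens X X') (kartens Y Y') (kfun f ⊠ kfun g))
      (fun X Y Z => @karm (kartens (kartens X Y) Z) (kartens X (kartens Y Z))
        (assoc (kob X) (kob Y) (kob Z)))
      (fun X Y Z => @karm (kartens X (kartens Y Z)) (kartens (kartens X Y) Z)
        (associ (kob X) (kob Y) (kob Z)))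
      (fun X => @karm (kartens karone X) X (lun (kob X)))
      (fun X => @karm X (kartens karone X) (luni (kob X)))
      (fun X => @karm (kartens X karone) X (run (kob X)))
      (fun X => @karm X (kartens X karone) (runi (kob X)))
      (fun X Y => @karm (kartens X Y) (kartens Y X) (braid (kob X) (kob Y))))
    (fun X Y => karm hzero)
    (fun X Y f g => karm (kfun f ⊞ kfun g))
    (fun X Y c f => karm (c ·: kfun f)).

End Karoubi.

Record tensors (r : nat) (K : fieldType) (D : linsymmon K) (W : D) := Tensors {
  tP : 'Zmod_r -> Mor W W;
  tmu : Mor (W ⊗ W) W;
  tDelta : Mor W (W ⊗ W);
  teps : Mor W unit_ob;
  teta : Mor unit_ob W
}.

(* Objects with an endomorphism e, not required to be idempotent, which plays
   the role of the identity.  This serves to write the axioms for the objects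
   "Im P_a" as equations in D before P_a is known to be idempotent. *)
Record endo_ob (D : symmon) := EndoOb { eob : D; eend : Mor eob eob }.

Definition with_endo (D : symmon) : symmon :=
  @SymMon (endo_ob D) (fun X Y => Mor (eob X) (eob Y))
    (fun X Y f g => f === g)
    (fun X => eend X)
    (fun X Y Z g f => g ∘ f)
    (EndoOb (idm unit_ob))
    (fun X Y => EndoOb (eend X ⊠ eend Y))
    (fun X Y X' Y' f g => f ⊠ g)
    (fun X Y Z => assoc (eob X) (eob Y) (eob Z)
                  ∘ ((eend X ⊠ eend Y) ⊠ eend Z))
    (fun X Y Z => associ (eob X) (eob Y) (eob Z)
                  ∘ (eend X ⊠ (eend Y ⊠ eend Z)))
    (fun X => eend X ∘ lun (eob X))
    (fun X => luni (eob X) ∘ eend X)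
    (fun X => eend X ∘ run (eob X))
    (fun X => runi (eob X) ∘ eend X)
    (fun X Y => braid (eob X) (eob Y) ∘ (eend X ⊠ eend Y)).

Section Theory.
Variables (r : nat) (K : fieldType) (D : linsymmon K) (W : D).
Variable t : tensors r W.

Local Notation P := (tP t).

Definition endo_components : frobdata r (with_endo D) :=
  @FrobData r (with_endo D) (fun a => EndoOb (P a))
    (fun a b c _ => P c ∘ tmu t ∘ (P a ⊠ P b))
    (P (z1 r) ∘ teta t)
    (fun a b c _ => (P a ⊠ P b) ∘ tDelta t ∘ P c)
    (teps t ∘ P (- z1 r)).

Inductive theory : forall X Y : D, Mor X Y -> Mor X Y -> Prop :=
| th_idem a : theory (P a ∘ P a) (P a)
| th_orth a b : a != b -> theory (P a ∘ P b) hzero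
| th_sum : theory (\big[hadd/hzero]_a P a) (idm W)
| th_mu a b :
    theory (tmu t ∘ (P a ⊠ P b)) (P (a + b - z1 r) ∘ tmu t ∘ (P a ⊠ P b))
| th_Delta a b :
    theory ((P a ⊠ P b) ∘ tDelta t)
           ((P a ⊠ P b) ∘ tDelta t ∘ P (a + b + z1 r))
| th_eta : theory (P (z1 r) ∘ teta t) (teta t)
| th_eps : theory (teps t ∘ P (- z1 r)) (teps t)
| th_frob (X Y : with_endo D) (f g : Mor X Y) :
    frob_axiom endo_components f g ->
    theory (X := eob X) (Y := eob Y) f g.

Definition theory_quotient : linsymmon K := quot_cat (generated_ideal theory).

Fact theory_quotientP (X Y : D) (f g : Mor X Y) :
  theory f g -> (f : @Mor theory_quotient X Y) === g.
Proof. by move=> fg J _; apply. Qed.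

Variable HQ : linsymmon_laws theory_quotient.

Definition theory_im (a : 'Zmod_r) : karob theory_quotient :=
  KarOb (theory_quotientP (th_idem a)).

(* The closed Lambda_r-Frobenius algebra encoded by W, with C_a = Im P_a in the
   Karoubi envelope *)
Definition theory_algebra : frobdata r (karoubi HQ) :=
  @FrobData r (karoubi HQ) theory_im
    (fun a b c _ =>
      @karm _ _ HQ (kartens HQ (theory_im a) (theory_im b)) (theory_im c) (tmu t))
    (@karm _ _ HQ (karone HQ) (theory_im _) (teta t))
    (fun a b c _ =>
      @karm _ _ HQ (theory_im c) (kartens HQ (theory_im a) (theory_im b))
        (tDelta t))
    (@karm _ _ HQ (theory_im _) (karone HQ) (teps t)).

End Theory.

Section UniversalQuotient.
Variables (r : nat) (K : fieldType).

Definition univ_box (b : box r) : Con r K (box_out b) (box_in b) :=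
  lc1 K (sbox b : @Mor (diagrams r) _ _).

Definition univ_tensors : tensors r (Wpq r K 1 0) :=
  @Tensors r K (C_univ r K) (Wpq r K 1 0)
    (fun a => fun _ _ => univ_box (BoxP a))
    (fun _ _ => univ_box (BoxMu r))
    (fun _ _ => univ_box (BoxDelta r))
    (fun _ _ => univ_box (BoxEps r))
    (fun _ _ => univ_box (BoxEta r)).

Definition C_univ_T : linsymmon K := theory_quotient univ_tensors.

(* s is the element of End(1) defined by the closed r-spin surface Sigma. *)
Definition surface_element (HU : linsymmon_laws C_univ_T)
    (Bord : spin_bordism r)
    (Sigma : closed_surface Bord) (s : Mor (unit_ob : C_univ_T) unit_ob) : Prop :=
  exists Z : symmonfun Bord (karoubi HU),
    tqft_of (theory_algebra HU) Z /\ kfun (surface_invariant Z Sigma) === s.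

End UniversalQuotient.

Record algebra_hom (K : fieldType) (D : linsymmon K)
    (chi : Mor (unit_ob : D) unit_ob -> K) : Prop := AlgebraHom {
  chi_heq : forall f g, f === g -> chi f = chi g;
  chi_add : forall f g, chi (f ⊞ g) = chi f + chi g;
  chi_scale : forall c f, chi (c ·: f) = c * chi f;
  chi_comp : forall f g, chi (f ∘ g) = chi f * chi g;
  chi_id : chi (idm unit_ob) = 1
}.

Definition algebra_iso (K : fieldType) (D : linsymmon K)
    (theta : Mor (unit_ob : D) unit_ob -> K) : Prop :=
  [/\ algebra_hom theta,
      (forall f g, theta f = theta g -> f === g) &
      forall c, exists f, theta f = c].

(* The trace does not depend on the dual of Y used to form it. *)
Definition negligible (K : fieldType) (D : linsymmon K)
    (chi : Mor (unit_ob : D) unit_ob -> K) (X Y : D) (f : Mor X Y) : Prop :=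
  forall (g : Mor Y X) (d : duality Y), chi (cat_trace d (f ∘ g)) = 0.

(* C_univ^T / N_chi.  The category axioms for quotients are propositions about
   the operations above; [karoubi] takes a proof of them because e ⊠ f has to be
   an idempotent when e and f are. *)
Definition C_univ_T_mod (r : nat) (K : fieldType)
    (chi : Mor (unit_ob : C_univ_T r K) unit_ob -> K) : linsymmon K :=
  quot_cat (negligible chi).

Definition C_chi (r : nat) (K : fieldType)
    (chi : Mor (unit_ob : C_univ_T r K) unit_ob -> K)
    (HN : linsymmon_laws (C_univ_T_mod chi)) : linsymmon K :=
  karoubi HN.

Definition is_direct_sum (K : fieldType) (D : linsymmon K) (I : finType)
    (Y : I -> D) (S : D) : Prop :=
  exists (inj : forall i, Mor (Y i) S) (prj : forall i, Mor S (Y i)),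
    [/\ forall i, prj i ∘ inj i === idm (Y i),
        forall i j, i != j -> prj j ∘ inj i === hzero &
        \big[hadd/hzero]_i (inj i ∘ prj i) === idm S].

Definition is_summand (D : symmon) (X S : D) : Prop :=
  exists (i : Mor X S) (p : Mor S X), p ∘ i === idm X.

Definition tensor_generated (K : fieldType) (D : linsymmon K) (W : D)
    (d : duality W) : Prop :=
  forall X : D, exists (I : finType) (ab : I -> nat * nat) (S : D),
    is_direct_sum (fun i => pow W (ab i).1 ⊗ pow (dob d) (ab i).2) S /\
    is_summand X S.

(* Main.v *)
(* A morphism f : X -> Y of the universal category is negligible if and only if
   chi (b ∘ (f ⊠ 1_Z) ∘ a) = 0 for all contexts a : 1 -> X ⊗ Z and
   b : Y ⊗ Z -> 1: a trace is such a context, and conversely bending Z around with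
   the dual of Y turns a context into a trace.  In this form it is clear that the
   negligible morphisms are a tensor ideal, and, chi being multiplicative, that
   the ideal meets End(1) exactly in the kernel of chi; so End(1) becomes K.
   The universal algebra is mapped to C_chi, and since a TQFT is determined up to
   isomorphism by its algebra, its value on a closed surface is the image under
   chi of the value in the universal category.

   The rest is coherence.  The category of the W^(a,b) inherits its laws from the
   linear category of string diagrams along the strong monoidal equivalence that
   bends strings, and it is rigid because W is. *)

Require Import Defs.
From HB Require Import structures.
From mathcomp Require Import all_boot all_order all_algebra.
From Stdlib Require Import Setoid Morphisms.

Set Implicit Arguments.
Unset Strict Implicit.
Unset Printing Implicit Defensive.

Import GRing.Theory.
Local Open Scope ring_scope.
Local Open Scope cat_scope.

(* The operations of [univ_W] are those of [lin_diagrams] conjugated by [bend] and [unbend], so none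
   of its laws is visible directly. They are all pulled back at once, [unbend] being a faithful
   strong monoidal functor; this rests on the triangle identities for the powers of [W]. The
   diagrammatic arguments (straightening, pulling a strand across a cap, closing a trace) take place
   in categories that are not strict and whose equality is [heq]. They become manageable by letting
   tensor words act on right-bracketed stacks, where associators and unitors disappear, and by
   rewriting there with a free tail. A trace needs a dual, and [negligible] would hold vacuously at
   an object without one. So a dual is built for every object: for [W] from the turns, then for its
   powers, for the objects W^(a,b), for formal sums and in the quotient by the theory. The value of
   a surface is defined by functors into the envelope of [C_univ_T], whereas the theorem speaks of
   functors into [C_chi]. The quotient changes only the equality of morphisms, so a functor of the
   first kind becomes one of the second by coarsening [heq]. *)
Existing Class symmon_laws.
Existing Class linsymmon_laws.

#[export] Instance linsymmon_base (K : fieldType) (D : linsymmon K)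
  (HD : linsymmon_laws D) : symmon_laws D := base_laws HD.

#[export] Instance heq_equivalence (D : symmon) (HD : symmon_laws D) (X Y : D) :
  Equivalence (@heq D X Y).
Proof.
split.
- exact: (heq_refl HD).
- exact: (heq_sym HD).
- exact: (heq_trans HD).
Qed.

#[export] Instance compm_proper (D : symmon) (HD : symmon_laws D) (X Y Z : D) :
  Proper (heq ==> heq ==> heq) (@compm D X Y Z).
Proof. by move=> g g' gg f f' ff; apply: (comp_congr HD). Qed.

#[export] Instance tensm_proper (D : symmon) (HD : symmon_laws D)
  (X Y X' Y' : D) : Proper (heq ==> heq ==> heq) (@tensm D X Y X' Y').
Proof. by move=> g g' gg f f' ff; apply: (tens_congr HD). Qed.

#[export] Instance hadd_proper (K : fieldType) (D : linsymmon K)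
  (HD : linsymmon_laws D) (X Y : D) :
  Proper (heq ==> heq ==> heq) (@hadd K D X Y).
Proof. by move=> g g' gg f f' ff; apply: (add_congr HD). Qed.

#[export] Instance hscale_proper (K : fieldType) (D : linsymmon K)
  (HD : linsymmon_laws D) (X Y : D) (c : K) :
  Proper (heq ==> heq) (@hscale K D X Y c).
Proof. by move=> g g' gg; apply: (scale_congr HD). Qed.

#[export] Hint Extern 0 (heq _ _) => reflexivity : core.

(** * Consequences of the monoidal axioms *)

Section Basic.
Context {D : symmon} {HD : symmon_laws D}.

Lemma compA (X Y Z T : D) (h : Mor Z T) (g : Mor Y Z) (f : Mor X Y) :
  (h ∘ g) ∘ f === h ∘ (g ∘ f).
Proof. by rewrite (comp_assoc HD). Qed.

Lemma id_comp (X Y : D) (f : Mor X Y) : idm Y ∘ f === f.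
Proof. exact: (comp_idl HD). Qed.

Lemma comp_id (X Y : D) (f : Mor X Y) : f ∘ idm X === f.
Proof. exact: (comp_idr HD). Qed.

Lemma wh_comp (X Y Z T : D) (g : Mor Z T) (f : Mor Y Z) :
  idm X ⊠ (g ∘ f) === (idm X ⊠ g) ∘ (idm X ⊠ f).
Proof. by rewrite -(tens_comp HD) id_comp. Qed.

Lemma comp_wh (X Y Z T : D) (g : Mor Z T) (f : Mor Y Z) :
  (g ∘ f) ⊠ idm X === (g ⊠ idm X) ∘ (f ⊠ idm X).
Proof. by rewrite -(tens_comp HD) id_comp. Qed.

Lemma tens_split (X Y X' Y' : D) (f : Mor X Y) (g : Mor X' Y') :
  f ⊠ g === (f ⊠ idm Y') ∘ (idm X ⊠ g).
Proof. by rewrite -(tens_comp HD) id_comp comp_id. Qed.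

Lemma tens_split' (X Y X' Y' : D) (f : Mor X Y) (g : Mor X' Y') :
  f ⊠ g === (idm Y ⊠ g) ∘ (f ⊠ idm X').
Proof. by rewrite -(tens_comp HD) id_comp comp_id. Qed.

Lemma wh_id (X Y : D) : idm X ⊠ idm Y === idm (X ⊗ Y).
Proof. exact: (tens_id HD). Qed.

Lemma epi_of_section (X Y Z : D) (s : Mor X Y) (s' : Mor Y X) (f g : Mor Y Z) :
  s ∘ s' === idm Y -> f ∘ s === g ∘ s -> f === g.
Proof.
move=> ss fg; rewrite -(comp_id f) -(comp_id g) -ss !(comp_assoc HD).
by rewrite fg.
Qed.

(* With z arbitrary, these rewrite at every position of a composite bracketed to
   the right. *)
Lemma comp_eq_at (X Y Z : D) (g : Mor Y Z) (f : Mor X Y) (h : Mor X Z) T (z : Mor T X) :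
  g ∘ f === h -> g ∘ (f ∘ z) === h ∘ z.
Proof. by move=> E; rewrite (comp_assoc HD) E. Qed.

Lemma comp_id_at (X Y : D) (g : Mor Y X) (f : Mor X Y) T (z : Mor T X) :
  g ∘ f === idm X -> g ∘ (f ∘ z) === z.
Proof. by move=> E; rewrite (comp_assoc HD) E id_comp. Qed.

Lemma comp_eq2_at (X Y Z Y' : D) (g : Mor Y Z) (f : Mor X Y) (g' : Mor Y' Z)
    (f' : Mor X Y') T (z : Mor T X) :
  g ∘ f === g' ∘ f' -> g ∘ (f ∘ z) === g' ∘ (f' ∘ z).
Proof. by move=> E; rewrite !(comp_assoc HD) E. Qed.

Lemma lwh_unit_inj (X Y : D) (f g : Mor X Y) :
  idm unit_ob ⊠ f === idm unit_ob ⊠ g -> f === g.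
Proof.
move=> fg; apply: (epi_of_section (luniK HD X)).
by rewrite -!(lun_nat HD) fg.
Qed.

Lemma rwh_unit_inj (X Y : D) (f g : Mor X Y) :
  f ⊠ idm unit_ob === g ⊠ idm unit_ob -> f === g.
Proof.
move=> fg; apply: (epi_of_section (runiK HD X)).
by rewrite -!(run_nat HD) fg.
Qed.

(** Kelly's observation that this second triangle follows from the pentagon and the first one.
    Tensoring with [unit_ob] on the left is faithful, and after precomposition with the invertible
    [s] the pentagon reduces the claim to instances of [triangle]. *)
Lemma lun_assoc (X Y : D) : lun (X ⊗ Y) ∘ assoc unit_ob X Y === lun X ⊠ idm Y.
Proof.
apply: lwh_unit_inj.
pose s := assoc unit_ob (unit_ob ⊗ X) Y ∘ (assoc unit_ob unit_ob X ⊠ idm Y).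
pose s' := (associ unit_ob unit_ob X ⊠ idm Y) ∘ associ unit_ob (unit_ob ⊗ X) Y.
apply: (@epi_of_section _ _ _ s s').
  rewrite /s /s' compA (comp_id_at _ _) -?comp_wh ?(associK HD) ?wh_id //.
rewrite /s wh_comp !(comp_assoc HD).
have P := pentagon HD unit_ob unit_ob X Y; rewrite !compA in P *.
rewrite -P (comp_assoc HD) (triangle HD) -(wh_id X Y).
rewrite -(assoc_nat HD) -(triangle HD) comp_wh.
by rewrite (comp_assoc HD) (assoc_nat HD) !compA.
Qed.
End Basic.

(** * Coherence *)

(* A formal object A acts on objects by R |-> X1 ⊗ (X2 ⊗ (... ⊗ R)).  In this
   action all associators and unitors become identities ([mst]), and it
   is faithful ([stack_eq]): equations between composites of structural maps and
   generators may be checked on such right-bracketed stacks. *)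
Section Coherence.
Context {D : symmon} {HD : symmon_laws D}.

Inductive mo := At of D | Un | Te of mo & mo.

Fixpoint den (A : mo) : D :=
  match A with
  | At X => X
  | Un => unit_ob
  | Te A B => den A ⊗ den B
  end.

Fixpoint st (A : mo) (R : D) : D :=
  match A with
  | At X => X ⊗ R
  | Un => R
  | Te A B => st A (st B R)
  end.

Fixpoint stm (A : mo) R R' (h : Mor R R') : Mor (st A R) (st A R') :=
  match A with
  | At X => idm X ⊠ h
  | Un => h
  | Te A B => stm A (stm B h)
  end.

(** The canonical isomorphism that flattens the word [A] in front of the tail [R]. Coherence amounts
    to its compatibility with all structural maps ([mst_mden]). *)
Fixpoint kap (A : mo) R : Mor (den A ⊗ R) (st A R) :=
  match A with
  | At X => idm (X ⊗ R)
  | Un => lun R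
  | Te A B => kap A (st B R) ∘ ((idm (den A) ⊠ kap B R) ∘ assoc (den A) (den B) R)
  end.

Fixpoint kapi (A : mo) R : Mor (st A R) (den A ⊗ R) :=
  match A with
  | At X => idm (X ⊗ R)
  | Un => luni R
  | Te A B => associ (den A) (den B) R ∘ ((idm (den A) ⊠ kapi B R) ∘ kapi A (st B R))
  end.

#[export] Instance stm_proper A R R' : Proper (heq ==> heq) (@stm A R R').
Proof.
elim: A R R' => [X| |A IHA B IHB] R R' f g /= fg; [by rewrite fg|by []|].
by apply: IHA; apply: IHB.
Qed.

Lemma kapK A R : kapi A R ∘ kap A R === idm _.
Proof.
elim: A R => [X| |A IHA B IHB] R /=; [by rewrite id_comp|exact: (lunK HD)|].
rewrite !compA (comp_id_at _ (IHA _)) (comp_id_at _ (_ : _ === idm _)).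
  by rewrite (assocK HD).
by rewrite -wh_comp IHB wh_id.
Qed.

Lemma kapiK A R : kap A R ∘ kapi A R === idm _.
Proof.
elim: A R => [X| |A IHA B IHB] R /=; [by rewrite id_comp|exact: (luniK HD)|].
rewrite !compA (comp_id_at _ (associK HD _ _ _)) (comp_id_at _ (_ : _ === idm _)).
  exact: IHA.
by rewrite -wh_comp IHB wh_id.
Qed.

Lemma kap_nat A R R' (h : Mor R R') :
  kap A R' ∘ (idm (den A) ⊠ h) === stm A h ∘ kap A R.
Proof.
elim: A R R' h => [X| |A IHA B IHB] R R' h /=; [by rewrite id_comp comp_id|exact: (lun_nat HD)|].
rewrite !compA -(wh_id (den A)) (assoc_nat HD) (comp_eq2_at _ (_ : _ === (idm _ ⊠ _) ∘ (idm _ ⊠ _))).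
  by rewrite (comp_eq2_at _ (IHA _ _ _)).
by rewrite -!wh_comp IHB.
Qed.

Inductive me : mo -> mo -> Type :=
| Gen A B (f : Mor (den A) (den B)) : me A B
| Id A : me A A
| Comp A B C (g : me B C) (f : me A B) : me A C
| Ten A B A' B' (f : me A B) (g : me A' B') : me (Te A A') (Te B B')
| Assoc A B C : me (Te (Te A B) C) (Te A (Te B C))
| Associ A B C : me (Te A (Te B C)) (Te (Te A B) C)
| Lun A : me (Te Un A) A
| Luni A : me A (Te Un A)
| Run A : me (Te A Un) A
| Runi A : me A (Te A Un).

Fixpoint mden A B (e : me A B) : Mor (den A) (den B) :=
  match e in me A B return Mor (den A) (den B) with
  | Gen A B f => f
  | Id A => idm (den A)
  | Comp A B C g f => mden g ∘ mden f
  | Ten A B A' B' f g => mden f ⊠ mden g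
  | Assoc A B C => assoc (den A) (den B) (den C)
  | Associ A B C => associ (den A) (den B) (den C)
  | Lun A => lun (den A)
  | Luni A => luni (den A)
  | Run A => run (den A)
  | Runi A => runi (den A)
  end.

Fact stg_key : unit. Proof. exact: tt. Qed.

(** Conjugation of a generator by [kap]. It is locked so that a generator remains one block acting
    on the top of a stack. *)
Definition stg A B (f : Mor (den A) (den B)) R : Mor (st A R) (st B R) :=
  locked_with stg_key (kap B R ∘ ((f ⊠ idm R) ∘ kapi A R)).

(** For associators and unitors the source and target stacks are convertible, so that [idm] is well
    typed there. *)
Fixpoint mst A B (e : me A B) R : Mor (st A R) (st B R) :=
  match e in me A B return Mor (st A R) (st B R) with
  | Gen A B f => stg f R
  | Id A => idm (st A R)
  | Comp A B C g f => mst g R ∘ mst f R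
  | Ten A B A' B' f g => mst f (st B' R) ∘ stm A (mst g R)
  | Assoc A B C => idm _
  | Associ A B C => idm _
  | Lun A => idm _
  | Luni A => idm _
  | Run A => idm _
  | Runi A => idm _
  end.

Lemma stg_proper A B (f g : Mor (den A) (den B)) R : f === g -> stg f R === stg g R.
Proof. by move=> fg; rewrite /stg !unlock fg. Qed.

Lemma stg_nat A B (f : Mor (den A) (den B)) R R' (h : Mor R R') :
  stg f R' ∘ stm A h === stm B h ∘ stg f R.
Proof.
rewrite /stg !unlock !(comp_assoc HD) -kap_nat !compA.
have E : kapi A R' ∘ stm A h === (idm _ ⊠ h) ∘ kapi A R.
  apply: (epi_of_section (kapiK A R)).
  by rewrite compA -kap_nat (comp_id_at _ (kapK A R')) compA kapK comp_id.
rewrite E !(comp_eq2_at _ (_ : (f ⊠ idm _) ∘ (idm _ ⊠ h) === (idm _ ⊠ h) ∘ (f ⊠ idm _))) //.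
by rewrite -tens_split -tens_split'.
Qed.

Lemma kap_assoc A B C R :
  kap (Te A (Te B C)) R ∘ (assoc (den A) (den B) (den C) ⊠ idm R)
  === kap (Te (Te A B) C) R.
Proof.
rewrite /= !wh_comp !compA; have P := pentagon HD (den A) (den B) (den C) R.
rewrite !compA in P; rewrite -P.
by rewrite -(wh_id (den A)) (comp_eq2_at _ (assoc_nat HD _ _ _)).
Qed.

Lemma kap_lun A R : kap A R ∘ (lun (den A) ⊠ idm R) === kap (Te Un A) R.
Proof. by rewrite /= -lun_assoc (comp_eq2_at _ (lun_nat HD _)). Qed.

Lemma kap_run A R : kap A R ∘ (run (den A) ⊠ idm R) === kap (Te A Un) R.
Proof. by rewrite /= -(triangle HD). Qed.

Lemma mst_mden A B (e : me A B) R :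
  kap B R ∘ (mden e ⊠ idm R) === mst e R ∘ kap A R.
Proof.
(* This passes from a structural map to its inverse: the cases [Associ], [Luni] and [Runi] are
   deduced from [Assoc], [Lun] and [Run]. *)
have inv (X Y X' : D) (a : Mor Y X') b (m : Mor X Y) n :
    m ∘ n === idm _ -> a ∘ m === b -> b ∘ n === a.
  by move=> mn <-; rewrite compA mn comp_id.
elim: e R => /= [A1 B1 f|A1|A1 B1 C1 g IHg f IHf|A1 B1 A' B' f IHf g IHg|A1 B1 C1|A1 B1 C1|A1|A1|A1|A1] R;
  rewrite ?id_comp.
- by rewrite /stg !unlock !compA kapK comp_id.
- by rewrite wh_id comp_id.
- by rewrite comp_wh (comp_assoc HD) IHg !compA IHf.
- rewrite !compA (assoc_nat HD).
  have E : (idm (den B1) ⊠ kap B' R) ∘ (mden f ⊠ (mden g ⊠ idm R))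
      === (mden f ⊠ idm _) ∘ ((idm _ ⊠ mst g R) ∘ (idm _ ⊠ kap A' R)).
    by rewrite -(tens_comp HD) IHg id_comp -wh_comp -(tens_comp HD) id_comp comp_id.
  by rewrite (comp_eq_at _ E) !compA (comp_eq2_at _ (IHf _)) (comp_eq2_at _ (kap_nat _ _)).
- exact: kap_assoc.
- by apply: inv (kap_assoc _ _ _ _); rewrite -comp_wh (associK HD) wh_id.
- exact: kap_lun.
- by apply: inv (kap_lun _ _); rewrite -comp_wh (luniK HD) wh_id.
- exact: kap_run.
- by apply: inv (kap_run _ _); rewrite -comp_wh (runiK HD) wh_id.
Qed.

Lemma mst_gen A B (e : me A B) R : mst e R === stg (mden e) R.
Proof. by rewrite /stg !unlock (comp_assoc HD) mst_mden compA kapiK comp_id. Qed.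

Theorem stack_eq A B (e e' : me A B) :
  (forall R, mst e R === mst e' R) -> mden e === mden e'.
Proof.
(* The tail [unit_ob] already decides, since tensoring with it is faithful and [kap] can be
   cancelled. *)
move=> ee; apply: rwh_unit_inj.
have E := mst_mden e unit_ob; rewrite ee -mst_mden in E.
by rewrite -(id_comp (mden e ⊠ _)) -(id_comp (mden e' ⊠ _)) -!(kapK B) !compA E.
Qed.

Lemma eq_stack A B (e e' : me A B) R : mden e === mden e' -> mst e R === mst e' R.
Proof. by rewrite !mst_gen; apply: stg_proper. Qed.

End Coherence.

Arguments mo D : clear implicits.
Arguments mst {D A B} e R : simpl nomatch.
Arguments stg {D} A B f R : simpl never.

(** * Reification of morphisms and passage to stacks *)

Ltac reify_ob D X :=
  lazymatch X with
  | @tens _ ?A ?B => let a := reify_ob D A in let b := reify_ob D B in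
                     constr:(@Te D a b)
  | @unit_ob _ => constr:(@Un D)
  | _ => constr:(@At D X)
  end.

(** The braiding has no clause: unlike associators and unitors it is not trivial on stacks. It is
    reified as a generator, which [fold_st] later displays as [braid_st]. *)
Ltac reify_mor D f :=
  lazymatch f with
  | @compm _ _ _ _ ?g ?h =>
    let g' := reify_mor D g in let h' := reify_mor D h in constr:(Comp g' h')
  | @tensm _ _ _ _ _ ?g ?h =>
    let g' := reify_mor D g in let h' := reify_mor D h in constr:(Ten g' h')
  | @idm _ ?X => let X' := reify_ob D X in constr:(Id X')
  | @assoc _ ?X ?Y ?Z =>
    let X' := reify_ob D X in let Y' := reify_ob D Y in
    let Z' := reify_ob D Z in constr:(Assoc X' Y' Z')
  | @associ _ ?X ?Y ?Z =>
    let X' := reify_ob D X in let Y' := reify_ob D Y in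
    let Z' := reify_ob D Z in constr:(Associ X' Y' Z')
  | @lun _ ?X => let X' := reify_ob D X in constr:(Lun X')
  | @luni _ ?X => let X' := reify_ob D X in constr:(Luni X')
  | @run _ ?X => let X' := reify_ob D X in constr:(Run X')
  | @runi _ ?X => let X' := reify_ob D X in constr:(Runi X')
  | _ => lazymatch type of f with
         | @Mor _ ?X ?Y => let X' := reify_ob D X in let Y' := reify_ob D Y in
                           constr:(@Gen D X' Y' f)
         end
  end.

Ltac to_stack :=
  lazymatch goal with
  | |- @heq ?D ?X ?Y ?f ?g =>
    let f' := reify_mor D f in let g' := reify_mor D g in
    apply: (@stack_eq D _ _ _ f' g'); let R := fresh "R" in intro R; cbn [mst stm st];
    rewrite ?wh_id ?id_comp ?comp_id ?wh_id ?compA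
  end.

Ltac stack_hyp pf H :=
  lazymatch type of pf with
  | @heq ?D ?X ?Y ?f ?g =>
    let f' := reify_mor D f in let g' := reify_mor D g in
    pose proof (fun R => @eq_stack D _ _ _ f' g' R pf) as H;
    cbn [mst stm st] in H
  end.

(** * Braiding, caps and cups on stacks *)

Section Braiding.
Context {D : symmon} {HD : symmon_laws D}.
Implicit Types X Y Z R : D.

Definition braid_st X Y R : Mor (X ⊗ (Y ⊗ R)) (Y ⊗ (X ⊗ R)) :=
  stg (Te (At X) (At Y)) (Te (At Y) (At X)) (braid X Y) R.

Lemma braid_stK X Y R : braid_st Y X R ∘ braid_st X Y R === idm _.
Proof. by stack_hyp (braidK HD X Y) H; exact: H. Qed.

Lemma braid_st_tail X Y R R' (h : Mor R R') :
  braid_st X Y R' ∘ (idm X ⊠ (idm Y ⊠ h)) === (idm Y ⊠ (idm X ⊠ h)) ∘ braid_st X Y R.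
Proof. exact: (stg_nat (A := Te (At X) (At Y)) (B := Te (At Y) (At X))). Qed.

(** Let b be the left side. The hexagon with two unit objects, combined with naturality along [lun],
    gives b = b b on stacks, and b cancels because the braiding is invertible. *)
Lemma braid_unit X R : stg (Te (At X) Un) (Te Un (At X)) (braid X unit_ob) R === idm _.
Proof.
stack_hyp (hexagon HD X unit_ob unit_ob) H.
stack_hyp (braid_nat HD (idm X) (lun (unit_ob : D))) G.
have {}G := G R; have {}H := H R. 
rewrite ?wh_id ?id_comp ?comp_id in G; rewrite ?wh_id ?id_comp ?comp_id -?G in H.
stack_hyp (braidK HD X unit_ob) K; have {}K := K R; cbn in K.
by rewrite -K {2}H -compA K id_comp.
Qed.

Lemma braid_tens X Y Z R :
  stg (Te (At X) (Te (At Y) (At Z))) (Te (Te (At Y) (At Z)) (At X)) (braid X (Y ⊗ Z)) R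
  === (idm Y ⊠ braid_st X Z R) ∘ braid_st X Y (Z ⊗ R).
Proof.
stack_hyp (hexagon HD X Y Z) H; have {H} := H R.
by rewrite ?wh_id ?id_comp ?comp_id ?wh_id ?comp_id.
Qed.

(** Naturality of the braiding in [e]: a strand is pulled across a cap, because its crossing with
    the unit object is trivial. The variants [slide_coev], [slide_ev'] and [slide_coev'] are the
    same move for a cup or from the other side. *)
Lemma slide_ev X Y Z (e : Mor (X ⊗ Y) unit_ob) R :
  stg (Te (At X) (At Y)) Un e (Z ⊗ R) ∘ ((idm X ⊠ braid_st Z Y R) ∘ braid_st Z X (Y ⊗ R))
  === idm Z ⊠ stg (Te (At X) (At Y)) Un e R.
Proof.
rewrite -braid_tens; stack_hyp (braid_nat HD (idm Z) e) H; have {}H := H R.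
rewrite braid_unit ?id_comp ?wh_id ?comp_id in H.
by rewrite H.
Qed.

Lemma slide_coev X Y Z (c : Mor unit_ob (X ⊗ Y)) R :
  (idm X ⊠ braid_st Z Y R) ∘ (braid_st Z X (Y ⊗ R) ∘ (idm Z ⊠ stg Un (Te (At X) (At Y)) c R))
  === stg Un (Te (At X) (At Y)) c (Z ⊗ R).
Proof.
rewrite -compA -braid_tens; stack_hyp (braid_nat HD (idm Z) c) H; have {}H := H R.
rewrite braid_unit ?id_comp ?wh_id ?comp_id in H.
by rewrite H.
Qed.

Definition ev_st X Y (e : Mor (X ⊗ Y) unit_ob) R : Mor (X ⊗ (Y ⊗ R)) R :=
  stg (Te (At X) (At Y)) Un e R.

Definition coev_st X Y (c : Mor unit_ob (X ⊗ Y)) R : Mor R (X ⊗ (Y ⊗ R)) :=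
  stg Un (Te (At X) (At Y)) c R.

(** With [R] arbitrary, the triangle identity can be applied in the middle of a larger diagram. *)
Lemma zig_stack X Y (e : Mor (Y ⊗ X) unit_ob) (c : Mor unit_ob (X ⊗ Y)) :
  run X ∘ (idm X ⊠ e) ∘ assoc X Y X ∘ (c ⊠ idm X) ∘ luni X === idm X <->
  forall R, (idm X ⊠ ev_st e R) ∘ coev_st c (X ⊗ R) === idm _.
Proof.
split=> [H R|H]; last by to_stack; exact: (H _).
stack_hyp H H'; have {H'} := H' R.
by rewrite ?wh_id ?id_comp ?comp_id ?wh_id ?comp_id.
Qed.

Lemma zag_stack X Y (e : Mor (Y ⊗ X) unit_ob) (c : Mor unit_ob (X ⊗ Y)) :
  lun Y ∘ (e ⊠ idm Y) ∘ associ Y X Y ∘ (idm Y ⊠ c) ∘ runi Y === idm Y <->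
  forall R, ev_st e (Y ⊗ R) ∘ (idm Y ⊠ coev_st c R) === idm _.
Proof.
split=> [H R|H]; last by to_stack; exact: (H _).
stack_hyp H H'; have {H'} := H' R.
by rewrite ?wh_id ?id_comp ?comp_id ?wh_id ?comp_id.
Qed.

Lemma ev_st_tail X Y (e : Mor (X ⊗ Y) unit_ob) R R' (h : Mor R R') :
  ev_st e R' ∘ (idm X ⊠ (idm Y ⊠ h)) === h ∘ ev_st e R.
Proof. exact: (stg_nat (A := Te (At X) (At Y)) (B := Un)). Qed.

Lemma coev_st_tail X Y (c : Mor unit_ob (X ⊗ Y)) R R' (h : Mor R R') :
  coev_st c R' ∘ h === (idm X ⊠ (idm Y ⊠ h)) ∘ coev_st c R.
Proof. exact: (stg_nat (A := Un) (B := Te (At X) (At Y))). Qed.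

End Braiding.

Ltac fold_st := rewrite -?/(braid_st _ _ _) -?/(ev_st _ _) -?/(coev_st _ _).
Ltac wh := rewrite ?wh_comp ?wh_id ?id_comp ?comp_id ?compA.
Ltac stk := to_stack; wh; fold_st.

Ltac rass f z :=
  lazymatch f with
  | compm ?a ?b => let bz := rass b z in rass a bz
  | idm _ => constr:(z)
  | _ => constr:(compm f z)
  end.

(* Rewrites with E anywhere in a composite bracketed to the right. *)
Ltac zrew E :=
  let E0 := fresh in pose proof E as E0; cbn [stm st] in E0; rewrite ?compA ?id_comp ?comp_id in E0;
  lazymatch type of E0 with
  | @heq ?D ?X ?Y ?f ?g =>
    let H := fresh in
    assert (H : forall T_ (z_ : @Mor D T_ X),
      ltac:(let l := rass f z_ in let r := rass g z_ in exact (heq l r)))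
      by (let z := fresh in let H := fresh in intros ? z; assert (H : f ∘ z === g ∘ z)
          by (rewrite E0; reflexivity);
          rewrite ?compA ?id_comp ?comp_id in H; exact H);
    first [rewrite H | rewrite E0 ?comp_id]; clear H
  end; clear E0.

(* The same with E whiskered by the formal object A. *)
Ltac wrew A E :=
  let E1 := fresh in pose proof (@stm_proper _ _ A _ _ _ _ E) as E1; cbn [stm] in E1;
  rewrite ?wh_comp ?wh_id in E1; zrew E1; clear E1.

(** * Duals *)

Section Duality.
Context {D : symmon} {HD : symmon_laws D}.
Implicit Types X Y Z R : D.

Lemma slide_ev' X Y Z (e : Mor (X ⊗ Y) unit_ob) R :
  ev_st e (Z ⊗ R) ∘ (idm X ⊠ braid_st Z Y R) === (idm Z ⊠ ev_st e R) ∘ braid_st X Z (Y ⊗ R).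
Proof.
rewrite -slide_ev !compA braid_stK comp_id //.
Qed.

Lemma slide_coev' X Y Z (c : Mor unit_ob (X ⊗ Y)) R :
  braid_st X Z (Y ⊗ R) ∘ ((idm X ⊠ braid_st Y Z R) ∘ coev_st c (Z ⊗ R)) === idm Z ⊠ coev_st c R.
Proof.
rewrite /coev_st -slide_coev; wrew (At X) (braid_stK Z Y R); zrew (braid_stK Z X (Y ⊗ R)).
by [].
Qed.

Lemma heq_flip X Y (f g : Mor X Y) : f === g -> g === f.
Proof. by move=> ->. Qed.

Section Tensor.
Variables X Xs Y Ys : D.
Variables (e : Mor (Xs ⊗ X) unit_ob) (c : Mor unit_ob (X ⊗ Xs)).
Variables (e' : Mor (Ys ⊗ Y) unit_ob) (c' : Mor unit_ob (Y ⊗ Ys)).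

(** The dual of [X ⊗ Y] is taken without reversing the order, at the price of the crossing in
    [mid4]. The shape is that of the successor case of [ev_pow], so that the induction step for
    powers holds by conversion. *)
Definition tens_ev : Mor ((Xs ⊗ Ys) ⊗ (X ⊗ Y)) unit_ob :=
  lun unit_ob ∘ (e ⊠ e') ∘ mid4 Xs Ys X Y.

Definition tens_coev : Mor unit_ob ((X ⊗ Y) ⊗ (Xs ⊗ Ys)) :=
  mid4 X Xs Y Ys ∘ (c ⊠ c') ∘ luni unit_ob.

Hypothesis zig1 : run X ∘ (idm X ⊠ e) ∘ assoc X Xs X ∘ (c ⊠ idm X) ∘ luni X === idm X.
Hypothesis zag1 : lun Xs ∘ (e ⊠ idm Xs) ∘ associ Xs X Xs ∘ (idm Xs ⊠ c) ∘ runi Xs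
  === idm Xs.
Hypothesis zig2 : run Y ∘ (idm Y ⊠ e') ∘ assoc Y Ys Y ∘ (c' ⊠ idm Y) ∘ luni Y === idm Y.
Hypothesis zag2 : lun Ys ∘ (e' ⊠ idm Ys) ∘ associ Ys Y Ys ∘ (idm Ys ⊠ c') ∘ runi Ys
  === idm Ys.

Lemma tens_zig :
  run (X ⊗ Y) ∘ (idm (X ⊗ Y) ⊠ tens_ev) ∘ assoc (X ⊗ Y) (Xs ⊗ Ys) (X ⊗ Y)
  ∘ (tens_coev ⊠ idm (X ⊗ Y)) ∘ luni (X ⊗ Y) === idm (X ⊗ Y).
Proof.
pose proof (proj1 (zig_stack _ _) zig1) as z1.
pose proof (proj1 (zig_stack _ _) zig2) as z2.
rewrite /tens_ev /tens_coev /mid4. stk.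
(* Independent pieces are moved past each other until the zigzag of [X] is isolated and straightened
   by [z1]. Then [X] is pulled off the cup of [Y], and [z2] applies. *)
wrew (At X) (heq_flip (braid_st_tail Xs Y (braid_st Ys X (Y ⊗ R)))).
wrew (At X) (heq_flip (braid_st_tail Xs Y (idm X ⊠ ev_st e' R))).
zrew (heq_flip (coev_st_tail c (idm Y ⊠ braid_st Ys X (Y ⊗ R)))).
zrew (heq_flip (coev_st_tail c (idm Y ⊠ (idm X ⊠ ev_st e' R)))).
wrew (At X) (heq_flip (slide_ev' Y e R)).
zrew (heq_flip (coev_st_tail c (braid_st Y X R))).
zrew (z1 (Y ⊗ R)).
zrew (braid_st_tail Y X (ev_st e' R)).
zrew (slide_coev' X c' (Y ⊗ R)).
by wrew (At X) (z2 R).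
Qed.

Lemma tens_zag :
  lun (Xs ⊗ Ys) ∘ (tens_ev ⊠ idm (Xs ⊗ Ys)) ∘ associ (Xs ⊗ Ys) (X ⊗ Y) (Xs ⊗ Ys)
  ∘ (idm (Xs ⊗ Ys) ⊠ tens_coev) ∘ runi (Xs ⊗ Ys) === idm (Xs ⊗ Ys).
Proof.
pose proof (proj1 (zag_stack _ _) zag1) as z1.
pose proof (proj1 (zag_stack _ _) zag2) as z2.
rewrite /tens_ev /tens_coev /mid4. stk.
wrew (At Xs) (braid_st_tail Ys X (braid_st Xs Y (Ys ⊗ R))).
wrew (Te (At Xs) (At X)) (slide_ev' Xs e' (Ys ⊗ R)).
wrew (At Xs) (slide_coev Ys c (Y ⊗ (Ys ⊗ R))).
zrew (ev_st_tail e (idm Xs ⊠ ev_st e' (Ys ⊗ R))).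
zrew (z1 (Ys ⊗ (Y ⊗ (Ys ⊗ R)))).
by wrew (At Xs) (z2 R).
Qed.

End Tensor.

Section Bending.
Variables A B Bs C E Es S T : D.
Variables (e : Mor (Bs ⊗ B) unit_ob) (c : Mor unit_ob (B ⊗ Bs)).
Variables (e' : Mor (Es ⊗ E) unit_ob) (c' : Mor unit_ob (E ⊗ Es)).
Variables (sp : Mor S (A ⊗ E)) (jo : Mor (A ⊗ E) S).
Variables (sp' : Mor T (B ⊗ C)) (jo' : Mor (B ⊗ C) T).

(** [bend] and [unbend] are instances of [gen_bend] and [gen_unbend] by conversion. Abstracting the
    powers and [pow_split], [pow_join] to arbitrary objects and isomorphisms keeps the recursive
    definitions out of the diagram calculation. *)
Definition gen_bend (f : Mor (A ⊗ Bs) (C ⊗ Es)) : Mor S T :=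
  jo'
  ∘ (idm B ⊠ (run C ∘ (idm C ⊠ e') ∘ assoc C Es E ∘ (f ⊠ idm E)))
  ∘ (idm B ⊠ ((braid Bs A ⊠ idm E) ∘ associ Bs A E))
  ∘ assoc B Bs (A ⊗ E) ∘ (c ⊠ idm (A ⊗ E)) ∘ luni (A ⊗ E) ∘ sp.

Definition gen_unbend (f : Mor S T) : Mor (A ⊗ Bs) (C ⊗ Es) :=
  lun (C ⊗ Es) ∘ (e ⊠ idm (C ⊗ Es)) ∘ associ Bs B (C ⊗ Es)
  ∘ (idm Bs ⊠ assoc B C Es)
  ∘ (idm Bs ⊠ ((sp' ∘ f ∘ jo) ⊠ idm Es))
  ∘ (idm Bs ⊠ associ A E Es)
  ∘ assoc Bs A (E ⊗ Es) ∘ (braid A Bs ⊠ c') ∘ runi (A ⊗ Bs).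

Hypothesis zig1 : run B ∘ (idm B ⊠ e) ∘ assoc B Bs B ∘ (c ⊠ idm B) ∘ luni B === idm B.
Hypothesis zag1 : lun Bs ∘ (e ⊠ idm Bs) ∘ associ Bs B Bs ∘ (idm Bs ⊠ c) ∘ runi Bs
  === idm Bs.
Hypothesis zig2 : run E ∘ (idm E ⊠ e') ∘ assoc E Es E ∘ (c' ⊠ idm E) ∘ luni E === idm E.
Hypothesis zag2 : lun Es ∘ (e' ⊠ idm Es) ∘ associ Es E Es ∘ (idm Es ⊠ c') ∘ runi Es
  === idm Es.
Hypotheses (spK : jo ∘ sp === idm _) (joK : sp ∘ jo === idm _).
Hypotheses (spK' : jo' ∘ sp' === idm _) (joK' : sp' ∘ jo' === idm _).

(** The composite contains one zigzag in [Bs] and one in [Es], each straightened by its triangle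
    identity; the two crossings of [A] with [Bs] cancel. *)
Lemma gen_bendK f : gen_unbend (gen_bend f) === f.
Proof.
pose proof (proj1 (zag_stack _ _) zag1) as z1.
pose proof (proj1 (zag_stack _ _) zag2) as z2.
stack_hyp joK K; stack_hyp joK' K'.
rewrite /gen_unbend /gen_bend. stk.
wrew (At Bs) (K' (Es ⊗ R)); wrew (At Bs) (K (Es ⊗ R)).
zrew (ev_st_tail e (idm C ⊠ ev_st e' (Es ⊗ R))).
zrew (ev_st_tail e (stg (Te (At A) (At Bs)) (Te (At C) (At Es)) f (E ⊗ (Es ⊗ R)))).
zrew (ev_st_tail e (braid_st Bs A (E ⊗ (Es ⊗ R)))).
zrew (z1 (A ⊗ (E ⊗ (Es ⊗ R)))); zrew (braid_stK A Bs (E ⊗ (Es ⊗ R))).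
zrew (stg_nat (A := Te (At A) (At Bs)) (B := Te (At C) (At Es)) f (coev_st c' R)).
by wrew (At C) (z2 R).
Qed.

Lemma gen_unbendK f : gen_bend (gen_unbend f) === f.
Proof.
pose proof (proj1 (zig_stack _ _) zig1) as z1.
pose proof (proj1 (zig_stack _ _) zig2) as z2.
stack_hyp spK K; stack_hyp spK' K'.
rewrite /gen_unbend /gen_bend. stk.
wrew (At B) (braid_st_tail A Bs (coev_st c' (E ⊗ R))); wrew (At B) (braid_stK Bs A (E ⊗ R)).
zrew (heq_flip (coev_st_tail c (idm A ⊠ coev_st c' (E ⊗ R)))).
zrew (heq_flip (coev_st_tail c (stg (Te (At A) (At E)) (At S) jo (Es ⊗ (E ⊗ R))))).
zrew (heq_flip (coev_st_tail c (stg (At S) (At T) f (Es ⊗ (E ⊗ R))))).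
zrew (heq_flip (coev_st_tail c (stg (At T) (Te (At B) (At C)) sp' (Es ⊗ (E ⊗ R))))).
zrew (z1 (C ⊗ (Es ⊗ (E ⊗ R)))).
zrew (heq_flip (stg_nat (A := At T) (B := Te (At B) (At C)) sp' (ev_st e' R))).
zrew (heq_flip (stg_nat (A := At S) (B := At T) f (ev_st e' R))).
zrew (heq_flip (stg_nat (A := Te (At A) (At E)) (B := At S) jo (ev_st e' R))).
by wrew (At A) (z2 R); zrew (K R); zrew (K' R).
Qed.

End Bending.

(** * Two-sided duals and traces in a symmetric category *)

Lemma yang_baxter X Y Z R :
  (idm Z ⊠ braid_st X Y R) ∘ (braid_st X Z (Y ⊗ R) ∘ (idm X ⊠ braid_st Y Z R))
  === braid_st Y Z (X ⊗ R) ∘ ((idm Y ⊠ braid_st X Z R) ∘ braid_st X Y (Z ⊗ R)).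
Proof.
stack_hyp (braid_nat HD (idm X) (braid Y Z)) H; have {}H := H R.
by rewrite ?braid_tens ?id_comp ?wh_id ?comp_id ?compA in H; exact: H.
Qed.

Lemma swap_zag_stack X Y (e : Mor (Y ⊗ X) unit_ob) (c : Mor unit_ob (X ⊗ Y)) R :
  (idm X ⊠ ev_st e R) ∘ coev_st c (X ⊗ R) === idm _ ->
  ev_st e (X ⊗ R) ∘ (braid_st X Y (X ⊗ R) ∘ ((idm X ⊠ braid_st X Y R) ∘ (idm X ⊠ coev_st c R)))
  === idm _.
Proof.
move=> z; rewrite -(slide_coev' X c).
zrew (heq_flip (yang_baxter X X Y R)); wrew (At X) (braid_stK Y X R).
zrew (slide_ev' X e R); zrew (braid_stK X Y (X ⊗ R)); exact: z.
Qed.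

(** Symmetry makes a left dual also a right dual. The curl formed by the two crossings is undone by
    the Yang-Baxter move and by pulling the strand off the cup and the cap. *)
Lemma swap_zig X Xs (e : Mor (Xs ⊗ X) unit_ob) (c : Mor unit_ob (X ⊗ Xs)) :
  lun Xs ∘ (e ⊠ idm Xs) ∘ associ Xs X Xs ∘ (idm Xs ⊠ c) ∘ runi Xs === idm Xs ->
  run Xs ∘ (idm Xs ⊠ (e ∘ braid X Xs)) ∘ assoc Xs X Xs ∘ ((braid X Xs ∘ c) ⊠ idm Xs)
  ∘ luni Xs === idm Xs.
Proof.
move=> /zag_stack z; stk.
(* A cancelling pair of crossings is inserted: the Yang-Baxter move needs three crossings and only
   two are present. *)
have s : coev_st c (Xs ⊗ R)
    === (idm X ⊠ braid_st Xs Xs R) ∘ ((idm X ⊠ braid_st Xs Xs R) ∘ coev_st c (Xs ⊗ R)).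
  by wrew (At X) (braid_stK Xs Xs R).
rewrite s; zrew (yang_baxter X Xs Xs R); zrew (slide_coev' Xs c R).
zrew (heq_flip (slide_ev' Xs e R)); wrew (At Xs) (braid_stK X Xs R); exact: z.
Qed.

Lemma swap_zag X Xs (e : Mor (Xs ⊗ X) unit_ob) (c : Mor unit_ob (X ⊗ Xs)) :
  run X ∘ (idm X ⊠ e) ∘ assoc X Xs X ∘ (c ⊠ idm X) ∘ luni X === idm X ->
  lun X ∘ ((e ∘ braid X Xs) ⊠ idm X) ∘ associ X Xs X ∘ (idm X ⊠ (braid X Xs ∘ c))
  ∘ runi X === idm X.
Proof.
move=> /zig_stack z; stk.
exact: swap_zag_stack.
Qed.

(** The endomorphism feeds its input to [b] and takes its output from [a], with [Z] running from [a]
    to [b]. Closing up [Y] therefore restores the pairing, and [Z] itself needs no dual. *)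
Lemma trace_pair Y Z (d : duality Y) (a : Mor unit_ob (Y ⊗ Z)) (b : Mor (Y ⊗ Z) unit_ob) :
  cat_trace d (run Y ∘ (idm Y ⊠ (b ∘ braid Z Y)) ∘ assoc Y Z Y ∘ (a ⊠ idm Y) ∘ luni Y)
  === b ∘ a.
Proof.
pose proof (proj1 (zig_stack _ _) (zig d)) as z1.
pose proof (proj1 (zag_stack _ _) (zag d)) as z2.
rewrite /cat_trace; stk.
zrew (coev_st_tail a (coev_st (coev d) R)).
have s : braid_st Z Y (dob d ⊗ R) ∘ (idm Z ⊠ coev_st (coev d) R)
    === (idm Y ⊠ braid_st (dob d) Z R) ∘ coev_st (coev d) (Z ⊗ R).
  by rewrite /coev_st -(slide_coev Z (coev d)); wrew (At Y) (braid_stK Z (dob d) R).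
wrew (At Y) s; wrew (At Y) (slide_ev' (dob d) b R).
zrew (braid_st_tail Y (dob d) (ev_st b R)); zrew (ev_st_tail (ev d) (ev_st b R)).
by zrew (swap_zag_stack (z1 (Z ⊗ R))).
Qed.

End Duality.

Section MoreDuality.
Context {D : symmon} {HD : symmon_laws D}.
Implicit Types X Y Z R : D.

Lemma mid4K X Y Z T : mid4 X Z Y T ∘ mid4 X Y Z T === idm _.
Proof. by rewrite /mid4; stk; wrew (At X) (braid_stK Y Z (T ⊗ R)). Qed.

Lemma pow_splitK X m n : pow_join X m n ∘ pow_split X m n === idm _.
Proof.
elim: m => [|m IH]; first exact: (luniK HD).
by rewrite /= compA (comp_id_at _ (associK HD _ _ _)) -wh_comp IH wh_id.
Qed.

Lemma pow_joinK X m n : pow_split X m n ∘ pow_join X m n === idm _.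
Proof.
elim: m => [|m IH]; first exact: (lunK HD).
rewrite /= compA (comp_id_at _ (_ : _ === idm _)); first exact: (assocK HD).
by rewrite -wh_comp IH wh_id.
Qed.

Definition tens_dual X Y (dX : duality X) (dY : duality Y) : duality (X ⊗ Y) :=
  Dual (tens_zig (zig dX) (zig dY)) (tens_zag (zag dX) (zag dY)).

Lemma unit_zig :
  run unit_ob ∘ (idm unit_ob ⊠ lun unit_ob) ∘ assoc unit_ob unit_ob unit_ob
  ∘ (luni unit_ob ⊠ idm unit_ob) ∘ luni unit_ob === idm (unit_ob : D).
Proof. by stk. Qed.

Lemma unit_zag :
  lun unit_ob ∘ (lun unit_ob ⊠ idm unit_ob) ∘ associ unit_ob unit_ob unit_ob
  ∘ (idm unit_ob ⊠ luni unit_ob) ∘ runi unit_ob === idm (unit_ob : D).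
Proof. by stk. Qed.

Definition swap_dual X (d : duality X) : duality (dob d) :=
  Dual (swap_zig (zag d)) (swap_zag (zig d)).

Lemma pow_zig X (d : duality X) n :
  run (pow X n) ∘ (idm (pow X n) ⊠ ev_pow (ev d) n)
  ∘ assoc (pow X n) (pow (dob d) n) (pow X n)
  ∘ (coev_pow (coev d) n ⊠ idm (pow X n)) ∘ luni (pow X n) === idm (pow X n).
Proof.
elim: n => [|n IH]; [exact: unit_zig | exact: (tens_zig (zig d) IH)].
Qed.

Lemma pow_zag X (d : duality X) n :
  lun (pow (dob d) n) ∘ (ev_pow (ev d) n ⊠ idm (pow (dob d) n))
  ∘ associ (pow (dob d) n) (pow X n) (pow (dob d) n)
  ∘ (idm (pow (dob d) n) ⊠ coev_pow (coev d) n) ∘ runi (pow (dob d) n)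
  === idm (pow (dob d) n).
Proof.
elim: n => [|n IH]; [exact: unit_zag | exact: (tens_zag (zag d) IH)].
Qed.

Definition pow_dual X (d : duality X) n : duality (pow X n) :=
  Dual (pow_zig d n) (pow_zag d n).

End MoreDuality.

(** * Monoidal functors *)

Section Functor.
Context {B D : symmon} {HD : symmon_laws D}.
Variable F : symmonfun B D.
Implicit Types X Y Z : B.

Local Notation m X Y := (stg (Te (At (F X)) (At (F Y))) (At (F (X ⊗ Y))) (Ften F X Y)).
Local Notation mi X Y := (stg (At (F (X ⊗ Y))) (Te (At (F X)) (At (F Y))) (Fteni F X Y)).

Lemma FtenK_st X Y R : mi X Y R ∘ m X Y R === idm _.
Proof. by stack_hyp (FtenK F X Y) H; exact: H. Qed.

Lemma FteniK_st X Y R : m X Y R ∘ mi X Y R === idm _.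
Proof. by stack_hyp (FteniK F X Y) H; exact: H. Qed.

Lemma Fhom_tens (X Y X' Y' : B) (f : Mor X Y) (g : Mor X' Y') :
  Fhom F (f ⊠ g) === Ften F Y Y' ∘ (Fhom F f ⊠ Fhom F g) ∘ Fteni F X X'.
Proof. by rewrite -Ften_nat compA FteniK comp_id. Qed.

Lemma Fhom_assoc X Y Z :
  Fhom F (assoc X Y Z) === Ften F X (Y ⊗ Z) ∘ (idm (F X) ⊠ Ften F Y Z)
    ∘ assoc (F X) (F Y) (F Z) ∘ (Fteni F X Y ⊠ idm (F Z)) ∘ Fteni F (X ⊗ Y) Z.
Proof.
rewrite -F_assoc !compA (comp_id_at _ (_ : _ === idm _)) ?FteniK ?comp_id //.
by rewrite -comp_wh FteniK wh_id.
Qed.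

Lemma Fhom_lun X :
  Fhom F (lun X) === lun (F X) ∘ (Fonei F ⊠ idm (F X)) ∘ Fteni F unit_ob X.
Proof.
rewrite -F_lun !compA (comp_id_at _ (_ : _ === idm _)) ?FteniK ?comp_id //.
by rewrite -comp_wh FoneiK wh_id.
Qed.

Lemma Fhom_run X :
  Fhom F (run X) === run (F X) ∘ (idm (F X) ⊠ Fonei F) ∘ Fteni F X unit_ob.
Proof.
rewrite -F_run !compA (comp_id_at _ (_ : _ === idm _)) ?FteniK ?comp_id //.
by rewrite -wh_comp FoneiK wh_id.
Qed.

Lemma Fhom_braid X Y :
  Fhom F (braid X Y) === Ften F Y X ∘ braid (F X) (F Y) ∘ Fteni F X Y.
Proof. by rewrite -F_braid !compA FteniK comp_id. Qed.

Lemma FtenK_at X Y R T (z : Mor T _) : mi X Y R ∘ (m X Y R ∘ z) === z.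
Proof. exact: comp_id_at (FtenK_st X Y R). Qed.

Lemma FtenK_wh_at P X Y R T (z : Mor T _) :
  (idm P ⊠ mi X Y R) ∘ ((idm P ⊠ m X Y R) ∘ z) === z.
Proof. by apply: comp_id_at; rewrite -wh_comp FtenK_st wh_id. Qed.

Section Reflect.
Hypothesis inj : forall X Y (f g : Mor X Y), Fhom F f === Fhom F g -> f === g.
Hypothesis assocK' : forall X Y Z,
  Fhom F (associ X Y Z) ∘ Fhom F (assoc X Y Z) === idm _.
Hypothesis associK' : forall X Y Z,
  Fhom F (assoc X Y Z) ∘ Fhom F (associ X Y Z) === idm _.
Hypothesis lunK' : forall X, Fhom F (luni X) ∘ Fhom F (lun X) === idm _.
Hypothesis luniK' : forall X, Fhom F (lun X) ∘ Fhom F (luni X) === idm _.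
Hypothesis runK' : forall X, Fhom F (runi X) ∘ Fhom F (run X) === idm _.
Hypothesis runiK' : forall X, Fhom F (run X) ∘ Fhom F (runi X) === idm _.

(** Nothing is known about [B] beforehand, so every law is checked after applying [F]. The fields of
    a [symmonfun] determine the images of [assoc], [lun], [run] and [braid] but say nothing about
    [associ], [luni] and [runi]; hence the six hypotheses on inverses. *)
Lemma reflect_laws : symmon_laws B.
Proof.
have FtenK_wh P X Y R : (idm P ⊠ mi X Y R) ∘ (idm P ⊠ m X Y R) === idm _.
  by rewrite -wh_comp FtenK_st wh_id.
split.
- by move=> *; apply: inj.
- by move=> X Y f g fg; apply: inj; apply: heq_sym; apply: F_congr.
- by move=> X Y f g h fg gh; apply: inj; transitivity (Fhom F g); apply: F_congr.
- by move=> *; apply: inj; rewrite !F_comp; apply: comp_congr; apply: F_congr.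
- by move=> *; apply: inj; rewrite F_comp F_id id_comp.
- by move=> *; apply: inj; rewrite F_comp F_id comp_id.
- by move=> *; apply: inj; rewrite !F_comp compA.
- move=> X Y X' Y' f g f' g' E E'; apply: inj; rewrite !Fhom_tens.
  by rewrite (F_congr F E) (F_congr F E').
- by move=> *; apply: inj; rewrite Fhom_tens !F_id wh_id comp_id FteniK.
- move=> *; apply: inj; rewrite !(Fhom_tens, F_comp) (tens_comp HD) !compA.
  by rewrite (comp_id_at _ (FtenK F _ _)).
- by move=> *; apply: inj; rewrite F_comp F_id.
- by move=> *; apply: inj; rewrite F_comp F_id.
- move=> X Y Z X' Y' Z' f g h; apply: inj; rewrite !F_comp.
  rewrite !Fhom_assoc !Fhom_tens. stk. rewrite ?FtenK_at ?FtenK_wh_at ?FtenK_st ?FtenK_wh ?comp_id.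
  zrew (stg_nat (A := At _) (B := Te (At _) (At _)) (Fteni F X Y)
    (stg (At (F Z)) (At (F Z')) (Fhom F h) R)).
  by zrew (stg_nat (A := At _) (B := At _) (Fhom F f) (m Y' Z' R)).
- by move=> *; apply: inj; rewrite F_comp F_id.
- by move=> *; apply: inj; rewrite F_comp F_id.
- move=> X Y f; apply: inj; rewrite !F_comp Fhom_tens F_id.
  rewrite !Fhom_lun; stk;  rewrite ?FtenK_at ?FtenK_wh_at ?FtenK_st ?FtenK_wh ?comp_id.
  by zrew (stg_nat (A := At _) (B := Un) (Fonei F) (stg (At (F X)) (At (F Y)) (Fhom F f) R)).
- by move=> *; apply: inj; rewrite F_comp F_id.
- by move=> *; apply: inj; rewrite F_comp F_id.
- move=> X Y f; apply: inj; rewrite !F_comp Fhom_tens F_id.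
  rewrite !Fhom_run; stk;  rewrite ?FtenK_at ?FtenK_wh_at ?FtenK_st ?FtenK_wh ?comp_id.
  by zrew (stg_nat (A := At _) (B := At _) (Fhom F f) (stg (At _) Un (Fonei F) R)).
- move=> X Y Z T; apply: inj; rewrite !F_comp !Fhom_tens !F_id.
  rewrite !Fhom_assoc; stk;  rewrite ?FtenK_at ?FtenK_wh_at ?FtenK_st ?FtenK_wh ?comp_id.
  by zrew (stg_nat (A := At _) (B := Te (At _) (At _)) (Fteni F X Y) (m Z T R)).
- move=> X Y; apply: inj; rewrite !F_comp !Fhom_tens !F_id.
  rewrite !Fhom_assoc Fhom_lun Fhom_run; stk;  rewrite ?FtenK_at ?FtenK_wh_at ?FtenK_st ?FtenK_wh ?comp_id.
  by [].
- move=> X Y X' Y' f g; apply: inj; rewrite !F_comp !Fhom_tens !Fhom_braid; stk;  rewrite ?FtenK_at ?FtenK_wh_at ?FtenK_st ?FtenK_wh ?comp_id.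
  stack_hyp (braid_nat HD (Fhom F f) (Fhom F g)) H; have {}H := H R.
  by rewrite -?/(braid_st _ _ _) in H; zrew H.
- move=> X Y; apply: inj; rewrite !F_comp F_id !Fhom_braid; stk;  rewrite ?FtenK_at ?FtenK_wh_at ?FtenK_st ?FtenK_wh ?comp_id.
  by zrew (braid_stK (F X) (F Y) R); exact: FteniK_st.
- move=> X Y Z; apply: inj; rewrite !F_comp !Fhom_tens !F_id.
  rewrite !Fhom_assoc !Fhom_braid; stk;  rewrite ?FtenK_at ?FtenK_wh_at ?FtenK_st ?FtenK_wh ?comp_id.
  stack_hyp (braid_nat HD (idm (F X)) (Ften F Y Z)) H; have {}H := H R.
  by rewrite ?braid_tens ?id_comp ?wh_id ?comp_id -?/(braid_st _ _ _) in H; zrew H; rewrite FtenK_at.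
Qed.
End Reflect.
End Functor.

(** * Duals along a monoidal functor *)

Section FunctorDual.
Context {B D : symmon} {HB : symmon_laws B} {HD : symmon_laws D}.
Variable F : symmonfun B D.
Implicit Types X Y Z : B.

Lemma Fhom_inv X Y (f : Mor X Y) (g : Mor Y X) :
  f ∘ g === idm _ -> Fhom F f ∘ Fhom F g === idm _.
Proof. by move=> fg; rewrite -F_comp (F_congr F fg) F_id. Qed.

Lemma inv_uniq (X Y : D) (f : Mor X Y) (g g' : Mor Y X) :
  g ∘ f === idm _ -> f ∘ g' === idm _ -> g === g'.
Proof. by move=> gf fg; rewrite -(comp_id g) -fg (comp_id_at _ gf). Qed.

Lemma Fhom_luni X :
  Fhom F (luni X) === Ften F unit_ob X ∘ (Fone F ⊠ idm (F X)) ∘ luni (F X).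
Proof.
apply: (inv_uniq (Fhom_inv (lunK HB X))).
rewrite Fhom_lun !compA (comp_id_at _ (FtenK F _ _)) (comp_id_at _ (_ : _ === idm _)).
  exact: (luniK HD).
by rewrite -comp_wh FoneK wh_id.
Qed.

Lemma Fhom_runi X :
  Fhom F (runi X) === Ften F X unit_ob ∘ (idm (F X) ⊠ Fone F) ∘ runi (F X).
Proof.
apply: (inv_uniq (Fhom_inv (runK HB X))).
rewrite Fhom_run !compA (comp_id_at _ (FtenK F _ _)) (comp_id_at _ (_ : _ === idm _)).
  exact: (runiK HD).
by rewrite -wh_comp FoneK wh_id.
Qed.

Lemma Fhom_associ X Y Z :
  Fhom F (associ X Y Z) === Ften F (X ⊗ Y) Z ∘ (Ften F X Y ⊠ idm (F Z))
    ∘ associ (F X) (F Y) (F Z) ∘ (idm (F X) ⊠ Fteni F Y Z) ∘ Fteni F X (Y ⊗ Z).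
Proof.
apply: (inv_uniq (Fhom_inv (assocK HB X Y Z))).
have w : (idm (F X) ⊠ Ften F Y Z) ∘ (idm (F X) ⊠ Fteni F Y Z) === idm _.
  by rewrite -wh_comp FteniK wh_id.
have w' : (Fteni F X Y ⊠ idm (F Z)) ∘ (Ften F X Y ⊠ idm (F Z)) === idm _.
  by rewrite -comp_wh FtenK wh_id.
rewrite Fhom_assoc !compA (comp_id_at _ (FtenK F _ _)) (comp_id_at _ w').
by rewrite (comp_id_at _ (associK HD _ _ _)) (comp_id_at _ w) FteniK.
Qed.

Definition image_ev X Y (e : Mor (Y ⊗ X) unit_ob) : Mor (F Y ⊗ F X) unit_ob :=
  Fonei F ∘ Fhom F e ∘ Ften F Y X.

Definition image_coev X Y (c : Mor unit_ob (X ⊗ Y)) : Mor unit_ob (F X ⊗ F Y) :=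
  Fteni F X Y ∘ Fhom F c ∘ Fone F.

(** No triangle identity is assumed for [e] and [c], so the formula serves both to push a duality
    forward ([image_dual]) and to pull one back along a full and faithful functor
    ([reflect_dual]). *)
Lemma Fhom_zig X Y (e : Mor (Y ⊗ X) unit_ob) (c : Mor unit_ob (X ⊗ Y)) :
  Fhom F (run X ∘ (idm X ⊠ e) ∘ assoc X Y X ∘ (c ⊠ idm X) ∘ luni X)
  === run (F X) ∘ (idm (F X) ⊠ image_ev e) ∘ assoc (F X) (F Y) (F X)
      ∘ (image_coev c ⊠ idm (F X)) ∘ luni (F X).
Proof.
rewrite !F_comp !Fhom_tens Fhom_assoc Fhom_run Fhom_luni /image_ev /image_coev !F_id.
by stk; rewrite ?FtenK_at ?FtenK_wh_at ?FtenK_st ?comp_id.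
Qed.

Lemma Fhom_zag X Y (e : Mor (Y ⊗ X) unit_ob) (c : Mor unit_ob (X ⊗ Y)) :
  Fhom F (lun Y ∘ (e ⊠ idm Y) ∘ associ Y X Y ∘ (idm Y ⊠ c) ∘ runi Y)
  === lun (F Y) ∘ (image_ev e ⊠ idm (F Y)) ∘ associ (F Y) (F X) (F Y)
      ∘ (idm (F Y) ⊠ image_coev c) ∘ runi (F Y).
Proof.
rewrite !F_comp !Fhom_tens Fhom_associ Fhom_lun Fhom_runi /image_ev /image_coev !F_id.
by stk; rewrite ?FtenK_at ?FtenK_wh_at ?FtenK_st ?comp_id.
Qed.

Lemma image_zig X (d : duality X) :
  run (F X) ∘ (idm (F X) ⊠ image_ev (ev d)) ∘ assoc (F X) (F (dob d)) (F X)
  ∘ (image_coev (coev d) ⊠ idm (F X)) ∘ luni (F X) === idm (F X).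
Proof. by rewrite -Fhom_zig (F_congr F (zig d)) F_id. Qed.

Lemma image_zag X (d : duality X) :
  lun (F (dob d)) ∘ (image_ev (ev d) ⊠ idm (F (dob d)))
  ∘ associ (F (dob d)) (F X) (F (dob d))
  ∘ (idm (F (dob d)) ⊠ image_coev (coev d)) ∘ runi (F (dob d)) === idm (F (dob d)).
Proof. by rewrite -Fhom_zag (F_congr F (zag d)) F_id. Qed.

Definition image_dual X (d : duality X) : duality (F X) :=
  Dual (image_zig d) (image_zag d).

Section ReflectDual.
Hypothesis inj : forall X Y (f g : Mor X Y), Fhom F f === Fhom F g -> f === g.
Variable lift : forall X Y, Mor (F X) (F Y) -> Mor X Y.
Hypothesis liftK : forall X Y (f : Mor (F X) (F Y)), Fhom F (lift f) === f.
Variables X Y : B.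
Variables (e : Mor (F Y ⊗ F X) unit_ob) (c : Mor unit_ob (F X ⊗ F Y)).

Let ue := lift (Fone F ∘ e ∘ Fteni F Y X).
Let uc := lift (Ften F X Y ∘ c ∘ Fonei F).

Let ueE : image_ev ue === e.
Proof. by rewrite /image_ev liftK !compA FtenK comp_id (comp_id_at _ (FoneK F)). Qed.

Let ucE : image_coev uc === c.
Proof. by rewrite /image_coev liftK !compA FoneK comp_id (comp_id_at _ (FtenK F X Y)). Qed.

Lemma reflect_zig :
  run (F X) ∘ (idm (F X) ⊠ e) ∘ assoc (F X) (F Y) (F X)
  ∘ (c ⊠ idm (F X)) ∘ luni (F X) === idm (F X) ->
  run X ∘ (idm X ⊠ ue) ∘ assoc X Y X ∘ (uc ⊠ idm X) ∘ luni X === idm X.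
Proof. by move=> z; apply: inj; rewrite Fhom_zig ueE ucE z F_id. Qed.

Lemma reflect_zag :
  lun (F Y) ∘ (e ⊠ idm (F Y)) ∘ associ (F Y) (F X) (F Y)
  ∘ (idm (F Y) ⊠ c) ∘ runi (F Y) === idm (F Y) ->
  lun Y ∘ (ue ⊠ idm Y) ∘ associ Y X Y ∘ (idm Y ⊠ uc) ∘ runi Y === idm Y.
Proof. by move=> z; apply: inj; rewrite Fhom_zag ueE ucE z F_id. Qed.

Definition reflect_dual z z' : duality X := Dual (reflect_zig z) (reflect_zag z').
End ReflectDual.

End FunctorDual.

Section IsoDual.
Context {D : symmon} {HD : symmon_laws D}.
Variables (X Y : D) (d : duality X) (i : Mor (dob d) Y) (j : Mor Y (dob d)).
Hypotheses (ji : j ∘ i === idm _) (ij : i ∘ j === idm _).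

Lemma iso_zig :
  run X ∘ (idm X ⊠ (ev d ∘ (j ⊠ idm X))) ∘ assoc X Y X
  ∘ (((idm X ⊠ i) ∘ coev d) ⊠ idm X) ∘ luni X === idm X.
Proof.
pose proof (proj1 (zig_stack _ _) (zig d)) as z; stack_hyp ji J.
by stk; wrew (At X) (J (X ⊗ R)); exact: (z R).
Qed.

Lemma iso_zag :
  lun Y ∘ ((ev d ∘ (j ⊠ idm X)) ⊠ idm Y) ∘ associ Y X Y
  ∘ (idm Y ⊠ ((idm X ⊠ i) ∘ coev d)) ∘ runi Y === idm Y.
Proof.
pose proof (proj1 (zag_stack _ _) (zag d)) as z; stack_hyp ij J.
stk; zrew (stg_nat (A := At Y) (B := At (dob d)) j (idm X ⊠ stg (At (dob d)) (At Y) i R)).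
zrew (stg_nat (A := At Y) (B := At (dob d)) j (coev_st (coev d) R)).
zrew (ev_st_tail (ev d) (stg (At (dob d)) (At Y) i R)).
by zrew (z R); exact: (J R).
Qed.

Definition iso_dual : duality X := Dual iso_zig iso_zag.

End IsoDual.

(** * Isomorphic objects *)

Section Iso.
Context {D : symmon} {HD : symmon_laws D}.

Lemma cancel_r (X Y Z : D) (m : Mor Y Z) (f : Mor X Y) (g : Mor Y X) :
  f ∘ g === idm _ -> m ∘ f ∘ g === m.
Proof. by move=> fg; rewrite compA fg comp_id. Qed.

Lemma comp_inv (X Y Z : D) (f : Mor Y Z) (f' : Mor Z Y) (g : Mor X Y) (g' : Mor Y X) :
  f ∘ f' === idm _ -> g ∘ g' === idm _ -> f ∘ g ∘ (g' ∘ f') === idm _.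
Proof. by move=> ff gg; rewrite !compA (comp_id_at _ gg). Qed.

Lemma comp_inv3 (X1 X2 X3 X4 : D) (f1 : Mor X2 X1) (g1 : Mor X1 X2)
    (f2 : Mor X3 X2) (g2 : Mor X2 X3) (f3 : Mor X4 X3) (g3 : Mor X3 X4) :
  f1 ∘ g1 === idm _ -> f2 ∘ g2 === idm _ -> f3 ∘ g3 === idm _ ->
  f1 ∘ f2 ∘ f3 ∘ (g3 ∘ g2 ∘ g1) === idm _.
Proof. by move=> E1 E2 E3; rewrite !compA (comp_id_at _ E3) (comp_id_at _ E2). Qed.

Lemma comp_inv5 (X1 X2 X3 X4 X5 X6 : D) (f1 : Mor X2 X1) (g1 : Mor X1 X2)
    (f2 : Mor X3 X2) (g2 : Mor X2 X3) (f3 : Mor X4 X3) (g3 : Mor X3 X4)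
    (f4 : Mor X5 X4) (g4 : Mor X4 X5) (f5 : Mor X6 X5) (g5 : Mor X5 X6) :
  f1 ∘ g1 === idm _ -> f2 ∘ g2 === idm _ -> f3 ∘ g3 === idm _ ->
  f4 ∘ g4 === idm _ -> f5 ∘ g5 === idm _ ->
  f1 ∘ f2 ∘ f3 ∘ f4 ∘ f5 ∘ (g5 ∘ g4 ∘ g3 ∘ g2 ∘ g1) === idm _.
Proof.
move=> E1 E2 E3 E4 E5; rewrite !compA (comp_id_at _ E5) (comp_id_at _ E4).
by rewrite (comp_id_at _ E3) (comp_id_at _ E2).
Qed.

Definition iso (X Y : D) : Prop :=
  exists (f : Mor X Y) (g : Mor Y X), g ∘ f === idm _ /\ f ∘ g === idm _.

Lemma iso_refl X : iso X X.
Proof. by exists (idm X), (idm X); rewrite id_comp. Qed.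

Lemma iso_sym X Y : iso X Y -> iso Y X.
Proof. by move=> [f [g [gf fg]]]; exists g, f. Qed.

Lemma iso_trans X Y Z : iso X Y -> iso Y Z -> iso X Z.
Proof.
move=> [f [g [gf fg]]] [h [k [kh hk]]]; exists (h ∘ f), (g ∘ k).
by rewrite !compA (comp_id_at _ kh) (comp_id_at _ fg).
Qed.

Lemma iso_tens X Y X' Y' : iso X Y -> iso X' Y' -> iso (X ⊗ X') (Y ⊗ Y').
Proof.
move=> [f [g [gf fg]]] [h [k [kh hk]]]; exists (f ⊠ h), (g ⊠ k).
by rewrite -!(tens_comp HD) gf kh fg hk !wh_id.
Qed.

End Iso.

Section FunctorIso.
Context {B D : symmon} {HD : symmon_laws D}.
Variable F : symmonfun B D.

Lemma iso_image_tens (X Y : B) : iso (F X ⊗ F Y) (F (X ⊗ Y)).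
Proof.
by exists (Ften F X Y), (Fteni F X Y); split; [apply: FtenK | apply: FteniK].
Qed.

Lemma iso_image_pow (X : B) n : iso (pow (F X) n) (F (pow X n)).
Proof.
elim: n => [|n IH].
  by exists (Fone F), (Fonei F); split; [apply: FoneK | apply: FoneiK].
by apply: iso_trans (iso_tens (iso_refl _) IH) (iso_image_tens _ _).
Qed.

Lemma iso_image_pows (X Y : B) m n :
  iso (F (pow X m ⊗ pow Y n)) (pow (F X) m ⊗ pow (F Y) n).
Proof.
apply: iso_sym; apply: iso_trans (iso_image_tens (pow X m) (pow Y n)).
by apply: iso_tens; apply: iso_image_pow.
Qed.

End FunctorIso.

(** * Linear categories *)

Section Linear.
Context {K : fieldType} {D : linsymmon K} {HD : linsymmon_laws D}.
Implicit Types X Y Z : D.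

Lemma add_zeror X Y (f : Mor X Y) : f ⊞ hzero === f.
Proof. by rewrite (add_comm HD) (add_zero HD). Qed.

Lemma scale_zerol X Y (f : Mor X Y) : 0 ·: f === hzero.
Proof. by rewrite -(subrr 1) (scale_addl HD) (scale_one HD) (add_opp HD). Qed.

Lemma comp_zerol X Y Z (f : Mor X Y) : hzero ∘ f === (hzero : Mor X Z).
Proof. by rewrite -(scale_zerol (hzero : Mor Y Z)) (comp_scalel HD) scale_zerol. Qed.

Lemma comp_zeror X Y Z (f : Mor Y Z) : f ∘ hzero === (hzero : Mor X Z).
Proof. by rewrite -(scale_zerol (hzero : Mor X Y)) (comp_scaler HD) scale_zerol. Qed.

Lemma tens_zerol X Y X' Y' (f : Mor X Y) : (hzero : Mor X' Y') ⊠ f === hzero.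
Proof. by rewrite -(scale_zerol (hzero : Mor X' Y')) (tens_scalel HD) scale_zerol. Qed.

Lemma tens_zeror X Y X' Y' (f : Mor X Y) : f ⊠ (hzero : Mor X' Y') === hzero.
Proof. by rewrite -(scale_zerol (hzero : Mor X' Y')) (tens_scaler HD) scale_zerol. Qed.

Lemma scale_zeror X Y c : c ·: (hzero : Mor X Y) === hzero.
Proof. by rewrite -(scale_zerol (hzero : Mor X Y)) (scale_scale HD) mulr0. Qed.

Lemma add_acomm X Y (f g h k : Mor X Y) : f ⊞ g ⊞ (h ⊞ k) === f ⊞ h ⊞ (g ⊞ k).
Proof.
by rewrite !(add_assoc HD) -(add_assoc HD f g) (add_comm HD g) (add_assoc HD).
Qed.

Lemma sub_eq0 X Y (f g : Mor X Y) : f ⊟ g === hzero <-> f === g.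
Proof.
split=> [fg|->]; last by rewrite (add_opp HD).
rewrite -(add_zeror f) -(add_opp HD g) (add_comm HD g) (add_assoc HD) fg.
by rewrite (add_zero HD).
Qed.

Section BigSums.
Variables X Y : D.
Local Notation "\ssum_ ( i <- r ) F" := (\big[hadd/hzero]_(i <- r) F)
  (at level 36, F at level 36, i, r at level 50).

(** [hadd] is associative and commutative only up to [heq], so the rules for sums in this section
    are proved by induction on the index sequence. *)
Lemma hsum_congr_seq (I : eqType) (r : seq I) (F G : I -> Mor X Y) :
  (forall i, i \in r -> F i === G i) -> \ssum_(i <- r) F i === \ssum_(i <- r) G i.
Proof.
elim: r => [|i r IH] FG; first by rewrite !big_nil.
rewrite !big_cons (FG i) ?mem_head // IH // => j jr.
by apply: FG; rewrite inE jr orbT.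
Qed.

Lemma hsum_congr I (r : seq I) (F G : I -> Mor X Y) :
  (forall i, F i === G i) -> \ssum_(i <- r) F i === \ssum_(i <- r) G i.
Proof.
move=> FG; elim: r => [|i r IH]; first by rewrite !big_nil.
by rewrite !big_cons FG IH.
Qed.

Lemma hsum_zero I (r : seq I) : \ssum_(i <- r) (hzero : Mor X Y) === hzero.
Proof.
elim: r => [|i r IH]; first by rewrite big_nil.
by rewrite big_cons IH (add_zero HD).
Qed.

Lemma hsum_add I (r : seq I) (F G : I -> Mor X Y) :
  \ssum_(i <- r) (F i ⊞ G i) === (\ssum_(i <- r) F i) ⊞ (\ssum_(i <- r) G i).
Proof.
elim: r => [|i r IH]; first by rewrite !big_nil (add_zero HD).
by rewrite !big_cons IH add_acomm.
Qed.

Lemma hsum_scale I (r : seq I) c (F : I -> Mor X Y) :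
  c ·: (\ssum_(i <- r) F i) === \ssum_(i <- r) (c ·: F i).
Proof.
elim: r => [|i r IH]; first by rewrite !big_nil scale_zeror.
by rewrite !big_cons (scale_addr HD) IH.
Qed.

Lemma hsum_cat I (r s : seq I) (F : I -> Mor X Y) :
  \ssum_(i <- r ++ s) F i === (\ssum_(i <- r) F i) ⊞ (\ssum_(i <- s) F i).
Proof.
elim: r => [|i r IH] /=; first by rewrite big_nil (add_zero HD).
by rewrite !big_cons IH (add_assoc HD).
Qed.

Lemma hsum_exchange I J (r : seq I) (s : seq J) (F : I -> J -> Mor X Y) :
  \ssum_(i <- r) \ssum_(j <- s) F i j === \ssum_(j <- s) \ssum_(i <- r) F i j.
Proof.
elim: r => [|i r IH].
  rewrite big_nil; transitivity (\ssum_(j <- s) (hzero : Mor X Y)).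
    by rewrite hsum_zero.
  by apply: hsum_congr => j; rewrite big_nil.
rewrite big_cons IH -hsum_add; apply: hsum_congr => j.
by rewrite big_cons.
Qed.

Lemma hsum_pair I J (r : seq I) (s : seq J) (F : I -> J -> Mor X Y) :
  \ssum_(p <- [seq (i, j) | i <- r, j <- s]) F p.1 p.2
  === \ssum_(i <- r) \ssum_(j <- s) F i j.
Proof.
elim: r => [|i r IH] /=; first by rewrite !big_nil.
by rewrite hsum_cat big_cons IH big_map.
Qed.

Lemma hsum_perm (I : eqType) (r s : seq I) (F : I -> Mor X Y) :
  perm_eq r s -> \ssum_(i <- r) F i === \ssum_(i <- s) F i.
Proof.
elim: r s => [|i r IH] s; first by rewrite perm_sym => /perm_nilP ->.
move=> rs; have si : i \in s by rewrite -(perm_mem rs) mem_head.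
have /(perm_trans rs) := perm_to_rem si; rewrite perm_cons => /IH {}IH.
move: si; rewrite big_cons IH => {IH rs}; elim: s => //= j s IH.
rewrite inE eq_sym; case: eqVneq => [-> _|ji /= si]; first by rewrite !big_cons.
by rewrite !big_cons -IH // !(add_assoc HD) (add_comm HD (F i)).
Qed.

Lemma hsum_single (I : eqType) (r : seq I) i (F : I -> Mor X Y) :
  uniq r -> i \in r -> (forall j, j != i -> F j === hzero) ->
  \ssum_(j <- r) F j === F i.
Proof.
elim: r => //= j r IH /andP[jr ur]; rewrite inE => /predU1P[->|ir] F0.
  rewrite big_cons -[X in _ === X]add_zeror; apply: add_congr => //.
  transitivity (\ssum_(j <- r) (hzero : Mor X Y)); last exact: hsum_zero.
  apply: hsum_congr_seq => k kr; apply: F0.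
  by apply: contraNneq jr => <-.
rewrite big_cons IH // F0 ?(add_zero HD) //.
by apply: contraNneq jr => ->.
Qed.

End BigSums.

Lemma hsum_pick X Y (I : finType) i (F : I -> Mor X Y) :
  (forall j, j != i -> F j === hzero) -> \big[hadd/hzero]_j F j === F i.
Proof. by apply: hsum_single; rewrite ?index_enum_uniq ?mem_index_enum. Qed.

Lemma hsum_pair_fin X Y (I J : finType) (F : I -> J -> Mor X Y) :
  \big[hadd/hzero]_(p : I * J) F p.1 p.2
  === \big[hadd/hzero]_i \big[hadd/hzero]_j F i j.
Proof.
(* The enumeration of [I * J] is compared with the list of pairs only up to permutation. *)
rewrite -hsum_pair; apply: hsum_perm; apply: uniq_perm.
- exact: index_enum_uniq.
- by apply: allpairs_uniq => [||[a b] [a' b'] _ _ /=]; rewrite ?index_enum_uniq.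
move=> [a b]; rewrite mem_index_enum; symmetry; apply/allpairsP.
by exists (a, b); rewrite !mem_index_enum.
Qed.

Lemma comp_suml X Y Z I (r : seq I) (F : I -> Mor Y Z) (g : Mor X Y) :
  (\big[hadd/hzero]_(i <- r) F i) ∘ g === \big[hadd/hzero]_(i <- r) (F i ∘ g).
Proof.
elim: r => [|i r IH]; first by rewrite !big_nil comp_zerol.
by rewrite !big_cons (comp_addl HD) IH.
Qed.

Lemma comp_sumr X Y Z I (r : seq I) (F : I -> Mor X Y) (g : Mor Y Z) :
  g ∘ (\big[hadd/hzero]_(i <- r) F i) === \big[hadd/hzero]_(i <- r) (g ∘ F i).
Proof.
elim: r => [|i r IH]; first by rewrite !big_nil comp_zeror.
by rewrite !big_cons (comp_addr HD) IH.
Qed.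

Lemma tens_suml X Y X' Y' I (r : seq I) (F : I -> Mor X Y) (g : Mor X' Y') :
  (\big[hadd/hzero]_(i <- r) F i) ⊠ g === \big[hadd/hzero]_(i <- r) (F i ⊠ g).
Proof.
elim: r => [|i r IH]; first by rewrite !big_nil tens_zerol.
by rewrite !big_cons (tens_addl HD) IH.
Qed.

Lemma tens_sumr X Y X' Y' I (r : seq I) (F : I -> Mor X Y) (g : Mor X' Y') :
  g ⊠ (\big[hadd/hzero]_(i <- r) F i) === \big[hadd/hzero]_(i <- r) (g ⊠ F i).
Proof.
elim: r => [|i r IH]; first by rewrite !big_nil tens_zeror.
by rewrite !big_cons (tens_addr HD) IH.
Qed.

Section DirectSumDual.
Variables (I : finType) (Y : I -> D) (d : forall i, duality (Y i)) (S T : D).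
Variables (inj : forall i, Mor (Y i) S) (prj : forall i, Mor S (Y i)).
Variables (inj' : forall i, Mor (dob (d i)) T) (prj' : forall i, Mor T (dob (d i))).
Hypotheses (pi1 : forall i, prj i ∘ inj i === idm (Y i))
  (pi0 : forall i j, i != j -> prj j ∘ inj i === hzero)
  (ip : \big[hadd/hzero]_i (inj i ∘ prj i) === idm S).
Hypotheses (pi1' : forall i, prj' i ∘ inj' i === idm (dob (d i)))
  (pi0' : forall i j, i != j -> prj' j ∘ inj' i === hzero)
  (ip' : \big[hadd/hzero]_i (inj' i ∘ prj' i) === idm T).

Definition sum_ev : Mor (T ⊗ S) unit_ob :=
  \big[hadd/hzero]_i (ev (d i) ∘ (prj' i ⊠ prj i)).

Definition sum_coev : Mor unit_ob (S ⊗ T) :=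
  \big[hadd/hzero]_i ((inj i ⊠ inj' i) ∘ coev (d i)).

(** After both sums are expanded, the term with indices [i], [j] contains [prj' i ∘ inj' j]. Only
    the diagonal survives, and there the triangle identity of [d j] applies. *)
Lemma sum_zig : run S ∘ (idm S ⊠ sum_ev) ∘ assoc S T S
  ∘ (sum_coev ⊠ idm S) ∘ luni S === idm S.
Proof.
(* The mixed zigzag with [h] on its dual strand, that is, the transpose of [h]. Each term factors as
   [inj j], such a transpose and [prj i]. *)
pose q i j (h : Mor (dob (d j)) (dob (d i))) : Mor (Y i) (Y j) :=
  run (Y j) ∘ (idm (Y j) ⊠ (ev (d i) ∘ (h ⊠ idm (Y i)))) ∘ assoc (Y j) (dob (d j)) (Y i)
  ∘ (coev (d j) ⊠ idm (Y i)) ∘ luni (Y i).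
have E i j : run S ∘ (idm S ⊠ (ev (d i) ∘ (prj' i ⊠ prj i))) ∘ assoc S T S
    ∘ (((inj j ⊠ inj' j) ∘ coev (d j)) ⊠ idm S) ∘ luni S
    === inj j ∘ q i j (prj' i ∘ inj' j) ∘ prj i.
  rewrite /q; stk; set f := stg (At S) (At (Y i)) (prj i) R.
  zrew (heq_flip (stg_nat (A := At _) (B := At _) (inj j) (idm T ⊠ f))).
  zrew (heq_flip (stg_nat (A := At _) (B := At _) (inj j)
    (stg (At T) (At (dob (d i))) (prj' i) (Y i ⊗ R)))).
  zrew (heq_flip (stg_nat (A := At _) (B := At _) (inj j) (ev_st (ev (d i)) R))).
  wrew (At (Y j)) (heq_flip (stg_nat (A := At _) (B := At _) (inj' j) f)).
  by zrew (heq_flip (coev_st_tail (coev (d j)) f)).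
rewrite /sum_ev /sum_coev.
transitivity (\big[hadd/hzero]_j \big[hadd/hzero]_i (run S
    ∘ (idm S ⊠ (ev (d i) ∘ (prj' i ⊠ prj i))) ∘ assoc S T S
    ∘ (((inj j ⊠ inj' j) ∘ coev (d j)) ⊠ idm S) ∘ luni S)).
  rewrite tens_suml comp_sumr comp_suml; apply: hsum_congr => j.
  by rewrite tens_sumr comp_sumr !comp_suml.
transitivity (\big[hadd/hzero]_j (inj j ∘ prj j)); last exact: ip.
apply: hsum_congr => j; rewrite (hsum_pick (i := j)) => [|i ij]; rewrite E /q.
  by rewrite pi1' wh_id comp_id (zig (d j)) comp_id.
rewrite pi0' 1?eq_sym // tens_zerol comp_zeror tens_zeror comp_zeror.
by rewrite !(comp_zerol, comp_zeror).
Qed.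

Lemma sum_zag : lun T ∘ (sum_ev ⊠ idm T) ∘ associ T S T
  ∘ (idm T ⊠ sum_coev) ∘ runi T === idm T.
Proof.
pose q i j (h : Mor (Y j) (Y i)) : Mor (dob (d i)) (dob (d j)) :=
  lun (dob (d j)) ∘ ((ev (d i) ∘ (idm (dob (d i)) ⊠ h)) ⊠ idm (dob (d j)))
  ∘ associ (dob (d i)) (Y j) (dob (d j))
  ∘ (idm (dob (d i)) ⊠ coev (d j)) ∘ runi (dob (d i)).
have E i j : lun T ∘ ((ev (d i) ∘ (prj' i ⊠ prj i)) ⊠ idm T) ∘ associ T S T
    ∘ (idm T ⊠ ((inj j ⊠ inj' j) ∘ coev (d j))) ∘ runi T
    === inj' j ∘ q i j (prj i ∘ inj j) ∘ prj' i.
  rewrite /q; stk.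
  set h := stg (At (dob (d j))) (At T) (inj' j) R.
  wrew (At T) (stg_nat (A := At _) (B := At _) (inj j) h).
  wrew (At T) (stg_nat (A := At _) (B := At _) (prj i) h).
  zrew (stg_nat (A := At _) (B := At _) (prj' i) (idm (Y i) ⊠ h)).
  zrew (ev_st_tail (ev (d i)) h).
  zrew (stg_nat (A := At _) (B := At _) (prj' i)
    (stg (At S) (At (Y i)) (prj i) (dob (d j) ⊗ R))).
  zrew (stg_nat (A := At _) (B := At _) (prj' i)
    (stg (At (Y j)) (At S) (inj j) (dob (d j) ⊗ R))).
  by zrew (stg_nat (A := At _) (B := At _) (prj' i) (coev_st (coev (d j)) R)).
rewrite /sum_ev /sum_coev.
transitivity (\big[hadd/hzero]_j \big[hadd/hzero]_i (lun T
    ∘ ((ev (d i) ∘ (prj' i ⊠ prj i)) ⊠ idm T) ∘ associ T S T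
    ∘ (idm T ⊠ ((inj j ⊠ inj' j) ∘ coev (d j))) ∘ runi T)).
  rewrite tens_sumr comp_sumr comp_suml; apply: hsum_congr => j.
  by rewrite tens_suml comp_sumr !comp_suml.
transitivity (\big[hadd/hzero]_j (inj' j ∘ prj' j)); last exact: ip'.
apply: hsum_congr => j; rewrite (hsum_pick (i := j)) => [|i ij]; rewrite E /q.
  by rewrite pi1 wh_id comp_id (zag (d j)) comp_id.
rewrite pi0 1?eq_sym // tens_zeror comp_zeror tens_zerol comp_zeror.
by rewrite !(comp_zerol, comp_zeror).
Qed.

End DirectSumDual.

(** [is_direct_sum] is a proposition, from which no duality can be extracted as data; hence
    [inhabited]. *)
Lemma direct_sum_dual (I : finType) (Y : I -> D) (d : forall i, duality (Y i)) (S T : D) :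
  is_direct_sum Y S -> is_direct_sum (fun i => dob (d i)) T -> inhabited (duality S).
Proof.
move=> [inj [prj [pi1 pi0 ip]]] [inj' [prj' [pi1' pi0' ip']]].
by split; apply: (@Dual _ S T (sum_ev prj prj') (sum_coev inj inj'));
  [apply: sum_zig | apply: sum_zag].
Qed.

Lemma direct_sum_iso (I : finType) (Y Y' : I -> D) (S : D) :
  (forall i, iso (Y i) (Y' i)) -> is_direct_sum Y S -> is_direct_sum Y' S.
Proof.
move=> YY [inj [prj [pi1 pi0 ip]]].
(* Since [I] is finite, the isomorphisms can be chosen simultaneously without a choice axiom. *)
have /fin_all_exists [f fP] i : exists f : Mor (Y i) (Y' i) * Mor (Y' i) (Y i),
    f.2 ∘ f.1 === idm _ /\ f.1 ∘ f.2 === idm _.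
  by have [u [v uv]] := YY i; exists (u, v).
exists (fun i => inj i ∘ (f i).2), (fun i => (f i).1 ∘ prj i); split=> [i|i j ij|].
- by rewrite !compA (comp_id_at _ (pi1 i)) (fP i).2.
- by rewrite !compA (comp_eq_at _ (pi0 i j ij)) comp_zerol comp_zeror.
- rewrite -[X in _ === X]ip; apply: hsum_congr => i.
  by rewrite !compA (comp_id_at _ (fP i).1).
Qed.
End Linear.

(** * Quotients, Karoubi envelopes and linearisations *)

Ltac base_law S :=
  first [ exact: (comp_idl S)
        | exact: (comp_idr S)
        | exact: (comp_assoc S)
        | exact: (tens_id S)
        | exact: (tens_comp S)
        | exact: (assocK S)
        | exact: (associK S)
        | exact: (assoc_nat S)
        | exact: (lunK S)
        | exact: (luniK S)
        | exact: (lun_nat S)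
        | exact: (runK S)
        | exact: (runiK S)
        | exact: (run_nat S)
        | exact: (pentagon S)
        | exact: (triangle S)
        | exact: (braid_nat S)
        | exact: (braidK S)
        | exact: (hexagon S)
        | exact: (heq_refl S) ].

Ltac linear_law S :=
  first [ exact: (add_assoc S)
        | exact: (add_comm S)
        | exact: (add_zero S)
        | exact: (add_opp S)
        | exact: (scale_one S)
        | exact: (scale_scale S)
        | exact: (scale_addr S)
        | exact: (scale_addl S)
        | exact: (comp_addl S)
        | exact: (comp_addr S)
        | exact: (comp_scalel S)
        | exact: (comp_scaler S)
        | exact: (tens_addl S)
        | exact: (tens_addr S)
        | exact: (tens_scalel S)
        | exact: (tens_scaler S) ].

Section Quotient.
Context {K : fieldType} {D : linsymmon K} {HD : linsymmon_laws D}.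
Variable J : forall X Y : D, Mor X Y -> Prop.
Hypothesis HJ : tensor_ideal J.

Lemma quot_of_heq (X Y : D) (f g : Mor X Y) : f === g -> J (f ⊟ g).
Proof.
move=> /sub_eq0 fg; apply: (ideal_heq HJ (f := hzero)); first by rewrite fg.
exact: (ideal_zero HJ).
Qed.

Lemma quot_laws : linsymmon_laws (quot_cat J).
Proof.
have q := quot_of_heq; have S := base_laws HD; have E := ideal_heq HJ.
have cancel (X Y : D) (f g h : Mor X Y) : (f ⊟ g) ⊞ (g ⊟ h) === f ⊟ h.
  rewrite -(add_assoc HD) (add_assoc HD _ g) (add_comm HD _ g) (add_opp HD).
  by rewrite (add_zero HD).
have subl (X Y Z : D) (f f' : Mor Y Z) (g : Mor X Y) :
    (f ∘ g) ⊟ (f' ∘ g) === (f ⊟ f') ∘ g.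
  by rewrite (comp_addl HD) (comp_scalel HD).
have subr (X Y Z : D) (f : Mor Y Z) (g g' : Mor X Y) :
    (f ∘ g) ⊟ (f ∘ g') === f ∘ (g ⊟ g').
  by rewrite (comp_addr HD) (comp_scaler HD).
have tsubl (X Y X' Y' : D) (f f' : Mor X Y) (g : Mor X' Y') :
    (f ⊠ g) ⊟ (f' ⊠ g) === (f ⊟ f') ⊠ g.
  by rewrite (tens_addl HD) (tens_scalel HD).
have tsubr (X Y X' Y' : D) (f : Mor X Y) (g g' : Mor X' Y') :
    (f ⊠ g) ⊟ (f ⊠ g') === f ⊠ (g ⊟ g').
  by rewrite (tens_addr HD) (tens_scaler HD).
(* The splitting g f - g' f' = (g - g') f + g' (f - f') reduces compatibility with composition to
   the two absorption properties of the ideal. *)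
have csub (X Y Z : D) (g g' : Mor Y Z) (f f' : Mor X Y) :
    ((g ⊟ g') ∘ f) ⊞ (g' ∘ (f ⊟ f')) === g ∘ f ⊟ g' ∘ f'.
  by rewrite -subl -subr cancel.
have tsub (X Y X' Y' : D) (f g : Mor X Y) (f' g' : Mor X' Y') :
    ((f ⊟ g) ⊠ f') ⊞ (g ⊠ (f' ⊟ g')) === f ⊠ f' ⊟ g ⊠ g'.
  by rewrite -tsubl -tsubr cancel.
have opp (X Y : D) (f g : Mor X Y) : -1 ·: (f ⊟ g) === g ⊟ f.
  by rewrite (scale_addr HD) (scale_scale HD) mulrNN mulr1 (scale_one HD) (add_comm HD).
have addsub (X Y : D) (f f' g g' : Mor X Y) : (f ⊟ f') ⊞ (g ⊟ g') === f ⊞ g ⊟ (f' ⊞ g').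
  by rewrite (scale_addr HD) add_acomm.
have scalesub (X Y : D) c (f f' : Mor X Y) : c ·: (f ⊟ f') === c ·: f ⊟ c ·: f'.
  by rewrite (scale_addr HD) !(scale_scale HD) mulrC.
split; [split| | |..]; try by move=> *; apply: q; base_law S.
all: try by move=> *; apply: q; linear_law HD.
- by move=> X Y f g /(ideal_scale HJ (-1)); apply: E; apply: opp.
- by move=> X Y f g h fg gh; apply: E (cancel _ _ _ _ _) (ideal_add HJ fg gh).
- move=> X Y Z g g' f f' gg ff; apply: E (csub _ _ _ _ _ _ _) _.
  by apply: (ideal_add HJ); [apply: (ideal_compr HJ) | apply: (ideal_compl HJ)].
- move=> X Y X' Y' f g f' g' fg fg'; apply: E (tsub _ _ _ _ _ _ _ _) _.
  by apply: (ideal_add HJ); [apply: (ideal_tensr HJ) | apply: (ideal_tensl HJ)].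
- by move=> X Y f f' g g' ff gg; apply: E (addsub _ _ _ _ _ _) (ideal_add HJ ff gg).
- by move=> X Y c f f' ff; apply: E (scalesub _ _ _ _ _) (ideal_scale HJ c ff).
Qed.

Definition quot_dual (X : D) (d : duality X) : duality (X : quot_cat J) :=
  @Dual (quot_cat J) X (dob d) (ev d) (coev d)
    (quot_of_heq (zig d)) (quot_of_heq (zag d)).

End Quotient.

Lemma generated_ideal_ideal (K : fieldType) (D : linsymmon K)
    (T : forall X Y : D, Mor X Y -> Mor X Y -> Prop) :
  tensor_ideal (generated_ideal T).
Proof.
split.
- by move=> X Y f g fg Jf J HJ TJ; apply: (ideal_heq HJ fg); apply: Jf.
- by move=> X Y J HJ TJ; apply: (ideal_zero HJ).
- by move=> X Y f g Jf Jg J HJ TJ; apply: (ideal_add HJ); [apply: Jf | apply: Jg].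
- by move=> X Y c f Jf J HJ TJ; apply: (ideal_scale HJ); apply: Jf.
- by move=> X Y Z g f Jf J HJ TJ; apply: (ideal_compl HJ); apply: Jf.
- by move=> X Y Z g f Jf J HJ TJ; apply: (ideal_compr HJ); apply: Jf.
- by move=> X Y X' Y' g f Jf J HJ TJ; apply: (ideal_tensl HJ); apply: Jf.
- by move=> X Y X' Y' g f Jf J HJ TJ; apply: (ideal_tensr HJ); apply: Jf.
Qed.

Section Karoubi.
Context {K : fieldType} {D : linsymmon K} {HD : linsymmon_laws D}.
Local Notation KD := (karoubi HD).
Let S := base_laws HD.
Implicit Types X Y Z : KD.

Lemma kar_l X Y (f : Mor X Y) : kidem Y ∘ kfun f === kfun f.
Proof. by rewrite -(kfunP f) (comp_eq_at _ (kidemP Y)). Qed.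

Lemma kar_r X Y (f : Mor X Y) : kfun f ∘ kidem X === kfun f.
Proof. by rewrite -(kfunP f) !compA (kidemP X). Qed.

(* On morphisms that commute with the idempotents, [karm] is compatible with all
   operations.  Hence an equation in the envelope follows from the equation
   between inducing morphisms, and every axiom is inherited from D. *)
Definition induces X Y (f : Mor X Y) (m : Mor (kob X) (kob Y)) : Prop :=
  kidem Y ∘ m === m ∘ kidem X /\ kfun f === m ∘ kidem X.

Lemma induces_eq X Y (f g : Mor X Y) m n :
  induces f m -> induces g n -> m === n -> f === g.
Proof. by move=> [_ fm] [_ gn] mn; change (kfun f === kfun g); rewrite fm gn mn. Qed.

Lemma induces_self X Y (f : Mor X Y) : induces f (kfun f).
Proof. by split; rewrite kar_r // kar_l. Qed.

Lemma induces_karm X Y (m : Mor (kob X) (kob Y)) :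
  kidem Y ∘ m === m ∘ kidem X -> induces (karm HD m : Mor X Y) m.
Proof.
move=> mE; split=> //=; rewrite (comp_eq2_at _ mE); by rewrite (kidemP X).
Qed.

Lemma induces_id X : induces (idm X) (idm (kob X)).
Proof. by apply: induces_karm; rewrite id_comp comp_id. Qed.

Lemma induces_comp X Y Z (g : Mor Y Z) (f : Mor X Y) n m :
  induces g n -> induces f m -> induces (g ∘ f) (n ∘ m).
Proof.
move=> [nE gn] [mE fm]; split; first by rewrite (comp_eq2_at _ nE) mE compA.
change (kidem Z ∘ (kfun g ∘ kfun f ∘ kidem X) === n ∘ m ∘ kidem X).
rewrite gn fm !compA (comp_eq2_at _ nE) (comp_eq_at _ (kidemP Y)) (comp_eq2_at _ mE) (kidemP X).
by rewrite (kidemP X).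
Qed.

Lemma induces_tens X Y X' Y' (f : Mor X Y) (g : Mor X' Y') m n :
  induces f m -> induces g n -> induces (f ⊠ g) (m ⊠ n).
Proof.
move=> [mE fm] [nE gn]; split; first by rewrite /= -!(tens_comp S) mE nE.
rewrite /= -!(tens_comp S) !kar_r !kar_l; exact: (tens_congr S).
Qed.

Lemma induces_assoc X Y Z : induces (assoc X Y Z) (assoc (kob X) (kob Y) (kob Z)).
Proof. by apply: induces_karm; rewrite /= (assoc_nat S). Qed.

Lemma induces_lun X : induces (lun X) (lun (kob X)).
Proof. by apply: induces_karm; rewrite /= (lun_nat S). Qed.

Lemma induces_run X : induces (run X) (run (kob X)).
Proof. by apply: induces_karm; rewrite /= (run_nat S). Qed.

Lemma induces_braid X Y : induces (braid X Y) (braid (kob X) (kob Y)).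
Proof. by apply: induces_karm; rewrite /= (braid_nat S). Qed.

Lemma nat_inv (A B A' B' : D) (s : Mor A B) (si : Mor B A) (t : Mor A' B')
    (ti : Mor B' A') (u : Mor A A') (v : Mor B B') :
  s ∘ si === idm _ -> ti ∘ t === idm _ -> t ∘ u === v ∘ s -> u ∘ si === ti ∘ v.
Proof.
move=> ss tt E; rewrite -[u]id_comp -tt !compA (comp_eq2_at _ E) ss.
by rewrite comp_id.
Qed.

Lemma induces_associ X Y Z : induces (associ X Y Z) (associ (kob X) (kob Y) (kob Z)).
Proof.
apply: induces_karm; apply: (nat_inv (associK S _ _ _) (assocK S _ _ _)).
exact: (assoc_nat S).
Qed.

Lemma induces_luni X : induces (luni X) (luni (kob X)).
Proof.
apply: induces_karm; apply: (nat_inv (luniK S _) (lunK S _)); exact: (lun_nat S).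
Qed.

Lemma induces_runi X : induces (runi X) (runi (kob X)).
Proof.
apply: induces_karm; apply: (nat_inv (runiK S _) (runK S _)); exact: (run_nat S).
Qed.

Lemma induces_zero X Y : induces (hzero : Mor X Y) hzero.
Proof. by apply: induces_karm; rewrite comp_zerol comp_zeror. Qed.

Lemma induces_add X Y (f g : Mor X Y) m n :
  induces f m -> induces g n -> induces (f ⊞ g) (m ⊞ n).
Proof.
move=> [mE fm] [nE gn]; split; first by rewrite (comp_addl HD) (comp_addr HD) mE nE.
rewrite /= !(comp_addl HD) !(comp_addr HD) !kar_r !kar_l; exact: (add_congr HD).
Qed.

Lemma induces_scale X Y c (f : Mor X Y) m : induces f m -> induces (c ·: f) (c ·: m).
Proof.
move=> [mE fm]; split; first by rewrite (comp_scalel HD) (comp_scaler HD) mE.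
by rewrite /= !(comp_scalel HD) !(comp_scaler HD) kar_r kar_l; exact: (scale_congr HD).
Qed.

Ltac induce :=
  lazymatch goal with
  | |- induces ?f _ =>
    lazymatch f with
    | compm _ _ => apply: induces_comp; induce
    | tensm _ _ => apply: induces_tens; induce
    | hadd _ _ => apply: induces_add; induce
    | hscale _ _ => apply: induces_scale; induce
    | hzero => exact: induces_zero
    | idm _ => exact: induces_id
    | assoc _ _ _ => exact: induces_assoc
    | associ _ _ _ => exact: induces_associ
    | lun _ => exact: induces_lun
    | luni _ => exact: induces_luni
    | run _ => exact: induces_run
    | runi _ => exact: induces_runi
    | braid _ _ => exact: induces_braid
    | _ => exact: induces_self
    end
  end.

Ltac induced := apply: induces_eq; [induce | induce |].

Lemma karoubi_laws : linsymmon_laws KD.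
Proof.
split; [split| | |..].
all: try by move=> *; induced; base_law S.
all: try by move=> *; induced; linear_law HD.
- by move=> X Y f g fg; apply: (heq_sym S).
- by move=> X Y f g h; apply: (heq_trans S).
- move=> X Y Z g g' f f' gg ff; apply: (comp_congr S) => //.
  by apply: (comp_congr S) => //; apply: (comp_congr S).
- move=> X Y X' Y' f g f' g' fg fg'; apply: (comp_congr S) => //.
  by apply: (comp_congr S) => //; apply: (tens_congr S).
- move=> X Y f f' g g' ff gg; apply: (comp_congr S) => //.
  by apply: (comp_congr S) => //; apply: (add_congr HD).
- move=> X Y c f f' ff; apply: (comp_congr S) => //.
  by apply: (comp_congr S) => //; apply: (scale_congr HD).
Qed.

Definition kid (X : D) : KD := KarOb (comp_idl S (idm X)).

Ltac good := solve [apply: induces_karm; rewrite /= ?wh_id ?id_comp ?comp_id //].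

Definition kid_functor : symmonfun D KD.
Proof.
unshelve refine (@SymMonFun D KD kid (fun (X Y : D) f => karm HD (X := kid X) (Y := kid Y) f)
  (@karm _ _ HD (unit_ob : KD) (kid unit_ob) (idm unit_ob))
  (@karm _ _ HD (kid unit_ob) (unit_ob : KD) (idm unit_ob))
  (fun X Y : D => @karm _ _ HD (kid X ⊗ kid Y : KD) (kid (X ⊗ Y)) (idm (X ⊗ Y)))
  (fun X Y : D => @karm _ _ HD (kid (X ⊗ Y)) (kid X ⊗ kid Y : KD) (idm (X ⊗ Y)))
  _ _ _ _ _ _ _ _ _ _ _ _).
- by move=> X Y f g fg; apply: induces_eq; [good | good | exact: fg].
- by move=> X; apply: induces_eq; [good | induce | by []].
- by move=> X Y Z g f; apply: induces_eq; [good | apply: induces_comp; good | by []].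
- by apply: induces_eq; [apply: induces_comp; good | induce | rewrite /= id_comp].
- by apply: induces_eq; [apply: induces_comp; good | induce | rewrite /= id_comp].
- by move=> X Y; apply: induces_eq; [apply: induces_comp; good | induce | rewrite /= id_comp].
- by move=> X Y; apply: induces_eq; [apply: induces_comp; good | induce | rewrite /= id_comp].
- move=> X Y X' Y' f g; apply: induces_eq;
    [apply: induces_comp; good | apply: induces_comp; [good | apply: induces_tens; good] |].
  by rewrite /= id_comp comp_id.
- move=> X Y Z; apply: induces_eq.
  + apply: induces_comp; [apply: induces_comp; good | apply: induces_tens; [good | induce]].
  + apply: induces_comp; [|induce].
    by apply: induces_comp; [good | apply: induces_tens; [induce | good]].
  + by rewrite /= !wh_id !comp_id id_comp.
- move=> X; apply: induces_eq; [|induce|].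
  + apply: induces_comp; [apply: induces_comp; good | apply: induces_tens; [good | induce]].
  + by rewrite /= !wh_id !comp_id.
- move=> X; apply: induces_eq; [|induce|].
  + apply: induces_comp; [apply: induces_comp; good | apply: induces_tens; [induce | good]].
  + by rewrite /= !wh_id !comp_id.
- move=> X Y; apply: induces_eq.
  + by apply: induces_comp; good.
  + by apply: induces_comp; [good | induce].
  + by rewrite /= id_comp comp_id.
Defined.

End Karoubi.

Section Linearisation.
Variables (K : fieldType) (D : symmon).
Context {HD : symmon_laws D}.
Local Notation L := (linearisation K D).
Implicit Types X Y Z : D.

(** The linear extension that defines [lc_eq]. By [lext_comp] and [lext_tens] an axiom becomes an
    equality of iterated sums, whose terms agree by the corresponding axiom of [D]. *)
Definition lext X Y (phi : Mor X Y -> K) (s : @Mor L X Y) : K :=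
  \sum_(p <- s) p.1 * phi p.2.

Lemma lext_eq X Y (phi psi : Mor X Y -> K) s : phi =1 psi -> lext phi s = lext psi s.
Proof. by move=> E; apply: eq_bigr => p _; rewrite E. Qed.

Lemma lext_comp X Y Z (phi : Mor X Z -> K) (g : @Mor L Y Z) (f : @Mor L X Y) :
  lext phi (g ∘ f) = lext (fun p => lext (fun q => phi (p ∘ q)) f) g.
Proof.
rewrite /lext big_allpairs_dep; apply: eq_bigr => p _.
by rewrite big_distrr; apply: eq_bigr => q _; rewrite /= mulrA.
Qed.

Lemma lext_tens X Y X' Y' (phi : Mor (X ⊗ X') (Y ⊗ Y') -> K)
    (f : @Mor L X Y) (g : @Mor L X' Y') :
  lext phi (f ⊠ g) = lext (fun p => lext (fun q => phi (p ⊠ q)) g) f.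
Proof.
rewrite /lext big_allpairs_dep; apply: eq_bigr => p _.
by rewrite big_distrr; apply: eq_bigr => q _; rewrite /= mulrA.
Qed.

Lemma lext_lc1 X Y (phi : Mor X Y -> K) f : lext phi (lc1 K f) = phi f.
Proof. by rewrite /lext big_seq1 mul1r. Qed.

Lemma lext_add X Y (phi : Mor X Y -> K) s t : lext phi (s ⊞ t) = lext phi s + lext phi t.
Proof. exact: big_cat. Qed.

Lemma lext_scale X Y (phi : Mor X Y -> K) c s : lext phi (c ·: s) = c * lext phi s.
Proof. by rewrite /lext big_map big_distrr; apply: eq_bigr => p _; rewrite /= mulrA. Qed.

Lemma lext_zero X Y (phi : Mor X Y -> K) : lext phi hzero = 0.
Proof. exact: big_nil. Qed.

Lemma lext_addf X Y (phi psi : Mor X Y -> K) s :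
  lext (fun p => phi p + psi p) s = lext phi s + lext psi s.
Proof. by rewrite /lext -big_split; apply: eq_bigr => p _; rewrite mulrDr. Qed.

Lemma lext_scalef X Y (phi : Mor X Y -> K) c s :
  lext (fun p => c * phi p) s = c * lext phi s.
Proof. by rewrite /lext big_distrr; apply: eq_bigr => p _; rewrite /= mulrCA. Qed.

Lemma lext_exchange X Y X' Y' (phi : Mor X Y -> Mor X' Y' -> K) s t :
  lext (fun p => lext (phi p) t) s = lext (fun q => lext (phi^~ q) s) t.
Proof.
rewrite /lext; under eq_bigr => p _ do rewrite big_distrr.
rewrite exchange_big; apply: eq_bigr => q _; rewrite big_distrr.
by apply: eq_bigr => p _; rewrite /= mulrCA.
Qed.

Lemma linearisation_laws : linsymmon_laws L.
Proof.
have C X Y (phi : Mor X Y -> K) (s t : @Mor L X Y) :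
  s === t -> (forall f g, f === g -> phi f = phi g) -> lext phi s = lext phi t.
  by move=> st; apply: st.
have cl := lext_comp; have tl := lext_tens; have l1 := lext_lc1.
split; [split| | |..].
- by [].
- by move=> X Y f g fg phi Hphi; rewrite fg.
- by move=> X Y f g h fg gh phi Hphi; rewrite fg ?gh.
- move=> X Y Z g g' f f' gg ff phi P; rewrite -!/(lext _ _) !cl.
  rewrite (C _ _ _ _ _ gg) => [|p q pq]; last first.
    by apply: lext_eq => z; apply: P; rewrite pq.
  by apply: lext_eq => p; apply: (C _ _ _ _ _ ff) => u v uv; apply: P; rewrite uv.
- move=> X Y f phi P; rewrite -!/(lext _ _) cl l1.
  by apply: lext_eq => p; apply: P; rewrite id_comp.
- move=> X Y f phi P; rewrite -!/(lext _ _) cl.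
  by apply: lext_eq => p; rewrite l1; apply: P; rewrite comp_id.
- move=> X Y Z T h g f phi P; rewrite -!/(lext _ _) !cl.
  apply: lext_eq => p; rewrite cl; apply: lext_eq => q; apply: lext_eq => u.
  by apply: P; rewrite compA.
- move=> X Y X' Y' f g f' g' fg fg' phi P; rewrite -!/(lext _ _) !tl.
  rewrite (C _ _ _ _ _ fg) => [|p q pq]; last first.
    by apply: lext_eq => z; apply: P; rewrite pq.
  by apply: lext_eq => p; apply: (C _ _ _ _ _ fg') => u v uv; apply: P; rewrite uv.
- by move=> X Y phi P; rewrite -!/(lext _ _) tl !l1; apply: P; rewrite wh_id.
- move=> X Y Z X' Y' Z' g f g' f' phi P; rewrite -!/(lext _ _) tl !cl tl.
  apply: lext_eq => p; under lext_eq => q do rewrite cl.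
  (* The two sides of the interchange law sum over [f] and [g'] in opposite orders. *)
  rewrite lext_exchange; apply: lext_eq => q; rewrite tl; apply: lext_eq => u.
  by apply: lext_eq => v; apply: P; rewrite (tens_comp HD).
- by move=> X Y Z phi P; rewrite -!/(lext _ _) cl !l1; apply: P; apply: assocK.
- by move=> X Y Z phi P; rewrite -!/(lext _ _) cl !l1; apply: P; apply: associK.
- move=> X Y Z X' Y' Z' f g h phi P; rewrite -!/(lext _ _) !cl l1 !tl.
  apply: lext_eq => p; rewrite tl; apply: lext_eq => q; apply: lext_eq => u.
  by rewrite l1; apply: P; apply: assoc_nat.
- by move=> X phi P; rewrite -!/(lext _ _) cl !l1; apply: P; apply: lunK.
- by move=> X phi P; rewrite -!/(lext _ _) cl !l1; apply: P; apply: luniK.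
- move=> X Y f phi P; rewrite -!/(lext _ _) !cl !l1 tl l1.
  by apply: lext_eq => p; rewrite l1; apply: P; apply: lun_nat.
- by move=> X phi P; rewrite -!/(lext _ _) cl !l1; apply: P; apply: runK.
- by move=> X phi P; rewrite -!/(lext _ _) cl !l1; apply: P; apply: runiK.
- move=> X Y f phi P; rewrite -!/(lext _ _) !cl !l1 tl.
  by apply: lext_eq => p; rewrite !l1; apply: P; apply: run_nat.
- move=> X Y Z T phi P; rewrite -!/(lext _ _) !(cl, tl, l1).
  by apply: P; apply: pentagon.
- by move=> X Y phi P; rewrite -!/(lext _ _) !(cl, tl, l1); apply: P; apply: triangle.
- move=> X Y X' Y' f g phi P; rewrite -!/(lext _ _) !cl !l1 !tl lext_exchange.
  apply: lext_eq => p; apply: lext_eq => q; rewrite l1.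
  by apply: P; apply: braid_nat.
- by move=> X Y phi P; rewrite -!/(lext _ _) cl !l1; apply: P; apply: braidK.
- by move=> X Y Z phi P; rewrite -!/(lext _ _) !(cl, tl, l1); apply: P; apply: hexagon.
- move=> X Y f f' g g' ff gg phi P; rewrite -!/(lext _ _) !lext_add.
  by congr (_ + _); [apply: ff | apply: gg].
- by move=> X Y c f f' ff phi P; rewrite -!/(lext _ _) !lext_scale; congr (_ * _); apply: ff.
all: move=> *; move=> phi P; rewrite -!/(lext _ _).
all: rewrite ?(cl, tl) ?(lext_add, lext_scale, lext_zero) ?(cl, tl) //.
all: rewrite ?(addrA, mulN1r, subrr, mul1r, mulrA, mulrDr, mulrDl) //.
- exact: addrC.
- by rewrite -lext_addf; apply: lext_eq => p; apply: lext_add.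
- by rewrite -lext_scalef; apply: lext_eq => p; apply: lext_scale.
- by rewrite -lext_addf; apply: lext_eq => p; apply: lext_add.
- by rewrite -lext_scalef; apply: lext_eq => p; apply: lext_scale.
Qed.

End Linearisation.

(** Equality of diagrams is tested by evaluation in all symmetric monoidal categories, so each law
    holds because it holds in every one of them. *)
Lemma diagrams_laws (r : nat) : symmon_laws (diagrams r).
Proof.
split.
- by move=> X Y f D HD U d t; apply: (heq_refl HD).
- by move=> X Y f g fg D HD U d t; apply: (heq_sym HD); apply: fg.
- move=> X Y f g h fg gh D HD U d t.
  by apply: (heq_trans HD); [apply: fg | apply: gh].
- move=> X Y Z g g' f f' gg ff D HD U d t.
  by apply: (comp_congr HD); [apply: gg | apply: ff].
- by move=> X Y f D HD U d t; apply: (comp_idl HD).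
- by move=> X Y f D HD U d t; apply: (comp_idr HD).
- by move=> X Y Z T h g f D HD U d t; apply: (comp_assoc HD).
- move=> X Y X' Y' f g f' g' fg fg' D HD U d t.
  by apply: (tens_congr HD); [apply: fg | apply: fg'].
all: move=> *; move=> D HD U d t; base_law HD.
Qed.

(** * Formal direct sums *)

Section DirectSums.
Context {K : fieldType} {D : linsymmon K} {HD : linsymmon_laws D}.
Local Notation S := (direct_sums D).
Local Notation fam X i := (@dsfam K D X i).
Let HS := base_laws HD.

(** One row of [dmat], isolated so that the cast along [y = j] is dealt with once and for all. *)
Definition dent (X : dsum D) (i : X) (Y : dsum D) (y : Y) (m : Mor (fam X i) (fam Y y))
    (j : Y) : Mor (fam X i) (fam Y j) :=
  match y =P j with
  | ReflectT e => eq_rect y (fun j => Mor (fam X i) (fam Y j)) m j e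
  | ReflectF _ => hzero
  end.

Lemma dmatE (X Y : dsum D) (s : X -> Y) (m : forall i, Mor (fam X i) (fam Y (s i))) i j :
  dmat m i j = dent (m i) j.
Proof. by []. Qed.

Lemma dent_eq (X : dsum D) (i : X) (Y : dsum D) (y : Y) (m : Mor (fam X i) (fam Y y)) :
  dent m y = m.
(* Index types have decidable equality, so every proof of [y = y] is trivial and the cast
   disappears. *)
Proof. by rewrite /dent; case: eqP => // e; rewrite (eq_axiomK e). Qed.

Lemma dent_neq (X : dsum D) (i : X) (Y : dsum D) (y : Y) (m : Mor (fam X i) (fam Y y)) j :
  j != y -> dent m j = hzero.
Proof. by rewrite /dent; case: eqP => // yj /eqP[]. Qed.

Lemma dent_congr (X : dsum D) (i : X) (Y : dsum D) (y : Y) (m n : Mor (fam X i) (fam Y y)) j :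
  m === n -> dent m j === dent n j.
Proof.
case: (eqVneq j y) => [->|jy]; first by rewrite !dent_eq.
by rewrite !(dent_neq _ jy).
Qed.

#[local] Instance dsum_equiv (X Y : S) : Equivalence (@heq S X Y).
Proof.
split.
- by move=> f i j.
- by move=> f g fg i j; apply: (heq_sym HS).
- by move=> f g h fg gh i j; apply: (heq_trans HS) (fg i j) (gh i j).
Qed.

#[local] Instance dsum_comp (X Y Z : S) : Proper (heq ==> heq ==> heq) (@compm S X Y Z).
Proof.
by move=> g g' gg f f' ff i k; apply: hsum_congr => j; apply: (comp_congr HS).
Qed.

#[local] Instance dsum_tens (X Y X' Y' : S) :
  Proper (heq ==> heq ==> heq) (@tensm S X Y X' Y').
Proof. by move=> f f' ff g g' gg i j; apply: (tens_congr HS). Qed.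

Lemma comp_dent (X Y Z : S) (g : Mor Y Z) (f : Mor X Y) (i : X) (k : Z) (y : Y)
    (m : Mor (fam X i) (fam Y y)) :
  (forall j, f i j = dent m j) -> (g ∘ f) i k === g y k ∘ m.
Proof.
move=> fE; rewrite /compm /= (hsum_pick (i := y)) => [|j jy]; rewrite fE.
  by rewrite dent_eq.
by rewrite dent_neq // comp_zeror.
Qed.

Arguments comp_dent X Y {Z g f} i {k} y m _.

(** A row of [dmat] has at most one nonzero entry by construction; for a column this requires [s] to
    be injective. *)
Lemma dent_comp (X Y Z : S) (s : Y -> Z) (m : forall j, Mor (fam Y j) (fam Z (s j)))
    (f : Mor X Y) (i : X) (l : Y) :
  injective s -> ((dmat m : @Mor S Y Z) ∘ f) i (s l) === m l ∘ f i l.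
Proof.
move=> s_inj; rewrite /compm /= (hsum_pick (i := l)) => [|j jl]; rewrite dmatE.
  by rewrite dent_eq.
by rewrite dent_neq ?comp_zerol // (inj_eq s_inj) eq_sym.
Qed.

Arguments dent_comp {X} Y Z s {m f i} l _.

Lemma dmat_comp (X Y Z : S) (s : X -> Y) (m : forall i, Mor (fam X i) (fam Y (s i)))
    (t : Y -> Z) (n : forall i, Mor (fam Y i) (fam Z (t i))) :
  (dmat n : @Mor S Y Z) ∘ (dmat m : @Mor S X Y)
  === (@dmat K D X Z (fun i => t (s i)) (fun i => n (s i) ∘ m i) : @Mor S X Z).
Proof.
move=> i k; rewrite (comp_dent X Y i (s i) (m i)) // !dmatE.
case: (eqVneq k (t (s i))) => [->|kn]; first by rewrite !dent_eq.
by rewrite !(dent_neq _ kn) comp_zerol.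
Qed.

Lemma dmat_tens (X Y X' Y' : S) (s : X -> Y) (m : forall i, Mor (fam X i) (fam Y (s i)))
    (t : X' -> Y') (n : forall i, Mor (fam X' i) (fam Y' (t i))) :
  (dmat m : @Mor S X Y) ⊠ (dmat n : @Mor S X' Y')
  === (@dmat K D (X ⊗ X' : S) (Y ⊗ Y' : S) (fun i => (s i.1, t i.2))
        (fun i => m i.1 ⊠ n i.2) : @Mor S _ _).
Proof.
move=> [i i'] [j j'] /=; rewrite !dmatE.
case: (eqVneq j (s i)) => [->|ji]; last first.
  rewrite (dent_neq _ ji) tens_zerol dent_neq //.
  by apply: contraNneq ji => -[->].
case: (eqVneq j' (t i')) => [->|ji]; last first.
  rewrite (dent_neq _ ji) tens_zeror dent_neq //.
  by apply: contraNneq ji => -[->].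
by rewrite (dent_eq (m i)) (dent_eq (n i')) (dent_eq (Y := dtens Y Y') (y := (s i, t i'))).
Qed.

Lemma direct_sums_laws : linsymmon_laws S.
Proof.
split; [split| | |..].
- by move=> X Y f.
- by move=> X Y f g ->.
- by move=> X Y f g h -> ->.
- by move=> X Y Z g g' f f' -> ->.
- by move=> X Y f i j; rewrite (dent_comp Y Y id j) ?id_comp // => ? ?.
- by move=> X Y f i j; rewrite (comp_dent X X i i (idm (fam X i))) ?comp_id.
- move=> X Y Z T h g f i l; rewrite /compm /=.
  transitivity (\big[hadd/hzero]_k \big[hadd/hzero]_j (h k l ∘ g j k ∘ f i j)).
    apply: hsum_congr => k; rewrite comp_sumr; apply: hsum_congr => j.
    by rewrite compA.
  by rewrite hsum_exchange; apply: hsum_congr => j; rewrite comp_suml.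
- by move=> X Y X' Y' f g f' g' -> ->.
- move=> X Y; rewrite dmat_tens => -[i i'] j; exact/dent_congr/wh_id.
- move=> X Y Z X' Y' Z' g f g' f' [i i'] [k k']; rewrite /compm /tensm /=.
  rewrite (hsum_pair_fin (fun j j' => (g j k ⊠ g' j' k') ∘ (f i j ⊠ f' i' j'))).
  rewrite tens_suml; apply: hsum_congr => j; rewrite tens_sumr; apply: hsum_congr => j'.
  exact: (tens_comp HS).
- move=> X Y Z; rewrite dmat_comp => -[[i1 i2] i3] j; exact/dent_congr/(assocK HS).
- move=> X Y Z; rewrite dmat_comp => -[i1 [i2 i3]] j; exact/dent_congr/(associK HS).
- move=> X Y Z X' Y' Z' f g h [[i1 i2] i3] [k1 [k2 k3]].
  rewrite (dent_comp (dtens (dtens X' Y') Z') (dtens X' (dtens Y' Z')) (fun i => (i.1.1, (i.1.2, i.2))) (k1, k2, k3)); last first.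
    by move=> [[? ?] ?] [[? ?] ?] [-> -> ->].
  rewrite (comp_dent (dtens (dtens X Y) Z) (dtens X (dtens Y Z)) (i1, i2, i3) (i1, (i2, i3)) (assoc (fam X i1) (fam Y i2) (fam Z i3))) //.
  exact: (assoc_nat HS).
- move=> X; rewrite dmat_comp => -[[] i] j; exact/dent_congr/(lunK HS).
- move=> X; rewrite dmat_comp => i j; exact/dent_congr/(luniK HS).
- move=> X Y f [[] i] j.
  rewrite (dent_comp (dtens (@dunit K D) Y) Y (fun i => i.2) (tt, j)); last first.
    by move=> [[] ?] [[] ?] /= ->.
  rewrite (comp_dent (dtens (@dunit K D) X) X (tt, i) i (lun (fam X i))) // -(lun_nat HS) /tensm /=.
  by rewrite dmatE dent_eq.
- move=> X; rewrite dmat_comp => -[i []] j; exact/dent_congr/(runK HS).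
- move=> X; rewrite dmat_comp => i j; exact/dent_congr/(runiK HS).
- move=> X Y f [i []] j.
  rewrite (dent_comp (dtens Y (@dunit K D)) Y (fun i => i.1) (j, tt)); last first.
    by move=> [? []] [? []] /= ->.
  rewrite (comp_dent (dtens X (@dunit K D)) X (i, tt) i (run (fam X i))) // -(run_nat HS) /tensm /=.
  by rewrite dmatE dent_eq.
(* Both sides are now matrices with one entry per row along the same index map, so the pentagon is
   needed only between entries. *)
- move=> X Y Z T; rewrite !dmat_tens !dmat_comp => -[[[i1 i2] i3] i4] j.
  exact/dent_congr/(pentagon HS).
- move=> X Y; rewrite !dmat_tens !dmat_comp => -[[i1 []] i3] j.
  exact/dent_congr/(triangle HS).
- move=> X Y X' Y' f g [i1 i2] [k1 k2].
  rewrite (dent_comp (dtens X' Y') (dtens Y' X') (fun i => (i.2, i.1)) (k2, k1)); last first.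
    by move=> [? ?] [? ?] [-> ->].
  rewrite (comp_dent (dtens X Y) (dtens Y X) (i1, i2) (i2, i1) (braid (fam X i1) (fam Y i2))) //.
  exact: (braid_nat HS).
- move=> X Y; rewrite !dmat_comp => -[i1 i2] j; exact/dent_congr/(braidK HS).
- move=> X Y Z; rewrite !dmat_tens !dmat_comp => -[[i1 i2] i3] j.
  exact/dent_congr/(hexagon HS).
- by move=> X Y f f' g g' ff gg i j; apply: (add_congr HD).
- by move=> X Y c f f' ff i j; apply: (scale_congr HD).
- by move=> *; move=> i j; apply: (add_assoc HD).
- by move=> *; move=> i j; apply: (add_comm HD).
- by move=> *; move=> i j; apply: (add_zero HD).
- by move=> *; move=> i j; apply: (add_opp HD).
- by move=> *; move=> i j; apply: (scale_one HD).
- by move=> *; move=> i j; apply: (scale_scale HD).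
- by move=> *; move=> i j; apply: (scale_addr HD).
- by move=> *; move=> i j; apply: (scale_addl HD).
- by move=> X Y Z g g' f i j; rewrite /= -hsum_add; apply: hsum_congr => k; apply: comp_addl.
- by move=> X Y Z g f f' i j; rewrite /= -hsum_add; apply: hsum_congr => k; apply: comp_addr.
- by move=> X Y Z c g f i j; rewrite /= hsum_scale; apply: hsum_congr => k; apply: comp_scalel.
- by move=> X Y Z c g f i j; rewrite /= hsum_scale; apply: hsum_congr => k; apply: comp_scaler.
- by move=> *; move=> i j; apply: (tens_addl HD).
- by move=> *; move=> i j; apply: (tens_addr HD).
- by move=> *; move=> i j; apply: (tens_scalel HD).
- by move=> *; move=> i j; apply: (tens_scaler HD).
Qed.

Lemma comp_unique (X Y Z : S) (y : Y) (g : Mor Y Z) (f : Mor X Y) (i : X) (k : Z) :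
  (forall j : Y, j = y) -> (g ∘ f) i k === g y k ∘ f i y.
Proof.
move=> yP; rewrite /compm /= (hsum_pick (i := y)) // => j.
by rewrite (yP j) eqxx.
Qed.
Arguments comp_unique {X} Y {Z} y {g f i k} _.

Lemma dmat_eq (X Y : S) (s : X -> Y) (m : forall i, Mor (fam X i) (fam Y (s i))) i :
  dmat m i (s i) = m i.
Proof. by rewrite dmatE dent_eq. Qed.

Lemma idm_entry (X : S) (i : X) : idm X i i = idm (fam X i).
Proof. exact: (@dmat_eq X X id (fun=> idm _)). Qed.

Let u1 (x : unit) : x = tt. Proof. by case: x. Qed.
Let u2 (x : unit * unit) : x = (tt, tt). Proof. by case: x => -[] []. Qed.
Let u3' (x : unit * (unit * unit)) : x = (tt, (tt, tt)).
Proof. by case: x => [[] [[] []]]. Qed.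

Let c1 (X W : S) (Z : D) (g : Mor (ds1 Z) W) (f : Mor X (ds1 Z)) (i : X) (k : W) :=
  @comp_unique X (ds1 Z) W tt g f i k u1.
Let c2 (X W : S) (Z Z' : D) (g : Mor (ds1 Z ⊗ ds1 Z') W) (f : Mor X (ds1 Z ⊗ ds1 Z'))
  (i : X) (k : W) := @comp_unique X (ds1 Z ⊗ ds1 Z') W (tt, tt) g f i k u2.
Let c3 (X W : S) (Z Z' Z'' : D) (g : Mor (ds1 Z ⊗ (ds1 Z' ⊗ ds1 Z'')) W)
  (f : Mor X (ds1 Z ⊗ (ds1 Z' ⊗ ds1 Z''))) (i : X) (k : W) :=
  @comp_unique X (ds1 Z ⊗ (ds1 Z' ⊗ ds1 Z'')) W (tt, (tt, tt)) g f i k u3'.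

Let dA (X Y Z : D) :
    assoc (ds1 X) (ds1 Y) (ds1 Z) (tt, tt, tt) (tt, (tt, tt)) = assoc X Y Z :=
  @dmat_eq ((ds1 X ⊗ ds1 Y) ⊗ ds1 Z) (ds1 X ⊗ (ds1 Y ⊗ ds1 Z))
    (fun i => (i.1.1, (i.1.2, i.2))) (fun=> assoc X Y Z) (tt, tt, tt).
Let dL (X : D) : lun (ds1 X) (tt, tt) tt = lun X :=
  @dmat_eq (unit_ob ⊗ ds1 X) (ds1 X) (fun i => i.2) (fun=> lun X) (tt, tt).
Let dR (X : D) : run (ds1 X) (tt, tt) tt = run X :=
  @dmat_eq (ds1 X ⊗ unit_ob) (ds1 X) (fun i => i.1) (fun=> run X) (tt, tt).
Let dB (X Y : D) : braid (ds1 X) (ds1 Y) (tt, tt) (tt, tt) = braid X Y :=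
  @dmat_eq (ds1 X ⊗ ds1 Y) (ds1 Y ⊗ ds1 X) (fun i => (i.2, i.1)) (fun=> braid X Y) (tt, tt).

(** [ds1 X ⊗ ds1 Y] is indexed by [unit * unit] and not by [unit], so the functor is strong without
    being strict; its comparison maps are identity matrices of size one. *)
Definition ds1_functor : symmonfun D S.
Proof.
unshelve refine (@SymMonFun D S (@ds1 K D) (fun X Y f => fun _ _ => f)
  (fun _ _ => idm unit_ob) (fun _ _ => idm unit_ob)
  (fun X Y => fun _ _ => idm (X ⊗ Y)) (fun X Y => fun _ _ => idm (X ⊗ Y))
  _ _ _ _ _ _ _ _ _ _ _ _).
- by move=> X Y f g fg [] [].
- by move=> X [] []; rewrite idm_entry.
- by move=> X Y Z g f [] []; rewrite c1.
- by move=> [] []; rewrite (comp_unique (ds1 unit_ob) tt u1) id_comp idm_entry.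
- by move=> [] []; rewrite (comp_unique (@dunit K D) tt u1) id_comp idm_entry.
- by move=> X Y [[] []] [[] []]; rewrite c1 id_comp idm_entry.
- by move=> X Y [] []; rewrite c2 id_comp idm_entry.
- by move=> X Y X' Y' f g [[] []] []; rewrite c1 c2 id_comp comp_id.
- move=> X Y Z [[[] []] []] [].
  rewrite c2 c1 c3 c2.
  change (assoc X Y Z ∘ idm ((X ⊗ Y) ⊗ Z) ∘ (idm (X ⊗ Y) ⊠ idm (ds1 Z) tt tt)
    === idm (X ⊗ (Y ⊗ Z)) ∘ (idm (ds1 X) tt tt ⊠ idm (Y ⊗ Z)) ∘ assoc (ds1 X) (ds1 Y) (ds1 Z) (tt, tt, tt) (tt, (tt, tt))).
  by rewrite dA !idm_entry !wh_id !comp_id id_comp.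
- move=> X [[] []] []; rewrite c2 c1.
  change (lun X ∘ idm (unit_ob ⊗ X) ∘ (idm unit_ob ⊠ idm (ds1 X) tt tt)
    === lun (ds1 X) (tt, tt) tt).
  by rewrite dL idm_entry wh_id !comp_id.
- move=> X [[] []] [];rewrite c2 c1.
  change (run X ∘ idm (X ⊗ unit_ob) ∘ (idm (ds1 X) tt tt ⊠ idm unit_ob)
    === run (ds1 X) (tt, tt) tt).
  by rewrite dR idm_entry wh_id !comp_id.
- move=> X Y [[] []] []; rewrite c1 c2.
  by rewrite dB comp_id id_comp.
Defined.

Lemma hsum_entry (X Y : S) I (r : seq I) (F : I -> Mor X Y) (a : X) (b : Y) :
  (\big[hadd/hzero]_(i <- r) F i) a b = \big[hadd/hzero]_(i <- r) F i a b.
Proof. by elim: r => [|i r IH]; rewrite ?big_nil // !big_cons -IH. Qed.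

Lemma dsum_is_direct_sum (X : dsum D) :
  is_direct_sum (fun i => ds1 (fam X i)) (X : S).
Proof.
exists (fun i => fun _ j => dent (idm (fam X i)) j).
exists (fun i => fun j _ => dent (idm (fam X j)) i); split=> [i [] []|i j ij [] []|a b].
- rewrite (comp_dent (ds1 (fam X i)) X tt i (idm (fam X i))) // dent_eq comp_id.
  by rewrite idm_entry.
- rewrite (comp_dent (ds1 (fam X i)) X tt i (idm (fam X i))) // comp_id.
  by rewrite dent_neq // eq_sym.
- rewrite hsum_entry (hsum_pick (i := a)) => [|i ia].
    rewrite (comp_unique (ds1 (fam X a)) tt) => [|[]] //.
    by rewrite dent_eq comp_id.
  rewrite (comp_unique (ds1 (fam X i)) tt) => [|[]] //.
  by rewrite (dent_neq (idm (fam X a))) // comp_zeror.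
Qed.

End DirectSums.

(** * The universal category *)

Section ReflectLinear.
Context {K : fieldType} {B D : linsymmon K} {HD : linsymmon_laws D}.
Variable F : symmonfun B D.
Hypothesis HB : symmon_laws B.
Hypothesis inj : forall (X Y : B) (f g : Mor X Y), Fhom F f === Fhom F g -> f === g.
Hypothesis F_add : forall (X Y : B) (f g : Mor X Y),
  Fhom F (f ⊞ g) === Fhom F f ⊞ Fhom F g.
Hypothesis F_scale : forall (X Y : B) c (f : Mor X Y), Fhom F (c ·: f) === c ·: Fhom F f.
Hypothesis F_zero : forall (X Y : B), Fhom F (hzero : Mor X Y) === hzero.

Lemma reflect_linear_laws : linsymmon_laws B.
Proof.
split.
- exact: HB.
- move=> X Y f f' g g' ff gg; apply: inj.
  by rewrite !F_add (F_congr F ff) (F_congr F gg).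
- by move=> X Y c f f' ff; apply: inj; rewrite !F_scale (F_congr F ff).
all: move=> *; apply: inj.
all: rewrite ?(F_add, F_scale, F_zero, F_comp, Fhom_tens)
  ?(F_add, F_scale, F_zero, F_comp, Fhom_tens).
all: try linear_law HD.
- by rewrite (tens_addl HD) (comp_addr HD) (comp_addl HD).
- by rewrite (tens_addr HD) (comp_addr HD) (comp_addl HD).
- by rewrite (tens_scalel HD) (comp_scaler HD) (comp_scalel HD).
- by rewrite (tens_scaler HD) (comp_scaler HD) (comp_scalel HD).
Qed.

End ReflectLinear.

Section BendLinear.
Context {K : fieldType} {D : linsymmon K} {HD : linsymmon_laws D}.
Variables A B Bs C E Es S T : D.
Variables (e : Mor (Bs ⊗ B) unit_ob) (c' : Mor unit_ob (E ⊗ Es)).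
Variables (jo : Mor (A ⊗ E) S) (sp' : Mor T (B ⊗ C)).

Lemma gen_unbend_add f g :
  gen_unbend e c' jo sp' (f ⊞ g) === gen_unbend e c' jo sp' f ⊞ gen_unbend e c' jo sp' g.
Proof.
rewrite /gen_unbend (comp_addr HD) (comp_addl HD) (tens_addl HD) (tens_addr HD).
by rewrite (comp_addr HD) !(comp_addl HD).
Qed.

Lemma gen_unbend_scale c f :
  gen_unbend e c' jo sp' (c ·: f) === c ·: gen_unbend e c' jo sp' f.
Proof.
rewrite /gen_unbend (comp_scaler HD) (comp_scalel HD) (tens_scalel HD) (tens_scaler HD).
by rewrite (comp_scaler HD) !(comp_scalel HD).
Qed.

Lemma gen_unbend_zero : gen_unbend e c' jo sp' hzero === hzero.
Proof.
transitivity (gen_unbend e c' jo sp' (0 ·: hzero)).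
  by rewrite /gen_unbend scale_zerol.
by rewrite gen_unbend_scale scale_zerol.
Qed.

End BendLinear.

Section UniversalCategory.
Variables (r : nat) (K : fieldType).
Local Notation L := (lin_diagrams r K).

#[local] Instance lin_diagrams_laws : linsymmon_laws L :=
  @linearisation_laws K (diagrams r) (diagrams_laws r).

Let LS : symmon_laws L := base_laws lin_diagrams_laws.

(** Diagrams are compared only at objects equipped with a duality [d], where the turns evaluate to
    [ev d] and [coev d] and the claim is [zig d]. *)
Lemma string_zig :
  run (SW : L) ∘ (idm (SW : L) ⊠ (lc1 K (sev r : @Mor (diagrams r) _ _) : @Mor L _ _))
  ∘ assoc (SW : L) SWd SW ∘ ((lc1 K (scoev r : @Mor (diagrams r) _ _) : @Mor L _ _) ⊠ idm _)
  ∘ luni (SW : L) === idm (SW : L).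
Proof.
move=> phi P; rewrite -!/(lext _ _) !(lext_comp, lext_tens, lext_lc1).
by apply: P => D HD X d t; apply: (zig d).
Qed.

Lemma string_zag :
  lun (SWd : L) ∘ ((lc1 K (sev r : @Mor (diagrams r) _ _) : @Mor L _ _) ⊠ idm (SWd : L))
  ∘ associ (SWd : L) SW SWd
  ∘ (idm (SWd : L) ⊠ (lc1 K (scoev r : @Mor (diagrams r) _ _) : @Mor L _ _))
  ∘ runi (SWd : L) === idm (SWd : L).
Proof.
move=> phi P; rewrite -!/(lext _ _) !(lext_comp, lext_tens, lext_lc1).
by apply: P => D HD X d t; apply: (zag d).
Qed.

Definition string_dual : duality (SW : L) := Dual string_zig string_zag.

Lemma unbend_bend x y f : unbend (@bend r K x y f) === f.
Proof.
exact: (gen_bendK (pow_zag string_dual x.2) (pow_zag string_dual y.2)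
  (pow_joinK _ x.1 y.2) (pow_joinK _ x.2 y.1)).
Qed.

Lemma bend_unbend x y f : bend (@unbend r K x y f) === f.
Proof.
exact: (gen_unbendK (pow_zig string_dual x.2) (pow_zig string_dual y.2)
  (pow_splitK _ x.1 y.2) (pow_splitK _ x.2 y.1)).
Qed.

Lemma unbend_congr x y f g : f === g -> @unbend r K x y f === unbend g.
Proof. by move=> fg; rewrite /unbend fg. Qed.

Lemma bend_congr x y f g : f === g -> @bend r K x y f === bend g.
Proof. by move=> fg; rewrite /bend fg. Qed.

Lemma unbend_inj x y f g : @unbend r K x y f === unbend g -> f === g.
Proof. by move=> /bend_congr; rewrite !bend_unbend. Qed.

Lemma shK x y : shi r K x y ∘ sh r K x y === idm _.
Proof.
apply: comp_inv; last exact: mid4K.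
by rewrite -(tens_comp LS) !(pow_splitK (D := L)) wh_id.
Qed.

Lemma shiK x y : sh r K x y ∘ shi r K x y === idm _.
Proof.
apply: comp_inv; first exact: mid4K.
by rewrite -(tens_comp LS) !(pow_joinK (D := L)) wh_id.
Qed.

Arguments unbend_inj : clear implicits.
Arguments shK : clear implicits.
Arguments shiK : clear implicits.
Arguments unbend_bend : clear implicits.
Arguments bend_unbend : clear implicits.

Let whK (x y z : nat * nat) :
  (sh r K x y ⊠ idm (Wab r K z)) ∘ (shi r K x y ⊠ idm _) === idm _.
Proof. by rewrite -comp_wh (shiK _ _) wh_id. Qed.
Arguments whK : clear implicits.

(** The structure maps of [univ_W] are bent versions of those of [lin_diagrams], conjugated by [sh]
    and [shi]; so each axiom is a cancellation of [unbend] with [bend] and of [sh] with [shi]. Laws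
    of [univ_W] are not presupposed, which allows the functor to be used to derive them. *)
Definition unbend_functor : symmonfun (univ_W r K) L.
Proof.
unshelve refine (@SymMonFun (univ_W r K) L (@Wab r K) (@unbend r K) (u0i r K) (u0 r K)
  (@shi r K) (@sh r K) _ _ _ _ _ _ _ _ _ _ _ _).
- by move=> X Y f g; apply: unbend_congr.
- by move=> X; exact: unbend_bend.
- by move=> X Y Z g f; exact: unbend_bend.
- exact: (luniK LS).
- exact: (lunK LS).
- by move=> X Y; apply: shiK.
- by move=> X Y; apply: shK.
- by move=> X Y X' Y' f g; rewrite unbend_bend (cancel_r _ (shiK _ _)).
- by move=> X Y Z; rewrite unbend_bend (cancel_r _ (shiK _ _)) (cancel_r _ (whK _ _ _)).
- move=> X; rewrite unbend_bend (cancel_r _ (shiK _ _)) (cancel_r _ _) //.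
  by rewrite -comp_wh (luniK LS) wh_id.
- move=> X; rewrite unbend_bend (cancel_r _ (shiK _ _)) (cancel_r _ _) //.
  by rewrite -wh_comp (luniK LS) wh_id.
- by move=> X Y; rewrite unbend_bend (cancel_r _ (shiK _ _)).
Defined.

Local Notation U := unbend_functor.

Lemma univ_W_base_laws : symmon_laws (univ_W r K).
Proof.
have tK' (x y z : nat * nat) :
    (shi r K x y ⊠ idm (Wab r K z)) ∘ (sh r K x y ⊠ idm _) === idm _.
  by rewrite -comp_wh (shK _ _) wh_id.
have wK (x y z : nat * nat) :
    (idm (Wab r K z) ⊠ sh r K x y) ∘ (idm _ ⊠ shi r K x y) === idm _.
  by rewrite -wh_comp (shiK _ _) wh_id.
have wK' (x y z : nat * nat) :
    (idm (Wab r K z) ⊠ shi r K x y) ∘ (idm _ ⊠ sh r K x y) === idm _.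
  by rewrite -wh_comp (shK _ _) wh_id.
have uK (x : nat * nat) : (u0 r K ⊠ idm (Wab r K x)) ∘ (u0i r K ⊠ idm _) === idm _.
  by rewrite -comp_wh (luniK LS) wh_id.
have uK' (x : nat * nat) : (u0i r K ⊠ idm (Wab r K x)) ∘ (u0 r K ⊠ idm _) === idm _.
  by rewrite -comp_wh (lunK LS) wh_id.
have vK (x : nat * nat) : (idm (Wab r K x) ⊠ u0 r K) ∘ (idm _ ⊠ u0i r K) === idm _.
  by rewrite -wh_comp (luniK LS) wh_id.
have vK' (x : nat * nat) : (idm (Wab r K x) ⊠ u0i r K) ∘ (idm _ ⊠ u0 r K) === idm _.
  by rewrite -wh_comp (lunK LS) wh_id.
have bb (x y z : nat * nat) m n o : m ∘ n === o ->
    @unbend r K y z (bend m) ∘ @unbend r K x y (bend n) === o.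
  by move=> <-; apply: (comp_congr LS); apply: unbend_bend.
apply: (reflect_laws (F := U)); first by move=> X Y f g; apply: (unbend_inj X Y f g).
(* The hypotheses on inverses remain: the associators are composites of five invertible maps, the
   unitors of three. *)
all: move=> *; apply: bb; first [apply: comp_inv5 | apply: comp_inv3].
all: first [exact: shK | exact: shiK | exact: tK' | exact: whK | exact: wK | exact: wK'
  | exact: uK | exact: uK' | exact: vK | exact: vK' | exact: (assocK LS)
  | exact: (associK LS) | exact: (lunK LS) | exact: (luniK LS) | exact: (runK LS)
  | exact: (runiK LS)].
Qed.

Lemma univ_W_laws : linsymmon_laws (univ_W r K).
Proof.
apply: (@reflect_linear_laws _ _ _ _ U univ_W_base_laws) => [x y f g|x y f g|x y c f|x y].
- exact: (unbend_inj x y f g).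
- exact: gen_unbend_add.
- exact: gen_unbend_scale.
- exact: gen_unbend_zero.
Qed.

(** The tensor product of the duals has the powers of [SWd] in front. They are braided to the back,
    because only a dual of the form [Wab] can be pulled back to [univ_W]. *)
Definition Wab_dual (x : nat * nat) : duality (Wab r K x) :=
  @iso_dual L LS (Wab r K x) (Wab r K (x.2, x.1))
    (tens_dual (pow_dual string_dual x.1) (swap_dual (pow_dual string_dual x.2)))
    (braid (pow (SWd : L) x.1) (pow (SW : L) x.2))
    (braid (pow (SW : L) x.2) (pow (SWd : L) x.1))
    (braidK LS _ _) (braidK LS _ _).

#[local] Instance univ_W_laws_inst : linsymmon_laws (univ_W r K) := univ_W_laws.

Definition univ_dual (x : univ_W r K) : duality x :=
  @reflect_dual (univ_W r K) L univ_W_base_laws LS U unbend_inj (@bend r K)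
    unbend_bend x (x.2, x.1) (ev (Wab_dual x)) (coev (Wab_dual x))
    (zig (Wab_dual x)) (zag (Wab_dual x)).

Lemma pow_univ (n : nat) : pow ((1, 0)%N : univ_W r K) n = (n, 0)%N.
Proof.
elim: n => [|n IH]; first by [].
by change (opair (1, 0)%N (pow ((1, 0)%N : univ_W r K) n) = (n.+1, 0)%N); rewrite IH.
Qed.

Lemma pow_univ' (n : nat) : pow ((0, 1)%N : univ_W r K) n = (0, n)%N.
Proof.
elim: n => [|n IH]; first by [].
by change (opair (0, 1)%N (pow ((0, 1)%N : univ_W r K) n) = (0, n.+1)%N); rewrite IH.
Qed.

#[local] Instance C_univ_laws : linsymmon_laws (C_univ r K) := direct_sums_laws.

(** An equality of objects and not merely an isomorphism, since objects of [univ_W] are pairs of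
    numbers. *)
Lemma pow_univ_tens (a b : nat) :
  pow ((1, 0)%N : univ_W r K) a ⊗ pow ((0, 1)%N : univ_W r K) b = (a, b).
Proof.
rewrite pow_univ pow_univ'.
by change (opair (a, 0)%N (0, b)%N = (a, b)); rewrite /opair /= addn0.
Qed.

Definition ds1_univ_dual (x : univ_W r K) : duality (ds1 x : C_univ r K) :=
  image_dual ds1_functor (univ_dual x).

Lemma C_univ_dual (X : C_univ r K) : inhabited (duality X).
Proof.
pose T := @DSum _ (univ_W r K) (dsidx X) (fun i => dob (univ_dual (dsfam i))).
exact: (@direct_sum_dual _ (C_univ r K) _ _ _ (fun i => ds1_univ_dual (dsfam i)) X T
  (dsum_is_direct_sum X) (dsum_is_direct_sum T)).
Qed.

End UniversalCategory.

(** * Negligible morphisms *)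

Section Negligible.
Context {K : fieldType} {D : linsymmon K} {HD : linsymmon_laws D}.
Variable chi : Mor (unit_ob : D) unit_ob -> K.
Hypothesis chiP : algebra_hom chi.
Hypothesis duals : forall X : D, inhabited (duality X).

(* For this notion, equivalent to being negligible ([negligibleE]), the ideal
   axioms hold by absorbing the extra morphisms into the context (a, b). *)
Definition context_negligible (X Y : D) (f : Mor X Y) : Prop :=
  forall Z (a : Mor unit_ob (X ⊗ Z)) (b : Mor (Y ⊗ Z) unit_ob),
  chi (b ∘ ((f ⊠ idm Z) ∘ a)) = 0.

Lemma chi0 : chi hzero = 0.
Proof. by rewrite -(chi_heq chiP (scale_zerol hzero)) (chi_scale chiP) mul0r. Qed.

Lemma context_negligible_ideal : tensor_ideal context_negligible.
Proof.
have tr (X Y X' Y' : D) (g : Mor X' Y') (f : Mor X Y) :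
    context_negligible f -> context_negligible (f ⊠ g).
  move=> fN Z a b.
  (* The strand of [g] joins the auxiliary object, which becomes [X' ⊗ Z], and [g] is absorbed into
     [b]. *)
  rewrite -[RHS](fN _ (assoc X X' Z ∘ a) (b ∘ (((idm Y ⊠ g) ⊠ idm Z) ∘ associ Y X' Z))).
  apply: (chi_heq chiP); stk.
  by zrew (stg_nat (A := At X) (B := At Y) f (stg (At X') (At Y') g (Z ⊗ R))).
have cl (X Y Z : D) (g : Mor Y Z) (f : Mor X Y) :
    context_negligible f -> context_negligible (g ∘ f).
  move=> fN T a b; rewrite -[RHS](fN _ a (b ∘ (g ⊠ idm T))); apply: (chi_heq chiP).
  by rewrite comp_wh !compA.
have cr (X Y Z : D) (g : Mor Y Z) (f : Mor X Y) :
    context_negligible g -> context_negligible (g ∘ f).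
  move=> gN T a b; rewrite -[RHS](gN _ ((f ⊠ idm T) ∘ a) b); apply: (chi_heq chiP).
  by rewrite comp_wh !compA.
have he (X Y : D) (f g : Mor X Y) :
    f === g -> context_negligible f -> context_negligible g.
  by move=> fg fN Z a b; rewrite -(fN Z a b); apply: (chi_heq chiP); rewrite fg.
split=> //.
- move=> X Y Z a b; rewrite -chi0; apply: (chi_heq chiP).
  by rewrite tens_zerol comp_zerol comp_zeror.
- move=> X Y f g fN gN Z a b; rewrite -(addr0 0) -{1}(fN Z a b) -(gN Z a b) -(chi_add chiP).
  by apply: (chi_heq chiP); rewrite (tens_addl HD) (comp_addl HD) (comp_addr HD).
- move=> X Y c f fN Z a b; rewrite -(mulr0 c) -(fN Z a b) -(chi_scale chiP).
  by apply: (chi_heq chiP); rewrite (tens_scalel HD) (comp_scalel HD) (comp_scaler HD).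
(* Tensoring on the left is conjugate by the braiding to tensoring on the right. *)
- move=> X Y X' Y' g f fN; apply: (he _ _ (braid Y Y' ∘ ((f ⊠ g) ∘ braid X' X))).
    rewrite (comp_eq2_at _ (braid_nat (base_laws HD) f g)) (braidK (base_laws HD)).
    exact: comp_id.
  exact/cl/cr/tr.
Qed.

(** The hypothesis [duals] enters from left to right, where the trace condition has content only
    once [Y] has a dual. *)
Lemma negligibleE (X Y : D) (f : Mor X Y) : negligible chi f <-> context_negligible f.
Proof.
split=> [fN Z a b|fN g d].
  have [d] := duals Y.
  (* Chosen so that [f ∘ g] is the endomorphism of [trace_pair] for [b] and [(f ⊠ idm Z) ∘ a]. *)
  pose g := run X ∘ (idm X ⊠ (b ∘ braid Z Y)) ∘ assoc X Z Y ∘ (a ⊠ idm Y) ∘ luni Y.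
  have E : f ∘ g === run Y ∘ (idm Y ⊠ (b ∘ braid Z Y)) ∘ assoc Y Z Y
      ∘ (((f ⊠ idm Z) ∘ a) ⊠ idm Y) ∘ luni Y.
    rewrite /g; stk; zrew (stg_nat (A := At X) (B := At Y) f (ev_st b R)).
    by zrew (stg_nat (A := At X) (B := At Y) f (braid_st Z Y R)).
  rewrite -[RHS](fN g d); apply: (chi_heq chiP).
  by pose proof (trace_pair d ((f ⊠ idm Z) ∘ a) b) as T; rewrite -T /cat_trace E.
rewrite -[RHS](fN _ ((g ⊠ idm (dob d)) ∘ coev d) (ev d ∘ braid Y (dob d))).
by apply: (chi_heq chiP); rewrite /cat_trace comp_wh !compA.
Qed.

Lemma negligible_ideal : tensor_ideal (@negligible K D chi).
Proof.
have N := context_negligible_ideal.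
split=> *; try apply/negligibleE;
  repeat match goal with H : negligible _ _ |- _ => move/negligibleE: H => H end.
- by apply: (ideal_heq N); eassumption.
- exact: (ideal_zero N).
- exact: (ideal_add N).
- exact: (ideal_scale N).
- exact: (ideal_compl N).
- exact: (ideal_compr N).
- exact: (ideal_tensl N).
- exact: (ideal_tensr N).
Qed.

Lemma negligible_scalar (f : Mor unit_ob unit_ob) : negligible chi f -> chi f = 0.
Proof.
move=> /negligibleE/(_ unit_ob (luni unit_ob) (lun unit_ob)) <-; apply: (chi_heq chiP).
by stk.
Qed.

Lemma chi0_negligible (f : Mor (unit_ob : D) unit_ob) : chi f = 0 -> negligible chi f.
Proof.
move=> f0; apply/negligibleE => Z a b.
(* A scalar slides out of every context, after which multiplicativity of [chi] applies. *)
transitivity (chi (f ∘ (b ∘ a))); last by rewrite (chi_comp chiP) f0 mul0r.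
apply: (chi_heq chiP); stk.
by zrew (stg_nat (A := Un) (B := Un) f (stg (Te Un (At Z)) Un b R)).
Qed.

End Negligible.

(** * Frobenius algebras in Karoubi envelopes *)

Section FrobeniusKaroubi.
Context {r : nat} {K : fieldType} {D : linsymmon K} {HD : linsymmon_laws D}.
Variables (W : D) (t : tensors r W).
Hypothesis idemP : forall a, tP t a ∘ tP t a === tP t a.
Local Notation KD := (karoubi HD).
Local Notation P := (tP t).
Let S := base_laws HD.

Definition kar_im (a : 'Zmod_r) : karob D := KarOb (idemP a).

(** For the theory quotient this is [theory_algebra] by conversion. It is stated for any [D] with
    idempotent [P a] so as to apply also to the quotient by negligible morphisms. *)
Definition kar_algebra : frobdata r KD :=
  @FrobData r KD kar_im
    (fun a b c _ => @karm _ _ HD (kartens HD (kar_im a) (kar_im b)) (kar_im c) (tmu t))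
    (@karm _ _ HD (karone HD) (kar_im _) (teta t))
    (fun a b c _ => @karm _ _ HD (kar_im c) (kartens HD (kar_im a) (kar_im b)) (tDelta t))
    (@karm _ _ HD (kar_im _) (karone HD) (teps t)).

(** Together the following rules say that [kfun] strictly preserves the operations when its target
    is read as [with_endo D], whose structure maps carry the idempotents. Thus an axiom for
    [kar_algebra] becomes, under [kfun], the axiom for [endo_components] listed in the theory. *)
Lemma kfun_id (X : KD) : kfun (idm X) === kidem X.
Proof. by rewrite /= id_comp (kidemP X). Qed.

Lemma kfun_comp (X Y Z : KD) (g : Mor Y Z) (f : Mor X Y) :
  kfun (g ∘ f) === kfun g ∘ kfun f.
Proof. by rewrite /= compA kar_r (comp_assoc S) kar_l. Qed.

Lemma kfun_tens (X Y X' Y' : KD) (f : Mor X Y) (g : Mor X' Y') :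
  kfun (f ⊠ g) === kfun f ⊠ kfun g.
Proof. by rewrite /= -!(tens_comp S) !kar_r !kar_l. Qed.

Lemma kfun_add (X Y : KD) (f g : Mor X Y) : kfun (f ⊞ g) === kfun f ⊞ kfun g.
Proof. by rewrite /= (comp_addl HD) (comp_addr HD) !kar_r !kar_l. Qed.

Lemma kfun_scale (X Y : KD) c (f : Mor X Y) : kfun (c ·: f) === c ·: kfun f.
Proof. by rewrite /= (comp_scalel HD) (comp_scaler HD) kar_r kar_l. Qed.

Lemma kfun_assoc (X Y Z : KD) :
  kfun (assoc X Y Z)
  === assoc (kob X) (kob Y) (kob Z) ∘ ((kidem X ⊠ kidem Y) ⊠ kidem Z).
Proof. exact: (induces_assoc X Y Z).2. Qed.

Lemma kfun_associ (X Y Z : KD) :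
  kfun (associ X Y Z)
  === associ (kob X) (kob Y) (kob Z) ∘ (kidem X ⊠ (kidem Y ⊠ kidem Z)).
Proof. exact: (induces_associ X Y Z).2. Qed.

Lemma kfun_lun (X : KD) : kfun (lun X) === kidem X ∘ lun (kob X).
Proof. by rewrite (induces_lun X).2 /= (lun_nat S). Qed.

Lemma kfun_luni (X : KD) : kfun (luni X) === luni (kob X) ∘ kidem X.
Proof. exact: (induces_luni X).2. Qed.

Lemma kfun_run (X : KD) : kfun (run X) === kidem X ∘ run (kob X).
Proof. by rewrite (induces_run X).2 /= (run_nat S). Qed.

Lemma kfun_runi (X : KD) : kfun (runi X) === runi (kob X) ∘ kidem X.
Proof. exact: (induces_runi X).2. Qed.

Lemma kfun_braid (X Y : KD) :
  kfun (braid X Y) === braid (kob X) (kob Y) ∘ (kidem X ⊠ kidem Y).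
Proof. exact: (induces_braid X Y).2. Qed.

Local Notation A := kar_algebra.
Local Notation E := (endo_components t).

Lemma kfun_mu a b c (e : c = a + b - z1 r) : kfun (fmu A e) === fmu E e.
Proof. by rewrite /= compA. Qed.

Lemma kfun_eta : kfun (feta A) === feta E.
Proof. by rewrite /= comp_id. Qed.

Lemma kfun_Delta a b c (e : c = a + b + z1 r) : kfun (fDelta A e) === fDelta E e.
Proof. by rewrite /= compA. Qed.

Lemma kfun_eps : kfun (feps A) === feps E.
Proof. by rewrite /= id_comp. Qed.

Definition kfunE := (kfun_comp, kfun_tens, kfun_id, kfun_assoc, kfun_associ, kfun_lun,
  kfun_luni, kfun_run, kfun_runi, kfun_braid, kfun_mu, kfun_eta, kfun_Delta, kfun_eps).

Lemma kfun_N a : kfun (fN A a) === fN E a.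
Proof. by rewrite /fN /fdelta !kfunE. Qed.

Lemma kfun_hpow a (f : Mor (fC A a) (fC A a)) (g : Mor (fC E a) (fC E a)) n :
  kfun f === g -> kfun (hpow f n) === hpow g n.
Proof.
move=> fg; elim: n => [|n IH]; first exact: kfun_id.
by change (kfun (f ∘ hpow f n) === g ∘ hpow g n); rewrite kfun_comp fg IH.
Qed.

Lemma kfun_Npow a b : kfun (fNpow A a b) === fNpow E a b.
Proof. exact/kfun_hpow/kfun_N. Qed.

Hypothesis frobP : forall (X Y : with_endo D) (f g : Mor X Y), frob_axiom E f g ->
  (f : Mor (eob X) (eob Y)) === g.

Lemma kfun_twist a b : kfun (ftwist A a b) === ftwist E a b.
Proof. by rewrite /ftwist /fdelta !kfunE kfun_Npow. Qed.

Lemma kfun_inj (X Y : KD) (f g : Mor X Y) : kfun f === kfun g -> f === g.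
Proof. by []. Qed.

Lemma kar_algebra_laws : frob_laws A.
Proof.
move=> X Y f g [].
- move=> a b c ab bc abc e1 e2 e3 e4; apply: kfun_inj; rewrite !kfunE.
  exact: frobP (ax_assoc E e1 e2 e3 e4).
- move=> a b c ab bc abc e1 e2 e3 e4; apply: kfun_inj; rewrite !kfunE.
  exact: frobP (ax_coassoc E e1 e2 e3 e4).
- move=> a e; apply: kfun_inj; rewrite !kfunE; exact: frobP (ax_unitl E e).
- move=> a e; apply: kfun_inj; rewrite !kfunE; exact: frobP (ax_unitr E e).
- move=> a e; apply: kfun_inj; rewrite !kfunE; exact: frobP (ax_counitl E e).
- move=> a e; apply: kfun_inj; rewrite !kfunE; exact: frobP (ax_counitr E e).
- move=> a b c d x y e1 e2 e3 e4; apply: kfun_inj; rewrite !kfunE.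
  exact: frobP (ax_frobenius E e1 e2 e3 e4).
- move=> a b c e e'; apply: kfun_inj; rewrite !kfunE kfun_Npow.
  exact: frobP (ax_comml E e e').
- move=> a b c e e'; apply: kfun_inj; rewrite !kfunE kfun_Npow.
  exact: frobP (ax_commr E e e').
- move=> a; apply: kfun_inj; rewrite kfun_Npow kfunE; exact: frobP (ax_twist E a).
- move=> a b; apply: kfun_inj; rewrite !kfun_twist; exact: frobP (ax_twist_pair E a b).
- move=> a; apply: kfun_inj; rewrite (kfun_hpow _ (kfun_N a)) kfunE.
  exact: frobP (ax_order E a).
Qed.

Lemma kfun_sum (X Y : KD) I (s : seq I) (F : I -> Mor X Y) :
  kfun (\big[hadd/hzero]_(i <- s) F i) === \big[hadd/hzero]_(i <- s) kfun (F i).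
Proof.
elim: s => [|i s IH]; first by rewrite !big_nil /= comp_zerol comp_zeror.
by rewrite !big_cons -IH kfun_add.
Qed.

Lemma kar_algebra_direct_sum :
  (forall a b, a != b -> P a ∘ P b === hzero) ->
  \big[hadd/hzero]_a P a === idm W ->
  is_direct_sum (fC A) (kid W : KD).
Proof.
move=> orth sumP.
exists (fun a => @karm _ _ HD (kar_im a) (kid W) (P a)).
exists (fun a => @karm _ _ HD (kid W) (kar_im a) (P a)); split.
- move=> a; apply: kfun_inj; rewrite !kfunE /= ?(compA, id_comp, comp_id).
  by rewrite !idemP.
- move=> a b ab; apply: kfun_inj; rewrite !kfunE /= ?(compA, id_comp, comp_id).
  by rewrite (comp_eq_at _ (orth b a _)) 1?eq_sym // !(comp_zerol, comp_zeror).
- apply: kfun_inj; rewrite kfun_sum kfun_id -[X in _ === X]sumP.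
  by apply: hsum_congr => a; rewrite kfunE /= ?(compA, id_comp, comp_id) !idemP.
Qed.

End FrobeniusKaroubi.

(** * The category C_chi *)

Section FrobMorphisms.
Context {r : nat} {D : symmon} {HD : symmon_laws D}.

Definition frob_mor_comp (A B C : frobdata r D) (psi : frob_mor B C) (phi : frob_mor A B) :
  frob_mor A C.
Proof.
unshelve refine (@FrobMor r D A C (fun a => fmor psi a ∘ fmor phi a) _ _ _ _).
- move=> a b c e; rewrite compA (fmor_mu phi) (comp_eq2_at _ (fmor_mu psi e)).
  by rewrite (tens_comp HD).
- by rewrite compA (fmor_eta phi) (fmor_eta psi).
- move=> a b c e; rewrite (comp_eq2_at _ (fmor_Delta psi e)) (fmor_Delta phi).
  by rewrite (tens_comp HD) compA.
- by rewrite -(fmor_eps phi) -(fmor_eps psi) compA.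
Defined.

(** The morphism of algebras through [A] extends to a monoidal transformation from [Z] to [Z']. Its
    component at the unit object is forced by [ntr_one], and naturality at [Sigma] identifies the
    two invariants. *)
Lemma surface_invariant_eq (Bord : spin_bordism r) (A : frobdata r D)
    (Z Z' : symmonfun Bord D) (Sigma : closed_surface Bord) :
  tqft_of A Z -> tqft_of A Z' ->
  surface_invariant Z Sigma === surface_invariant Z' Sigma.
Proof.
move=> [phi _] [_ [psi' _]].
have [t _] := tqft_ff HD (frob_mor_comp psi' phi).
have t1 : t unit_ob === Fone Z' ∘ Fonei Z.
  by rewrite -(ntr_one t) compA (FoneiK Z) comp_id.
rewrite /surface_invariant -(ntr_one t) !compA -(comp_eq2_at _ (ntr_nat t Sigma)) t1.
by rewrite !compA (comp_id_at _ (FoneK Z')).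
Qed.

End FrobMorphisms.

Section DirectSumTransport.
Context {K : fieldType} {D : linsymmon K} {HD : linsymmon_laws D}.

Lemma quot_direct_sum (J : forall X Y : D, Mor X Y -> Prop) (I : finType) (Y : I -> D)
    (S : D) :
  tensor_ideal J -> is_direct_sum Y S -> is_direct_sum (D := quot_cat J) Y S.
Proof.
move=> HJ [inj [prj [pi1 pi0 ip]]]; exists inj, prj; split=> *; apply: (quot_of_heq HJ).
- exact: pi1.
- exact: pi0.
- exact: ip.
Qed.

#[local] Instance karoubi_laws_inst : linsymmon_laws (karoubi HD) := karoubi_laws.

Lemma kid_direct_sum (I : finType) (Y : I -> D) (S : D) :
  is_direct_sum Y S -> is_direct_sum (fun i => kid (Y i) : karoubi HD) (kid S).
Proof.
move=> [inj [prj [pi1 pi0 ip]]].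
exists (fun i => Fhom kid_functor (inj i)), (fun i => Fhom kid_functor (prj i)); split.
- by move=> i; exact: (Fhom_inv kid_functor (pi1 i)).
- move=> i j ij; apply: kfun_inj; rewrite kfun_comp /= !(id_comp, comp_id).
  by rewrite pi0.
- apply: kfun_inj; rewrite kfun_sum kfun_id -[X in _ === X]ip.
  by apply: hsum_congr => i; rewrite kfun_comp /= !(id_comp, comp_id).
Qed.

Lemma kar_summand (X : karoubi HD) : is_summand X (kid (kob X) : karoubi HD).
Proof.
exists (@karm _ _ HD X (kid (kob X)) (kidem X)), (@karm _ _ HD (kid (kob X)) X (kidem X)).
apply: kfun_inj; rewrite kfun_comp kfun_id /= !(id_comp, comp_id, compA).
by rewrite !(kidemP X).
Qed.

End DirectSumTransport.

(* [endo_ob D] and [endo_ob (quot_cat J)] are different types, so that the two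
   sides are not convertible. *)
Lemma hpow_quot (K : fieldType) (D : linsymmon K) (J : forall X Y : D, Mor X Y -> Prop)
    (X : with_endo D) (f : Mor X X) n :
  @hpow (with_endo D) X f n
  = @hpow (with_endo (quot_cat J)) (@EndoOb (quot_cat J) (eob X) (eend X)) f n
    :> @Mor D (eob X) (eob X).
Proof.
elim: n => [//|n IH].
by change (@compm D _ _ _ f (@hpow (with_endo D) X f n) = @compm D _ _ _ f
  (@hpow (with_endo (quot_cat J)) (@EndoOb (quot_cat J) (eob X) (eend X)) f n)); rewrite IH.
Qed.

Definition tensors_quot (r : nat) (K : fieldType) (D : linsymmon K)
    (J : forall X Y : D, Mor X Y -> Prop) (W : D) (t : tensors r W) :
    tensors r (W : quot_cat J) :=
  @Tensors r K (quot_cat J) W (tP t) (tmu t) (tDelta t) (teps t) (teta t).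

(** The axioms over [D] and over [quot_cat J] are built from the same morphisms. They are matched
    case by case, by conversion except where a power of [fN] occurs. *)
Lemma frob_axiom_quot (r : nat) (K : fieldType) (D : linsymmon K)
    (J : forall X Y : D, Mor X Y -> Prop) (W : D) (t : tensors r W) :
  (forall (X Y : with_endo D) (f g : Mor X Y), frob_axiom (endo_components t) f g ->
     (f : @Mor (quot_cat J) (eob X) (eob Y)) === g) ->
  forall (X Y : with_endo (quot_cat J)) (f g : Mor X Y),
    frob_axiom (endo_components (tensors_quot J t)) f g ->
    (f : Mor (eob X) (eob Y)) === g.
Proof.
pose E := endo_components t; have hE := hpow_quot J; move=> q X Y f g; case.
- move=> a b c ab bc abc e1 e2 e3 e4; exact (q _ _ _ _ (ax_assoc E e1 e2 e3 e4)).
- move=> a b c ab bc abc e1 e2 e3 e4; exact (q _ _ _ _ (ax_coassoc E e1 e2 e3 e4)).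
- move=> a e; exact (q _ _ _ _ (ax_unitl E e)).
- move=> a e; exact (q _ _ _ _ (ax_unitr E e)).
- move=> a e; exact (q _ _ _ _ (ax_counitl E e)).
- move=> a e; exact (q _ _ _ _ (ax_counitr E e)).
- move=> a b c d x y e1 e2 e3 e4; exact (q _ _ _ _ (ax_frobenius E e1 e2 e3 e4)).
- by move=> a b c e e'; move: (q _ _ _ _ (ax_comml E e e')); rewrite /fNpow !hE.
- by move=> a b c e e'; move: (q _ _ _ _ (ax_commr E e e')); rewrite /fNpow !hE.
- by move=> a; move: (q _ _ _ _ (ax_twist E a)); rewrite /fNpow !hE.
- by move=> a b; move: (q _ _ _ _ (ax_twist_pair E a b)); rewrite /ftwist /fNpow !hE.
- by move=> a; move: (q _ _ _ _ (ax_order E a)); rewrite !hE.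
Qed.

(* D plays the role of the category C_univ^T. *)
Section Main.
Context {r : nat} {K : fieldType} {D : linsymmon K} {HD : linsymmon_laws D}.
Hypothesis duals : forall X : D, inhabited (duality X).
Variable chi : Mor (unit_ob : D) unit_ob -> K.
Hypothesis chiP : algebra_hom chi.
Local Notation CN := (quot_cat (@negligible K D chi)).

Lemma chi_ideal : tensor_ideal (@negligible K D chi).
Proof. exact: negligible_ideal chiP duals. Qed.

#[local] Instance mod_negligible_laws : linsymmon_laws CN := quot_laws chi_ideal.
Local Notation KT := (karoubi HD).
Local Notation KN := (karoubi mod_negligible_laws).
#[local] Instance C_chi_laws : linsymmon_laws KN := karoubi_laws.
#[local] Instance kar_laws : linsymmon_laws KT := karoubi_laws.

Lemma coarsen (X Y : D) (f g : Mor X Y) : f === g -> (f : @Mor CN X Y) === g.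
Proof. exact: (quot_of_heq chi_ideal). Qed.

Variables (W : D) (t : tensors r W).
Hypothesis idemP : forall a, tP t a ∘ tP t a === tP t a.
Hypothesis frobP : forall (X Y : with_endo D) (f g : Mor X Y),
  frob_axiom (endo_components t) f g -> (f : Mor (eob X) (eob Y)) === g.
Hypothesis orthP : forall a b, a != b -> tP t a ∘ tP t b === hzero.
Hypothesis sumP : \big[hadd/hzero]_a tP t a === idm W.

Definition quot_idem a : tP (tensors_quot (@negligible K D chi) t) a ∘ tP (tensors_quot (@negligible K D chi) t) a === tP (tensors_quot (@negligible K D chi) t) a :=
  coarsen (idemP a).

Lemma frob_quot (X Y : with_endo CN) (f g : Mor X Y) :
  frob_axiom (endo_components (tensors_quot (@negligible K D chi) t)) f g -> (f : Mor (eob X) (eob Y)) === g.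
Proof. by apply: frob_axiom_quot => X' Y' f' g' /frobP/coarsen. Qed.

Definition alg : frobdata r KT := kar_algebra idemP.
Definition quot_alg : frobdata r KN := kar_algebra quot_idem.

Lemma quot_alg_laws : frob_laws quot_alg.
Proof. exact: kar_algebra_laws frob_quot. Qed.

Lemma quot_alg_direct_sum : is_direct_sum (fC quot_alg) (kid (W : CN) : KN).
Proof.
apply: kar_algebra_direct_sum => [a b ab|]; apply: coarsen; last exact: sumP.
exact: orthP.
Qed.

Definition coarse_ob (X : KT) : KN := @KarOb K CN (kob X) (kidem X) (coarsen (kidemP X)).

Definition coarse_mor (X Y : KT) (f : Mor X Y) : Mor (coarse_ob X) (coarse_ob Y) :=
  @KarHom K CN (coarse_ob X) (coarse_ob Y) (kfun f) (coarsen (kfunP f)).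

Variable Bord : spin_bordism r.

(** [Z] followed by the functor that the quotient induces on envelopes. As [quot_cat] keeps objects,
    morphisms and operations, every axiom is the coarsened axiom of [Z]. *)
Definition coarse_functor (Z : symmonfun Bord KT) : symmonfun Bord KN.
Proof.
unshelve refine (@SymMonFun Bord KN (fun X => coarse_ob (Z X))
  (fun X Y f => coarse_mor (Fhom Z f)) 
  (@KarHom K CN (unit_ob : KN) (coarse_ob (Z unit_ob)) (kfun (Fone Z))
    (coarsen (kfunP (Fone Z))))
  (@KarHom K CN (coarse_ob (Z unit_ob)) (unit_ob : KN) (kfun (Fonei Z))
    (coarsen (kfunP (Fonei Z))))
  (fun X Y => @KarHom K CN (coarse_ob (Z X) ⊗ coarse_ob (Z Y) : KN) (coarse_ob (Z (X ⊗ Y)))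
    (kfun (Ften Z X Y)) (coarsen (kfunP (Ften Z X Y))))
  (fun X Y => @KarHom K CN (coarse_ob (Z (X ⊗ Y))) (coarse_ob (Z X) ⊗ coarse_ob (Z Y) : KN)
    (kfun (Fteni Z X Y)) (coarsen (kfunP (Fteni Z X Y))))
  _ _ _ _ _ _ _ _ _ _ _ _).
- move=> X Y f g fg; exact: (coarsen (F_congr Z fg)).
- move=> X; exact: (coarsen (F_id Z X)).
- move=> X Y U g f; exact: (coarsen (F_comp Z g f)).
- exact: (coarsen (FoneK Z)).
- exact: (coarsen (FoneiK Z)).
- move=> X Y; exact: (coarsen (FtenK Z X Y)).
- move=> X Y; exact: (coarsen (FteniK Z X Y)).
- move=> X Y X' Y' f g; exact: (coarsen (Ften_nat Z f g)).
- move=> X Y U; exact: (coarsen (F_assoc Z X Y U)).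
- move=> X; exact: (coarsen (F_lun Z X)).
- move=> X; exact: (coarsen (F_run Z X)).
- move=> X Y; exact: (coarsen (F_braid Z X Y)).
Defined.

Lemma coarse_tqft (Z : symmonfun Bord KT) :
  tqft_of alg Z -> tqft_of quot_alg (coarse_functor Z).
Proof.
move=> [phi [psi phiK]].
unshelve eexists.
  unshelve refine (@FrobMor r KN (frob_image (coarse_functor Z) (circles Bord)) quot_alg
    (fun a => coarse_mor (fmor phi a)) _ _ _ _).
  - move=> a b c e; exact: (coarsen (fmor_mu phi e)).
  - exact: (coarsen (fmor_eta phi)).
  - move=> a b c e; exact: (coarsen (fmor_Delta phi e)).
  - exact: (coarsen (fmor_eps phi)).
unshelve eexists.
  unshelve refine (@FrobMor r KN quot_alg (frob_image (coarse_functor Z) (circles Bord))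
    (fun a => coarse_mor (fmor psi a)) _ _ _ _).
  - move=> a b c e; exact: (coarsen (fmor_mu psi e)).
  - exact: (coarsen (fmor_eta psi)).
  - move=> a b c e; exact: (coarsen (fmor_Delta psi e)).
  - exact: (coarsen (fmor_eps psi)).
move=> a; split; [exact: (coarsen (phiK a).1) | exact: (coarsen (phiK a).2)].
Qed.

Lemma chi_quot (f g : Mor (unit_ob : D) unit_ob) :
  (f : @Mor CN unit_ob unit_ob) === g -> chi f = chi g.
Proof.
move=> fg; apply/eqP; rewrite -subr_eq0; apply/eqP.
rewrite -[RHS](negligible_scalar chiP duals fg) (chi_add chiP) (chi_scale chiP).
by rewrite mulN1r.
Qed.

Definition theta (f : Mor (unit_ob : KN) unit_ob) : K := chi (kfun f).

Lemma theta_iso : algebra_iso theta.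
Proof.
split=> [|f g fg|c].
- split=> [f g fg|f g|c f|f g|].
  + exact: chi_quot fg.
  + by rewrite -(chi_add chiP); apply: (chi_quot (kfun_add f g)).
  + by rewrite -(chi_scale chiP); apply: (chi_quot (kfun_scale c f)).
  + by rewrite -(chi_comp chiP); apply: (chi_quot (kfun_comp f g)).
  + by rewrite -(chi_id chiP); apply: (chi_quot (kfun_id unit_ob)).
- apply: (@chi0_negligible _ _ _ _ chiP duals (kfun f ⊟ kfun g)).
  by rewrite (chi_add chiP) (chi_scale chiP) -/(theta f) fg mulN1r subrr.
- exists (@karm _ _ mod_negligible_laws (unit_ob : KN) (unit_ob : KN) (c ·: idm (unit_ob : CN))).
  rewrite -[RHS]mulr1 -(chi_id chiP) -(chi_scale chiP); apply/chi_quot/coarsen.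
  exact: (heq_trans (base_laws HD) (id_comp _) (comp_id _)).
Qed.

(** [surface_element] appears unfolded, with [alg] in place of [theory_algebra], so that the
    statement makes sense for any rigid [D] generated by an object with such tensors. *)
Theorem C_chi_spec (dW : duality W)
    (gen : forall X : D, exists (I : finType) (ab : I -> nat * nat),
      is_direct_sum (fun i => pow W (ab i).1 ⊗ pow (dob dW) (ab i).2) X) :
  exists (HN : linsymmon_laws CN),
    linsymmon_laws (karoubi HN) /\
    exists (V : karoubi HN) (Vd : duality V) (A : frobdata r (karoubi HN))
           (theta : Mor (unit_ob : karoubi HN) unit_ob -> K),
      [/\ tensor_generated Vd,
          frob_laws A /\ is_direct_sum (fC A) V,
          algebra_iso theta &
          (exists Z : symmonfun Bord (karoubi HN), tqft_of A Z) /\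
          forall Z : symmonfun Bord (karoubi HN), tqft_of A Z ->
          forall Sigma : closed_surface Bord,
            (exists s, exists Z : symmonfun Bord KT,
               tqft_of alg Z /\ kfun (surface_invariant Z Sigma) === s) /\
            (forall s, (exists Z : symmonfun Bord KT,
               tqft_of alg Z /\ kfun (surface_invariant Z Sigma) === s) ->
               theta (surface_invariant Z Sigma) = chi s)].
Proof.
exists mod_negligible_laws; split; first exact: karoubi_laws.
exists (kid (W : CN) : KN).
exists (@image_dual CN KN (base_laws mod_negligible_laws) (base_laws C_chi_laws) kid_functor W
  (quot_dual chi_ideal dW)).
exists quot_alg, theta; split.
- move=> X; have [I [ab gX]] := gen (kob X).
  exists I, ab, (kid (kob X) : KN); split; last exact: kar_summand.
  (* The decomposition of [kob X] survives the quotient and the embedding [kid]; its summands are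
     then images of powers, which have to be replaced by powers of the images. *)
  apply: direct_sum_iso (kid_direct_sum (quot_direct_sum chi_ideal gX)) => i.
  exact: (iso_image_pows (@kid_functor K CN mod_negligible_laws)).
- by split; [exact: quot_alg_laws | exact: quot_alg_direct_sum].
- exact: theta_iso.
split; first exact: (tqft_exists Bord (base_laws C_chi_laws) quot_alg_laws).
move=> Z AZ Sigma; split.
  have [Z0 AZ0] := tqft_exists Bord (base_laws kar_laws) (kar_algebra_laws frobP).
  by exists (kfun (surface_invariant Z0 Sigma)), Z0; split.
(* The coarsening of [Z0] is a TQFT for the same algebra as [Z], so both give the same scalar modulo
   negligible morphisms, which [chi] does not distinguish. *)
move=> s [Z0 [AZ0 Zs]]; rewrite -(chi_heq chiP Zs); apply: chi_quot.
exact: (surface_invariant_eq Sigma AZ (coarse_tqft AZ0)).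
Qed.

End Main.

(** * The quotient by the theory *)

Section TheoryQuotient.
Context {r : nat} {K : fieldType} {D : linsymmon K} {HD : linsymmon_laws D}.
Variables (W : D) (t : tensors r W).
Hypothesis duals : forall X : D, inhabited (duality X).
Local Notation CT := (theory_quotient t).

Lemma theory_ideal : tensor_ideal (generated_ideal (theory t)).
Proof. exact: generated_ideal_ideal. Qed.

#[local] Instance theory_quotient_laws : linsymmon_laws CT := quot_laws theory_ideal.

Lemma theory_quotient_duals (X : CT) : inhabited (duality X).
Proof. by have [d] := duals X; split; apply: (quot_dual theory_ideal d). Qed.

Local Notation theory_tensors := (tensors_quot (generated_ideal (theory t)) t).

Lemma theory_frob (X Y : with_endo CT) (f g : Mor X Y) :
  frob_axiom (endo_components theory_tensors) f g -> (f : Mor (eob X) (eob Y)) === g.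
Proof.
apply: frob_axiom_quot => X' Y' f' g' ax; exact: (theory_quotientP (th_frob (t := t) ax)).
Qed.

Theorem theory_quotient_spec (chi : Mor (unit_ob : CT) unit_ob -> K)
    (chiP : algebra_hom chi) (Bord : spin_bordism r) (dW : duality W)
    (gen : forall X : D, exists (I : finType) (ab : I -> nat * nat),
      is_direct_sum (fun i => pow W (ab i).1 ⊗ pow (dob dW) (ab i).2) X) :
  exists (HU : linsymmon_laws CT) (HN : linsymmon_laws (quot_cat (@negligible K CT chi))),
    linsymmon_laws (karoubi HN) /\
    exists (V : karoubi HN) (Vd : duality V) (A : frobdata r (karoubi HN))
           (theta : Mor (unit_ob : karoubi HN) unit_ob -> K),
      [/\ tensor_generated Vd,
          frob_laws A /\ is_direct_sum (fC A) V,
          algebra_iso theta &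
          (exists Z : symmonfun Bord (karoubi HN), tqft_of A Z) /\
          forall Z : symmonfun Bord (karoubi HN), tqft_of A Z ->
          forall Sigma : closed_surface Bord,
            (exists s, exists Z : symmonfun Bord (karoubi HU),
               tqft_of (theory_algebra HU) Z /\ kfun (surface_invariant Z Sigma) === s) /\
            (forall s, (exists Z : symmonfun Bord (karoubi HU),
               tqft_of (theory_algebra HU) Z /\ kfun (surface_invariant Z Sigma) === s) ->
               theta (surface_invariant Z Sigma) = chi s)].
Proof.
exists theory_quotient_laws.
have orthP a b : a != b -> tP theory_tensors a ∘ tP theory_tensors b === hzero.
  by move=> ab; exact (theory_quotientP (th_orth t ab)).
have sumP : \big[hadd/hzero]_a tP theory_tensors a === idm (W : CT).
  exact (theory_quotientP (th_sum t)).
have genT (X : CT) : exists (I : finType) (ab : I -> nat * nat),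
    is_direct_sum (fun i => pow (W : CT) (ab i).1
      ⊗ pow (dob (quot_dual theory_ideal dW)) (ab i).2) X.
  have [I [ab gX]] := gen X; exists I, ab; exact: (quot_direct_sum theory_ideal gX).
exact (@C_chi_spec r K CT theory_quotient_laws theory_quotient_duals chi chiP W theory_tensors
  (fun a => theory_quotientP (th_idem t a)) theory_frob orthP sumP Bord _ genT).
Qed.

End TheoryQuotient.

Lemma C_univ_generated (r : nat) (K : fieldType) (X : C_univ r K) :
  exists (I : finType) (ab : I -> nat * nat),
    is_direct_sum (fun i => pow (Wpq r K 1 0) (ab i).1
      ⊗ pow (dob (ds1_univ_dual (r := r) (K := K) (1, 0)%N)) (ab i).2) X.
Proof.
pose HC := C_univ_laws r K; pose HW := univ_W_laws r K.
exists (dsidx X), (fun i => dsfam i).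
refine (@direct_sum_iso K (C_univ r K) HC _ _ _ X _ (@dsum_is_direct_sum K _ HW X)) => i.
(* A formal sum already lists its exponents. What remains is to identify [ds1] of a pair with a
   product of powers of [ds1], through this equality and the monoidality of [ds1_functor]. *)
have E := pow_univ_tens r K (dsfam i).1 (dsfam i).2.
pose proof (@iso_image_pows _ _ (base_laws HC) (@ds1_functor K _ HW)
  ((1, 0)%N : univ_W r K) ((0, 1)%N : univ_W r K) (dsfam i).1 (dsfam i).2) as I.
rewrite E -surjective_pairing in I; exact: I.
Qed.

Theorem proposition4p6 (r : nat) (hr : (1 <= r)%N)
  (K : fieldType) (hK : [pchar K] =i pred0)
  (Bord : spin_bordism r)
  (chi : Mor (unit_ob : C_univ_T r K) unit_ob -> K)
  (hchi : algebra_hom chi) :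
  exists (HU : linsymmon_laws (C_univ_T r K))
         (HN : linsymmon_laws (C_univ_T_mod chi)),
    linsymmon_laws (C_chi HN) /\
    exists (W : C_chi HN) (Wd : duality W) (A : frobdata r (C_chi HN))
           (theta : Mor (unit_ob : C_chi HN) unit_ob -> K),
      [/\ tensor_generated Wd,
          frob_laws A /\ is_direct_sum (fC A) W,
          algebra_iso theta &
          (exists Z : symmonfun Bord (C_chi HN), tqft_of A Z) /\
          forall Z : symmonfun Bord (C_chi HN), tqft_of A Z ->
          forall Sigma : closed_surface Bord,
            (exists s, surface_element HU Sigma s) /\
            (forall s, surface_element HU Sigma s ->
               theta (surface_invariant Z Sigma) = chi s)].
Proof.
exact (@theory_quotient_spec r K (C_univ r K) (C_univ_laws r K) (Wpq r K 1 0)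
  (univ_tensors r K) (@C_univ_dual r K) chi hchi Bord (ds1_univ_dual (1, 0)%N)
  (@C_univ_generated r K)).
Qed.
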